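(* There is an absolute constant $C$ such that the following holds. Let $\Phi:\mathbb{R}^{n\times n}\to\mathbb{R}^m$ be the random linear operator $\Phi(Z)_k=\langle\Phi_k,Z\rangle$, $k=1,\dots,m$, where the entries $\Phi_{kij}$ of the matrices $\Phi_k\in\mathbb{R}^{n\times n}$ are i.i.d. $N(0,1)$. Let $X\in\Sigma_s^{n\times n}$ be a columnwise $s$-sparse and $l_1$-column-flat matrix signal, let $y=\Phi(X)+e\in\mathbb{R}^m$ with $|e|_2\le\eta$, and let $X^*$ be the minimizer of $$\inf|||Z|||_1\quad\text{s.t. }Z\in\mathbb{R}^{n\times n},\ |y-\Phi(Z)|_2\le\eta.$$ Let $t>0$ and $\delta>0$. If $$m\ge\Big(t+\frac{2\eta}{\delta}+\big(ns\log(Cn^6)\big)^{1/2}\Big)^2,$$ then $$P\big[|X^*-X|_F\le\delta\big]\ge1-\exp(-t^2/2).$$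
   Context: For $Z=(z_1,\dots,z_n)\in\mathbb{R}^{n\times n}$ with columns $z_j$, $|||Z|||_1:=\max_j|z_j|_1$ ($|\cdot|_1$ the vector $l_1$-norm). $\Sigma_s^{n\times n}$ is the set of $n\times n$ real matrices each of whose columns has at most $s$ nonzero entries. $X$ is $l_1$-column-flat if all its columns have the same $l_1$-norm. $\langle\cdot,\cdot\rangle$ on matrices is $\langle X,Y\rangle=\mathrm{tr}(X^TY)$, $|\cdot|_F$ is the Frobenius norm, $|\cdot|_2$ the Euclidean norm. Throughout the paper it is assumed that $0\le\eta<|y|_2$ in this problem. *)

(* Defs.v *)
From HB Require Import structures.
From mathcomp Require Import all_boot all_order all_algebra.
From mathcomp Require Import all_classical all_reals all_analysis.

Set Implicit Arguments.
Unset Strict Implicit.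
Unset Printing Implicit Defensive.

Import Order.TTheory GRing.Theory Num.Theory.

Local Open Scope classical_set_scope.
Local Open Scope ring_scope.

Definition l1norm (R : realType) (m : nat) (v : 'cV[R]_m) : R :=
  \sum_(i < m) `|v i 0|.

Definition l2norm (R : realType) (m : nat) (v : 'cV[R]_m) : R :=
  Num.sqrt (\sum_(i < m) v i 0 ^+ 2).

(* |||Z|||_1 *)
Definition maxcol_l1norm (R : realType) (n : nat) (Z : 'M[R]_n) : R :=
  \big[Num.max/0]_(j < n) l1norm (col j Z).

Definition mxdot (R : realType) (n : nat) (X Y : 'M[R]_n) : R :=
  \tr (X^T *m Y).

(* The norm built into the library on matrices is the sup norm. *)
Definition frobenius_norm (R : realType) (n : nat) (Z : 'M[R]_n) : R :=
  Num.sqrt (mxdot Z Z).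

Definition column_sparse (R : realType) (n s : nat) (Z : 'M[R]_n) : Prop :=
  forall j : 'I_n, (#|[set i : 'I_n | Z i j != 0%R]%SET| <= s)%N.

Definition l1_column_flat (R : realType) (n : nat) (X : 'M[R]_n) : Prop :=
  forall j k : 'I_n, l1norm (col j X) = l1norm (col k X).

Definition measurement (R : realType) (m n : nat) (Phi : 'I_m -> 'M[R]_n)
    (Z : 'M[R]_n) : 'cV[R]_m :=
  \col_k mxdot (Phi k) Z.

(* Minimizers need not be unique; any of them is accepted. *)
Definition is_minimizer (R : realType) (m n : nat) (Phi : 'I_m -> 'M[R]_n)
    (y : 'cV[R]_m) (eta : R) (Xstar : 'M[R]_n) : Prop :=
  l2norm (y - measurement Phi Xstar) <= eta /\
  forall Z : 'M[R]_n, l2norm (y - measurement Phi Z) <= eta ->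
    maxcol_l1norm Xstar <= maxcol_l1norm Z.

Definition mutually_independent (R : realType) (d : measure_display)
    (T : measurableType d) (P : probability T R) (I : finType)
    (X : I -> {RV P >-> R}) : Prop :=
  forall (J : {set I}) (B : I -> set R),
    (forall i, measurable (B i)) ->
    P (\bigcap_(i in [set` J]) (X i @^-1` B i)) =
      (\prod_(i in J) P (X i @^-1` B i))%E.

Definition iid_standard_normal (R : realType) (d : measure_display)
    (T : measurableType d) (P : probability T R) (I : finType)
    (X : I -> {RV P >-> R}) : Prop :=
  mutually_independent X /\
  forall (i : I) (B : set R), measurable B ->
    distribution P (X i) B = normal_prob 0 1 B.

(* Main.v *)
(* The error H = Xstar - X satisfies |Phi H|_2 <= 2 eta, and column flatness makes
   it a descent direction of the entrywise l1 norm at X.  By Gordon's escape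
   theorem Phi is bounded below by 2 eta / delta on the unit vectors of the
   descent cone, whose Gaussian width is at most about sqrt (n s (15 + 6 ln n)).
   Gordon's comparison is obtained for a smoothed indicator F by Lindeberg's
   method: expectations of F at Gaussian vectors are iterated one-dimensional
   Gaussian integrals, those integrals commute, and cutting each into k pieces of
   variance 1/k reduces the comparison to the sums of second derivatives of F.
   Concentration of measure is replaced by exponential moments: on both sides of
   the comparison the error probability is weighted against a deviation of order
   t, which costs only additive constants, absorbed by C = exp 251. *)

Require Import Defs.
From HB Require Import structures.
From mathcomp Require Import all_boot all_order all_algebra.
From mathcomp Require Import all_classical all_reals all_analysis.
From mathcomp Require Import measurable_realfun ring lra.

Set Implicit Arguments.
Unset Strict Implicit.
Unset Printing Implicit Defensive.

Import Order.TTheory GRing.Theory Num.Theory.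

Local Open Scope classical_set_scope.
Local Open Scope ring_scope.

(** * Gaussian integrals on the line *)

(** The weighting has an exact budget. With $l=t+1$ and $r=2\eta/\delta$, the common scalar of the
    matrix process is below $-l$ with probability at least $e^{-(l+1)^2/2}/4$; there it lowers every
    level by $l$, and the bound must survive division by this probability. The vector process gives
    $2e^{l^2+l(4+r-t+W-\sqrt m)}$, where $W=\sqrt{ns(15+6\ln n)}$. If $\sqrt m\ge t+r+W+11$, the
    quotient has exponent at most $-t^2/2-4$, and $e^4\ge 16$ absorbs the constant factors 2 and 8.
    The constant in the logarithm is there to buy the 11. The coefficient 6, hence the power $n^6$,
    is $3\cdot 2$: the squared distance from a Gaussian to a dilated subdifferential is integrated
    in the exponential with factor 1/3, and the dilation has square $2\ln n$. The comparison
    concerns finitely many directions, but its bound does not depend on their number. A dense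
    sequence in the cone is therefore reached by monotone limits and no covering number enters; one
    unit of the slack pays for approximating a direction by a member of the sequence. *)

Lemma ge0_integral_normal_prob (R : realType) (a b : R) (f : R -> \bar R) :
  measurable_fun [set: R] f -> (forall x, (0 <= f x)%E) ->
  (\int[normal_prob a b]_x f x =
   \int[lebesgue_measure]_x (f x * (normal_pdf a b x)%:E))%E.
Proof.
move=> mf f0.
have dom := @normal_prob_dominates R a b.
rewrite -(Radon_Nikodym_SigmaFinite.change_of_variables dom)//.
apply: ae_eq_integral => //.
- apply: emeasurable_funM => //.
  exact: measurable_int (Radon_Nikodym_SigmaFinite.f_integrable dom).
- apply: emeasurable_funM => //; apply/measurable_EFinP.
  exact: measurable_normal_pdf.
(* The Radon-Nikodym derivative is fixed up to null sets by its integrals over measurable sets, and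
   the density has the same integrals. *)
- apply: ae_eqe_mul2l => /=.
  apply: integral_ae_eq => //=.
  + exact: Radon_Nikodym_SigmaFinite.f_integrable.
  + by apply/measurable_EFinP; exact: measurable_normal_pdf.
  + by move=> E E01 mE; rewrite -Radon_Nikodym_SigmaFinite.f_integral.
Qed.

(** The image of Lebesgue measure under $x\mapsto c+bx$, scaled by $|b|$, gives half-open intervals
    their length, which characterises Lebesgue measure. For $b<0$ the preimage is closed on the
    other side, hence two cases. *)
Lemma ge0_lebesgue_affine (R : realType) (c b : R) (f : R -> \bar R) :
  b != 0 -> measurable_fun [set: R] f -> (forall x, (0 <= f x)%E) ->
  (`|b|%:E * \int[lebesgue_measure]_x f (c + b * x)%R =
   \int[lebesgue_measure]_x f x)%E.
Proof.
move=> b0 mf f0.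
pose phi := fun x : measurableTypeR R => (c + b * x : measurableTypeR R).
have mphi : measurable_fun setT phi.
  by apply: measurable_funD => //; apply: measurable_funM.
pose nu0 : {measure set _ -> \bar R} := pushforward (@lebesgue_measure R) phi.
pose nu := nu0 mphi.
have nb0 : 0 < `|b| by rewrite normr_gt0.
pose bb := NngNum (ltW nb0).
transitivity (\int[mscale bb nu]_x f x)%E; last first.
  apply: eq_measure_integral => A mA _.
  apply/esym/lebesgue_measure_unique => //= _ [[u v]] _ <-.
  rewrite /mscale/= /nu /pushforward.
  have [b_gt0|b_lt0|/eqP] := ltrgtP b 0; last by rewrite (negbTE b0).
  - rewrite (_ : phi @^-1` _ = `[(v - c) / b, (u - c) / b[%classic); last first.
      apply/seteqP; split => x /=; rewrite /phi !in_itv/= => /andP[h1 h2]; apply/andP; split.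
      - by rewrite ler_ndivrMr//; lra.
      - by rewrite ltr_ndivlMr//; lra.
      - by move: h2; rewrite ltr_ndivlMr//; lra.
      - by move: h1; rewrite ler_ndivrMr//; lra.
    rewrite !lebesgue_measure_itv/= !lte_fin ltr_nM2r ?invr_lt0// ltrD2r.
    case: ifPn => _; last by rewrite mule0.
    rewrite -EFinM -!EFinB; congr EFin.
    by rewrite ltr0_norm//; field.
  - rewrite (_ : phi @^-1` _ = `](u - c) / b, (v - c) / b]%classic); last first.
      apply/seteqP; split => x /=; rewrite /phi !in_itv/= => /andP[h1 h2]; apply/andP; split.
      - by rewrite ltr_pdivrMr//; lra.
      - by rewrite ler_pdivlMr//; lra.
      - by move: h1; rewrite ltr_pdivrMr//; lra.
      - by move: h2; rewrite ler_pdivlMr//; lra.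
    rewrite !lebesgue_measure_itv/= !lte_fin ltr_pM2r ?invr_gt0// ltrD2r.
    case: ifPn => _; last by rewrite mule0.
    rewrite -EFinM -!EFinB; congr EFin.
    by rewrite gtr0_norm//; field.
rewrite ge0_integral_mscale//=; congr (_ * _)%E.
by rewrite ge0_integral_pushforward.
Qed.

Lemma normal_pdf_std (R : realType) (a b x : R) : 0 < b ->
  normal_pdf a b x = b^-1 * normal_pdf 0 1 ((x - a) / b).
Proof.
move=> b0; rewrite !normal_pdfE ?oner_eq0 ?gt_eqF// /normal_peak /normal_fun.
rewrite subr0 expr1n -mulrnAr sqrtrM ?sqr_ge0// sqrtr_sqr gtr0_norm//.
rewrite invfM mul1r mulrA; congr (_ * expR _).
by field; rewrite gt_eqF.
Qed.

Lemma normal_pdf01E (R : realType) (x : R) :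
  normal_pdf 0 1 x = normal_peak 1 * expR (- x ^+ 2 / 2).
Proof. by rewrite normal_pdfE ?oner_eq0// /normal_fun subr0 expr1n. Qed.

(** Completing the square: the joint density of $s$ and $x=as+bt$ is the density of $x$ times the
    conditional density of $s$ given $x$, which is normal with mean $ax/r^2$ and deviation $b/r$. *)
Lemma normal_pdf_convolution (R : realType) (a b r s x : R) :
  0 < a -> 0 < b -> 0 < r -> r ^+ 2 = a ^+ 2 + b ^+ 2 ->
  normal_pdf 0 1 s * (b^-1 * normal_pdf 0 1 ((x - a * s) / b)) =
  r^-1 * normal_pdf 0 1 (x / r) * normal_pdf (a * x / r ^+ 2) (b / r) s.
Proof.
move=> a0 b0 r0 e.
rewrite [normal_pdf (a * x / _) _ _]normal_pdf_std ?divr_gt0// !normal_pdf01E.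
rewrite [LHS](_ : _ = normal_peak 1 ^+ 2 * b^-1 *
  (expR (- s ^+ 2 / 2) * expR (- ((x - a * s) / b) ^+ 2 / 2))); last by ring.
rewrite [RHS](_ : _ = normal_peak 1 ^+ 2 * b^-1 * (expR (- (x / r) ^+ 2 / 2) *
   expR (- ((s - a * x / r ^+ 2) / (b / r)) ^+ 2 / 2))); last first.
  by field; rewrite !gt_eqF.
congr (_ * _); rewrite -!expRD; congr expR.
have -> : (s - a * x / r ^+ 2) / (b / r) = (r ^+ 2 * s - a * x) / (r * b).
  by field; rewrite !gt_eqF.
rewrite !expr_div_n exprMn e.
have e0 : a ^+ 2 + b ^+ 2 != 0 by rewrite -e expf_neq0 ?gt_eqF.
by field; rewrite e0 gt_eqF.
Qed.

(** Substitute $x=as+bt$ in the inner integral, exchange the integrals, and integrate $s$ out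
    against its conditional density, of total mass 1. *)
Lemma ge0_gauss_stable (R : realType) (a b r : R) (f : R -> \bar R) :
  0 < a -> 0 < b -> 0 < r -> r ^+ 2 = a ^+ 2 + b ^+ 2 ->
  measurable_fun [set: R] f -> (forall x, (0 <= f x)%E) ->
  (\int[normal_prob 0 1]_s \int[normal_prob 0 1]_t f (a * s + b * t)%R =
   \int[normal_prob 0 1]_u f (r * u)%R)%E.
Proof.
move=> a0 b0 r0 e mf f0.
have mpdf : measurable_fun [set: R] (fun x : R => (normal_pdf 0 1 x)%:E).
  by apply/measurable_EFinP; exact: measurable_normal_pdf.
have pdf0 x : (0 <= (normal_pdf (0 : R) 1 x)%:E)%E by rewrite lee_fin normal_pdf_ge0.
have maff (c k : R) : measurable_fun [set: R] (fun x : R => c + k * x).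
  by apply: measurable_funD => //; apply: measurable_funM.
have mdiv (c k : R) : measurable_fun [set: R] (fun x : R => (x - c) / k).
  by apply: measurable_funM => //; apply: measurable_funB.
have inner s : (\int[normal_prob 0 1]_t f (a * s + b * t)%R =
    \int[lebesgue_measure]_x (f x * (b^-1 * normal_pdf 0 1 ((x - a * s) / b))%:E))%E.
  rewrite ge0_integral_normal_prob//; last first.
    exact: (measurableT_comp mf).
  under [RHS]eq_integral do rewrite EFinM muleCA.
  rewrite ge0_integralZl//; last 3 first.
  - by apply: emeasurable_funM => //; apply: (measurableT_comp mpdf); exact: mdiv.
  - by move=> x _; rewrite mule_ge0.
  - by rewrite lee_fin invr_ge0 ltW.
  pose g x := (f x * (normal_pdf 0 1 ((x - a * s) / b))%:E)%E.
  have mg : measurable_fun [set: R] g.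
    by apply: emeasurable_funM => //; apply: (measurableT_comp mpdf); exact: mdiv.
  have g0 x : (0 <= g x)%E by rewrite mule_ge0.
  rewrite -[X in (_ * X)%E](ge0_lebesgue_affine (a * s) (lt0r_neq0 b0) mg g0).
  rewrite gtr0_norm// muleA -EFinM mulVf ?gt_eqF// mul1e.
  apply: eq_integral => t _; congr (_ * _%:E)%E; congr normal_pdf.
  by field; rewrite gt_eqF.
pose k (z : measurableTypeR R * measurableTypeR R) :=
  (f z.2 * (b^-1 * normal_pdf 0 1 ((z.2 - a * z.1) / b))%:E)%E.
have mk : measurable_fun setT k.
  apply: emeasurable_funM; first exact: (measurableT_comp mf).
  apply/measurable_EFinP/measurable_funM => //.
  apply: (measurableT_comp (measurable_normal_pdf _ _)).
  apply: measurable_funM => //; apply: measurable_funB => //.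
  by apply: measurable_funM.
have k0 z : (0 <= k z)%E.
  by rewrite mule_ge0// lee_fin mulr_ge0 ?normal_pdf_ge0// invr_ge0 ltW.
have mk1 : measurable_fun setT (fun z => k z * (normal_pdf 0 1 z.1)%:E)%E.
  by apply: emeasurable_funM => //; exact: (measurableT_comp mpdf).
under eq_integral do rewrite inner.
rewrite [LHS]ge0_integral_normal_prob; last 2 first.
- exact: (measurable_fun_fubini_tonelli_F (m2 := lebesgue_measure) k mk k0).
- by move=> s; apply: integral_ge0 => x _; exact: (k0 (s, x)).
transitivity (\int[lebesgue_measure]_s \int[lebesgue_measure]_x
   (k (s, x) * (normal_pdf 0 1 s)%:E))%E.
  apply: eq_integral => s _; rewrite ge0_integralZr//.
  by apply: (measurableT_comp mk); exact: measurable_pair1.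
rewrite (fubini_tonelli (fun z => k z * (normal_pdf 0 1 z.1)%:E)%E)//=; last first.
  by move=> z; rewrite mule_ge0.
rewrite [RHS]ge0_integral_normal_prob//; last first.
  by apply: (measurableT_comp mf); apply: measurable_funM.
transitivity (\int[lebesgue_measure]_x (f x * (r^-1 * normal_pdf 0 1 (x / r))%:E))%E.
  apply: eq_integral => x _.
  under eq_integral => s _.
    rewrite /k/= -muleA -EFinM (mulrC (b^-1 * _)) (normal_pdf_convolution _ _ a0 b0 r0 e) EFinM.
    over.
  rewrite ge0_integralZl//; last 2 first.
  - apply: emeasurable_funM => //; apply/measurable_EFinP; exact: measurable_normal_pdf.
  - by move=> s _; rewrite mule_ge0// lee_fin ?mulr_ge0 ?normal_pdf_ge0// invr_ge0 ltW.
  congr (_ * _)%E; rewrite ge0_integralZl//; last 3 first.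
  - apply/measurable_EFinP; exact: measurable_normal_pdf.
  - by move=> s _; rewrite lee_fin normal_pdf_ge0.
  - by rewrite lee_fin ?mulr_ge0 ?normal_pdf_ge0// invr_ge0 ltW.
  by rewrite integral_normal_pdf mule1.
under eq_integral do rewrite EFinM muleCA.
rewrite ge0_integralZl//; last 3 first.
- by apply: emeasurable_funM => //; apply: (measurableT_comp mpdf); exact: measurable_funM.
- by move=> s _; rewrite mule_ge0.
- by rewrite lee_fin invr_ge0 ltW.
pose g x := (f x * (normal_pdf 0 1 (x / r))%:E)%E.
have mg : measurable_fun [set: R] g.
  by apply: emeasurable_funM => //; apply: (measurableT_comp mpdf); exact: measurable_funM.
have g0 x : (0 <= g x)%E by rewrite mule_ge0.
rewrite -[X in (_ * X)%E](ge0_lebesgue_affine 0 (lt0r_neq0 r0) mg g0).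
rewrite gtr0_norm// muleA -EFinM mulVf ?gt_eqF// mul1e.
by apply: eq_integral => t _; rewrite /g add0r mulrAC mulfV ?gt_eqF// mul1r.
Qed.

(** Gaussian moments are bounded below by comparing integrands: once a square is completed, the
    integrand is at most [K] times another normal density, whose integral is 1. *)
Lemma integral_expR_le_normal (R : realType) (K a b : R) (f : R -> R) :
  0 < b -> 0 <= K -> measurable_fun [set: R] f -> (forall x, 0 <= f x) ->
  (forall x, f x * normal_pdf 0 1 x <= K * normal_pdf a b x) ->
  (\int[normal_prob 0 1]_x (f x)%:E <= K%:E)%E.
Proof.
move=> b0 K0 mf f0 le; rewrite ge0_integral_normal_prob; last 2 first.
- exact/measurable_EFinP.
- by move=> x; rewrite lee_fin.
apply: (@le_trans _ _ (\int[lebesgue_measure]_x (K%:E * (normal_pdf a b x)%:E))%E).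
  apply: ge0_le_integral => //.
  - by move=> x _; rewrite mule_ge0// lee_fin// normal_pdf_ge0.
  - apply: emeasurable_funM; apply/measurable_EFinP => //; exact: measurable_normal_pdf.
  - apply: emeasurable_funM; apply/measurable_EFinP => //; exact: measurable_normal_pdf.
  - by move=> x _; rewrite -!EFinM lee_fin.
rewrite ge0_integralZl//; last 2 first.
- apply/measurable_EFinP; exact: measurable_normal_pdf.
- by move=> s _; rewrite lee_fin normal_pdf_ge0.
by rewrite integral_normal_pdf mule1.
Qed.

Lemma normal_pdfNx (R : realType) (x : R) : normal_pdf 0 1 (- x) = normal_pdf 0 1 x.
Proof. by rewrite !normal_pdf01E sqrrN. Qed.

Lemma ge0_gauss_sym (R : realType) (f : R -> \bar R) :
  measurable_fun [set: R] f -> (forall x, (0 <= f x)%E) ->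
  (\int[normal_prob 0 1]_s f (- s)%R = \int[normal_prob 0 1]_s f s)%E.
Proof.
move=> mf f0.
have mpdf : measurable_fun [set: R] (fun x : R => (normal_pdf 0 1 x)%:E).
  by apply/measurable_EFinP; exact: measurable_normal_pdf.
have mo : measurable_fun [set: R] (fun x : R => - x) by exact: measurable_funN.
rewrite !ge0_integral_normal_prob//; last exact: (measurableT_comp mf).
pose g x := (f x * (normal_pdf 0 1 x)%:E)%E.
have mg : measurable_fun [set: R] g by exact: emeasurable_funM.
have g0 x : (0 <= g x)%E by rewrite mule_ge0// lee_fin normal_pdf_ge0.
have n1 : (-1 : R) != 0 by rewrite oppr_eq0 oner_eq0.
rewrite -[RHS](ge0_lebesgue_affine 0 n1 mg g0) normrN normr1 mul1e.
by apply: eq_integral => x _; rewrite /g add0r mulN1r normal_pdfNx.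
Qed.

Lemma measurable_normr_id (R : realType) : measurable_fun [set: R] (fun x : R => `|x|).
Proof. exact: normr_measurable. Qed.

(** Comparison with the density of variance 2, using $y^3\le 32+y^4\le 32e^{y^2/4}$ for $y\ge 0$. It
    makes functions of cubic growth integrable, in particular Taylor remainders. *)
Lemma gauss_cube_le (R : realType) :
  (\int[normal_prob 0 1]_x (`|x : R| ^+ 3)%:E <= (32 * Num.sqrt 2)%:E)%E.
Proof.
have s2 : 0 < Num.sqrt 2 :> R by rewrite sqrtr_gt0.
apply: (@integral_expR_le_normal _ _ 0 (Num.sqrt 2)) => //.
- by apply: measurable_funX; exact: measurable_normr_id.
- move=> x; rewrite [normal_pdf _ (Num.sqrt _) _]normal_pdf_std// !normal_pdf01E subr0 expr_div_n sqr_sqrtr//.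
  have -> : 32 * Num.sqrt 2 * ((Num.sqrt 2)^-1 * (normal_peak 1 * expR (- (x ^+ 2 / 2) / 2)))
    = normal_peak 1 * (32 * expR (- (x ^+ 2 / 4))) :> R.
    rewrite (_ : - (x ^+ 2 / 2) / 2 = - (x ^+ 2 / 4)); last by field.
    by field; rewrite gt_eqF.
  rewrite mulrCA ler_wpM2l ?normal_peak_ge0//.
  have -> : - x ^+ 2 / 2 = - (x ^+ 2 / 4) + - (x ^+ 2 / 4) by field.
  rewrite expRD mulrA ler_wpM2r ?expR_ge0// expRN.
  rewrite ler_pdivrMr ?expR_gt0//.
  have x0 : 0 <= x ^+ 2 / 4 by rewrite divr_ge0// sqr_ge0.
  have h := @expR_ge1Dxn R _ 1 x0.
  have e : `|x| ^+ 2 = x ^+ 2 by rewrite real_normK// num_real.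
  apply: (@le_trans _ _ (32 * (1 + (x ^+ 2 / 4) ^+ 2 / (2`!)%:R))).
    rewrite (_ : (2`!)%:R = 2 :> R)// -e; have := normr_ge0 x; set y := `|x|; nra.
  by rewrite ler_wpM2l.
Qed.

Lemma gauss_integrable_cubic (R : realType) (f : R -> R) (C : R) :
  measurable_fun [set: R] f -> (forall x, `|f x| <= C * (1 + `|x| ^+ 3)) ->
  (@normal_prob R 0 1).-integrable setT (EFin \o f).
Proof.
move=> mf fC; apply/integrableP; split; first exact/measurable_EFinP.
have C0 : 0 <= C by have := le_trans (normr_ge0 _) (fC 0); rewrite normr0 expr0n addr0 mulr1.
apply: (@le_lt_trans _ _ (\int[normal_prob 0 1]_x (C%:E * (1 + (`|x| ^+ 3)%:E)))%E).
  apply: ge0_le_integral => //.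
  - by apply/measurable_EFinP; exact: measurableT_comp.
  - apply: emeasurable_funM => //; apply: emeasurable_funD => //.
    by apply/measurable_EFinP; apply: measurable_funX; exact: measurable_normr_id.
  - by move=> x _; rewrite /= -EFinD -EFinM lee_fin.
have m3 : measurable_fun [set: R] (fun x : R => (`|x| ^+ 3)%:E).
  by apply/measurable_EFinP; apply: measurable_funX; exact: measurable_normr_id.
rewrite ge0_integralZl//; [|exact: emeasurable_funD|by move=> x _; rewrite adde_ge0].
rewrite ge0_integralD// integral_cst//.
rewrite lte_mul_pinfty// ?lee_fin//.
apply: lte_add_pinfty; first by rewrite mul1e (le_lt_trans (probability_le1 _ _)) ?ltry.
by apply: le_lt_trans (gauss_cube_le R) _; rewrite ltry.
Qed.

(** The identity $(x-a)^2/3-x^2/2=a^2-(x+2a)^2/6$ exhibits the normal density of mean $-2a$ and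
    variance 3. *)
Lemma gauss_expR_shift (R : realType) (a : R) :
  (\int[normal_prob 0 1]_x (expR ((x - a) ^+ 2 / 3))%:E <=
   (Num.sqrt 3 * expR (a ^+ 2))%:E)%E.
Proof.
have s3 : 0 < Num.sqrt 3 :> R by rewrite sqrtr_gt0.
apply: (@integral_expR_le_normal _ _ (- (2 * a)) (Num.sqrt 3)) => //.
- apply: measurableT_comp => //; apply: measurable_funM => //.
  by apply: measurable_funX; exact: measurable_funB.
- move=> x; rewrite [normal_pdf _ (Num.sqrt _) _]normal_pdf_std// !normal_pdf01E expr_div_n sqr_sqrtr//.
  rewrite mulrCA -expRD [leRHS](_ : _ = normal_peak 1 *
     (expR (a ^+ 2) * expR (- ((x - - (2 * a)) ^+ 2 / 3) / 2))); last first.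
    by field; rewrite gt_eqF.
  by rewrite -expRD ler_wpM2l ?normal_peak_ge0// ler_expR le_eqVlt; apply/orP; left; apply/eqP; field.
Qed.

Lemma gauss_expR_trunc (R : realType) (a : R) : 0 <= a ->
  (\int[normal_prob 0 1]_x (expR (Num.max 0 (`|x| - a) ^+ 2 / 3))%:E <=
   (1 + 2 * (Num.sqrt 3 * expR (- (a ^+ 2 / 2))))%:E)%E.
Proof.
move=> a0.
have s3 : 0 < Num.sqrt 3 :> R by rewrite sqrtr_gt0.
(* Times the standard density, [h] is $\sqrt3e^{-a^2/2}$ times the density of mean $a$ and variance
   3. For $x\ge a$ it dominates the integrand because $(x-a)^2\le x^2-a^2$. *)
pose h x := expR (- (a ^+ 2 / 2) - (x - a) ^+ 2 / 6 + x ^+ 2 / 2).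
have mh : measurable_fun [set: R] (fun x => (h x)%:E).
  apply/measurable_EFinP; apply: measurableT_comp => //; apply: measurable_funD.
    apply: measurable_funB => //; apply: measurable_funM => //.
    by apply: measurable_funX; exact: measurable_funB.
  by apply: measurable_funM => //; exact: measurable_funX.
have mhN : measurable_fun [set: R] (fun x => (h (- x))%:E).
  by apply: (measurableT_comp mh); exact: measurable_funN.
have h0 x : (0 <= (h x)%:E)%E by rewrite lee_fin expR_ge0.
have ih : (\int[normal_prob 0 1]_x (h x)%:E <= (Num.sqrt 3 * expR (- (a ^+ 2 / 2)))%:E)%E.
  apply: (@integral_expR_le_normal _ _ a (Num.sqrt 3)) => //.
    - exact/measurable_EFinP.
  - move=> x; rewrite [normal_pdf _ (Num.sqrt _) _]normal_pdf_std// !normal_pdf01E expr_div_n sqr_sqrtr//.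
    rewrite mulrCA -expRD [leRHS](_ : _ = normal_peak 1 *
     (expR (- (a ^+ 2 / 2)) * expR (- ((x - a) ^+ 2 / 3) / 2))); last first.
      by field; rewrite gt_eqF.
    by rewrite -expRD ler_wpM2l ?normal_peak_ge0// ler_expR le_eqVlt; apply/orP; left; apply/eqP; field.
apply: (@le_trans _ _ (\int[normal_prob 0 1]_x (1 + ((h x)%:E + (h (- x))%:E)))%E).
  apply: ge0_le_integral => //.
  - apply/measurable_EFinP; apply: measurableT_comp => //; apply: measurable_funM => //.
    apply: measurable_funX; apply: measurable_maxr => //.
    by apply: measurable_funB => //; exact: measurable_normr_id.
  - by apply: emeasurable_funD => //; exact: emeasurable_funD.
  - move=> x _; rewrite -!EFinD lee_fin.
    have [xa|ax] := leP (`|x|) a.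
      rewrite max_l ?subr_le0// expr0n mul0r expR0 lerDl.
      by rewrite addr_ge0 ?expR_ge0.
    rewrite max_r; last by rewrite subr_ge0 ltW.
    have [x0|x0] := leP 0 x.
      rewrite (ger0_norm x0) in ax *.
      apply: (@le_trans _ _ (h x)); last by rewrite addrCA lerDl addr_ge0 ?expR_ge0.
      by rewrite ler_expR; nra.
    rewrite (ltr0_norm x0) in ax *.
    apply: (@le_trans _ _ (h (- x))); last by rewrite addrA lerDr addr_ge0 ?expR_ge0.
    by rewrite ler_expR; nra.
rewrite ge0_integralD//; last first.
  by apply: emeasurable_funD.
  by move=> x _; rewrite adde_ge0.
rewrite integral_cst//= mul1e [normal_prob _ _ _](@probability_setT _ _ _ (normal_prob 0 1)) EFinD leeD2l//.
rewrite ge0_integralD// (ge0_gauss_sym mh)//.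
rewrite (_ : 2 * _ = Num.sqrt 3 * expR (- (a ^+ 2 / 2)) + Num.sqrt 3 * expR (- (a ^+ 2 / 2))); last by ring.
by rewrite EFinD leeD.
Qed.

Lemma gauss_expR_sqr (R : realType) (u : R) : 0 <= u ->
  (\int[normal_prob 0 1]_x (expR (- u * x ^+ 2))%:E <= ((Num.sqrt (1 + 2 * u))^-1)%:E)%E.
Proof.
move=> u0; have u1 : 0 < 1 + 2 * u by rewrite ltr_wpDr// mulr_ge0.
have s0 : 0 < Num.sqrt (1 + 2 * u) by rewrite sqrtr_gt0.
apply: (@integral_expR_le_normal _ _ 0 ((Num.sqrt (1 + 2 * u))^-1)) => //.
- by rewrite invr_gt0.
- by apply: measurableT_comp => //; apply: measurable_funM => //; exact: measurable_funX.
- move=> x; rewrite [normal_pdf _ (_^-1) _]normal_pdf_std ?invr_gt0// !normal_pdf01E subr0 invrK exprMn sqr_sqrtr ?(ltW u1)//.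
  rewrite mulKf ?gt_eqF// mulrCA -expRD.
  by rewrite ler_wpM2l ?normal_peak_ge0// ler_expR le_eqVlt; apply/orP; left; apply/eqP; field.
Qed.

(** Keep only the interval of length 1 ending at $-l$; on it the density is at least its value at
    $-l-1$, and $1/\sqrt{2\pi}\ge 1/4$. *)
Lemma gauss_tail_ge (R : realType) (l : R) : 0 <= l ->
  ((4^-1 * expR (- ((l + 1) ^+ 2 / 2)))%:E <= normal_prob 0 1 `]-oo, (- l)%R])%E.
Proof.
move=> l0.
have p4 : 4^-1 <= normal_peak 1 :> R.
  have p0 := @pi_gt0 R; have p4 := @pihalf_lt2 R.
  have p2 : 0 < pi *+ 2 :> R by rewrite pmulrn_lgt0.
  rewrite /normal_peak expr1n mul1r lef_pV2 ?posrE ?sqrtr_gt0//.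
  have -> : 4 = Num.sqrt (4 ^+ 2) :> R by rewrite sqrtr_sqr ger0_norm.
  by apply: ler_wsqrtr; rewrite mulr2n; lra.
apply: (@le_trans _ _ (\int[lebesgue_measure]_(x in `](- l - 1)%R, (- l)%R])
    (4^-1 * expR (- ((l + 1) ^+ 2 / 2)))%:E)%E).
  rewrite integral_cst//= lebesgue_measure_itv/= lte_fin ltrBlDr ltrDl ltr01.
  by rewrite (_ : (- l)%:E + _ = 1)%E ?mule1// -EFinD; congr EFin; ring.
apply: (@le_trans _ _ (\int[lebesgue_measure]_(x in `](- l - 1)%R, (- l)%R]) (normal_pdf 0 1 x)%:E)%E).
  apply: ge0_le_integral => //.
  - apply/measurable_EFinP; apply: measurable_funTS; exact: measurable_normal_pdf.
  - move=> x /=; rewrite in_itv/= => /andP[x1 x2]; rewrite lee_fin normal_pdf01E.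
    apply: ler_pM; rewrite ?expR_ge0// ler_expR; nra.
rewrite /normal_prob; apply: ge0_subset_integral => //.
- apply/measurable_EFinP; apply: measurable_funTS; exact: measurable_normal_pdf.
- by move=> x _; rewrite lee_fin normal_pdf_ge0.
- by move=> x /=; rewrite !in_itv/= => /andP[].
Qed.

(** * Iterated Gaussian integrals *)

(** No sigma-algebra is put on [J -> R]. Instead [F] must stay measurable after every substitution
    of measurable coordinates, which covers lines, products with the real line and random vectors
    alike. *)
Definition coord_measurable (R : realType) (J : Type) (F : (J -> R) -> R) : Prop :=
  forall (d : measure_display) (U : measurableType d) (W : U -> J -> R),
    (forall j, measurable_fun [set: U] (fun u => W u j)) ->
    measurable_fun [set: U] (fun u => F (W u)).

Definition bounded_coord_measurable (R : realType) (J : Type) (F : (J -> R) -> R) : Prop :=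
  coord_measurable F /\ exists M : R, forall w, `|F w| <= M.

Definition gauss_op (R : realType) (J : Type) (v : J -> R) (F : (J -> R) -> R) :
    (J -> R) -> R :=
  fun w => \int[normal_prob 0 1]_s F (w + s *: v).

(** The expectation of [F] at [w] plus a combination of the vectors of [l] with independent standard
    normal weights, expressed without a probability space. *)
Definition gauss_ops (R : realType) (J : Type) (l : seq (J -> R)) (F : (J -> R) -> R) :
    (J -> R) -> R :=
  foldr (@gauss_op R J) F l.

Section gauss_op_theory.
Variables (R : realType) (J : Type).
Implicit Types (v w : J -> R) (F G : (J -> R) -> R) (l : seq (J -> R)).

Lemma bcm_line F v w : coord_measurable F ->
  measurable_fun [set: R] (fun s : R => F (w + s *: v)).
Proof.
move=> mF; apply: (mF _ (measurableTypeR R) (fun s => w + s *: v)) => j.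
by apply: measurable_funD => //; exact: measurable_funM.
Qed.

Lemma bcm_integrable F v w : bounded_coord_measurable F ->
  (@normal_prob R 0 1).-integrable setT (fun s => (F (w + s *: v))%:E).
Proof.
move=> [mF [M FM]]; apply: (gauss_integrable_cubic (bcm_line v w mF) (C := M)) => x.
have M0 : 0 <= M := le_trans (normr_ge0 _) (FM 0).
by rewrite (le_trans (FM _))// ler_peMr// lerDl exprn_ge0.
Qed.

Lemma gauss_opE F v w : bounded_coord_measurable F ->
  ((gauss_op v F w)%:E = \int[normal_prob 0 1]_s (F (w + s *: v))%:E)%E.
Proof.
move=> bF; rewrite /gauss_op /Rintegral fineK//.
exact: integrable_fin_num (bcm_integrable v w bF).
Qed.

Lemma bcm_cst (c : R) : bounded_coord_measurable (fun _ : J -> R => c).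
Proof. by split; [move=> d U W mW; exact: measurable_cst|exists `|c|]. Qed.

Lemma bcm_lin (a b : R) F G : bounded_coord_measurable F -> bounded_coord_measurable G ->
  bounded_coord_measurable (fun w => a * F w + b * G w).
Proof.
move=> [mF [M FM]] [mG [N GN]]; split.
  move=> d U W mW; apply: measurable_funD; apply: measurable_funM => //; [exact: mF|exact: mG].
exists (`|a| * M + `|b| * N) => w.
by rewrite (le_trans (ler_normD _ _))// !normrM lerD// ler_wpM2l.
Qed.

Lemma bcmB F G : bounded_coord_measurable F -> bounded_coord_measurable G ->
  bounded_coord_measurable (fun w => F w - G w).
Proof.
move=> bF bG; have := bcm_lin 1 (-1) bF bG.
have -> // : (fun w => 1 * F w + -1 * G w) = (fun w => F w - G w).
by apply/funext => w; rewrite mul1r mulN1r.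
Qed.

Lemma gauss_op_lin (a b : R) v F G w :
  bounded_coord_measurable F -> bounded_coord_measurable G ->
  gauss_op v (fun w => a * F w + b * G w) w = a * gauss_op v F w + b * gauss_op v G w.
Proof.
move=> bF bG; have iF := bcm_integrable v w bF; have iG := bcm_integrable v w bG.
rewrite /gauss_op RintegralD//; last 2 first.
- exact: integrableZl iF.
- exact: integrableZl iG.
by rewrite !RintegralZl.
Qed.

Lemma gauss_opB v F G w :
  bounded_coord_measurable F -> bounded_coord_measurable G ->
  gauss_op v (fun w => F w - G w) w = gauss_op v F w - gauss_op v G w.
Proof.
move=> bF bG; have := gauss_op_lin 1 (-1) v w bF bG.
rewrite mul1r mulN1r => <-; congr gauss_op; apply/funext => x.
by rewrite mul1r mulN1r.
Qed.

Lemma gauss_op_le v F G w :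
  bounded_coord_measurable F -> bounded_coord_measurable G ->
  (forall w, F w <= G w) -> gauss_op v F w <= gauss_op v G w.
Proof.
move=> bF bG FG; apply: le_Rintegral => //.
- exact: bcm_integrable.
- exact: bcm_integrable.
Qed.

Lemma gauss_op_cst v (c : R) w : gauss_op v (fun=> c) w = c.
Proof.
by rewrite /gauss_op Rintegral_cst//= (@probability_setT _ _ _ (normal_prob 0 1)) mulr1.
Qed.

Lemma gauss_op_bcm v F : bounded_coord_measurable F -> bounded_coord_measurable (gauss_op v F).
Proof.
move=> bF; have [mF [M FM]] := bF; split; last first.
  exists M => w; rewrite ler_norml -[X in X <= _](gauss_op_cst v (- M) w).
  rewrite -[X in _ && (_ <= X)](gauss_op_cst v M w); apply/andP; split.
    by apply: gauss_op_le => //; [exact: bcm_cst|move=> x; have := FM x; rewrite ler_norml => /andP[]].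
  by apply: gauss_op_le => //; [exact: bcm_cst|move=> x; have := FM x; rewrite ler_norml => /andP[]].
move=> d U W mW.
have mFW : measurable_fun [set: U * measurableTypeR R] (fun z => F (W z.1 + z.2 *: v)).
  apply: (mF _ (U * measurableTypeR R)%type (fun z => W z.1 + z.2 *: v)) => j.
  apply: measurable_funD; first exact: (measurableT_comp (mW j)).
  by apply: measurable_funM.
(* Tonelli's measurability statement is for nonnegative functions, so [F] is shifted by its
   bound. *)
pose f (z : U * measurableTypeR R) := (F (W z.1 + z.2 *: v) + M)%:E.
have f0 z : (0 <= f z)%E.
  by rewrite lee_fin addrC -[X in _ + X]opprK subr_ge0; have := FM (W z.1 + z.2 *: v); rewrite ler_norml; lra.
have mf : measurable_fun setT f by apply/measurable_EFinP; exact: measurable_funD.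
have := measurable_fun_fubini_tonelli_F (m2 := normal_prob (0 : R) 1) f mf f0.
have bM := bcm_lin 1 1 bF (bcm_cst M).
move=> mg; have -> : (fun u => gauss_op v F (W u)) = (fun u => gauss_op v F (W u) + M - M).
  by apply/funext => u; rewrite addrK.
apply: measurable_funB => //; apply/measurable_EFinP; apply: eq_measurable_fun mg => u _ /=.
rewrite /fubini_F/= /f/=.
have -> : gauss_op v F (W u) + M = gauss_op v (fun w => 1 * F w + 1 * M) (W u).
  by rewrite (gauss_op_lin 1 1 v (W u) bF (bcm_cst M)) gauss_op_cst !mul1r.
rewrite gauss_opE//; apply: eq_integral => s _; by rewrite !mul1r.
Qed.

Lemma gauss_opC u v F w : bounded_coord_measurable F ->
  gauss_op u (gauss_op v F) w = gauss_op v (gauss_op u F) w.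
Proof.
move=> bF; have [mF [M FM]] := bF.
apply: EFin_inj; rewrite !gauss_opE; try exact: gauss_op_bcm.
have mFW : measurable_fun [set: measurableTypeR R * measurableTypeR R]
    (fun z => F (w + z.1 *: u + z.2 *: v)).
  apply: (mF _ (measurableTypeR R * measurableTypeR R)%type (fun z => w + z.1 *: u + z.2 *: v)) => j.
  by apply: measurable_funD; [apply: measurable_funD => //|]; apply: measurable_funM.
transitivity (\int[normal_prob 0 1]_s \int[normal_prob 0 1]_t (F (w + s *: u + t *: v))%:E)%E.
  by apply: eq_integral => s _; rewrite gauss_opE.
transitivity (\int[normal_prob 0 1]_t \int[normal_prob 0 1]_s (F (w + s *: u + t *: v))%:E)%E.
  apply: (@Fubini _ _ _ _ R (normal_prob 0 1) (normal_prob 0 1)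
    (fun z : measurableTypeR R * measurableTypeR R => (F (w + z.1 *: u + z.2 *: v))%:E)).
  apply: measurable_bounded_integrable => //.
  - rewrite -setXTT [X in (X < _)%E]product_measure1E//.
    have h1 := @probability_setT _ _ R (normal_prob 0 1).
    by rewrite [X in (X * _)%E]h1 mul1e [X in (X < _)%E]h1 ltry.
  - exists M; split; first exact: num_real.
    by move=> x Mx z _ /=; rewrite (le_trans (FM _))// ltW.
by apply: eq_integral => t _; rewrite gauss_opE//; apply: eq_integral => s _; rewrite addrAC.
Qed.

Lemma gauss_op_stable (a b r : R) v F w : 0 < a -> 0 < b -> 0 < r ->
  r ^+ 2 = a ^+ 2 + b ^+ 2 -> bounded_coord_measurable F ->
  gauss_op (a *: v) (gauss_op (b *: v) F) w = gauss_op (r *: v) F w.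
Proof.
move=> a0 b0 r0 e bF; have [mF [M FM]] := bF.
pose G w := 1 * F w + 1 * M.
have bG : bounded_coord_measurable G := bcm_lin 1 1 bF (bcm_cst M).
have G0 x : 0 <= G x by have := FM x; rewrite /G ler_norml; lra.
suff h : gauss_op (a *: v) (gauss_op (b *: v) G) w = gauss_op (r *: v) G w.
  have opM u x : gauss_op u G x = gauss_op u F x + M.
    by rewrite gauss_op_lin ?gauss_op_cst ?mul1r//; exact: bcm_cst.
  move: h; rewrite opM.
  have -> : gauss_op (b *: v) G = (fun x => 1 * gauss_op (b *: v) F x + 1 * M).
    by apply/funext => x; rewrite opM !mul1r.
  rewrite gauss_op_lin ?gauss_op_cst ?mul1r; [|exact: gauss_op_bcm|exact: bcm_cst].
  exact: addIr.
apply: EFin_inj; rewrite !gauss_opE//; last exact: gauss_op_bcm.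
transitivity (\int[normal_prob 0 1]_s \int[normal_prob 0 1]_t (G (w + (a * s + b * t) *: v))%:E)%E.
  apply: eq_integral => s _; rewrite gauss_opE//; apply: eq_integral => t _.
  by rewrite !scalerA scalerDl addrA (mulrC s) (mulrC t).
rewrite (ge0_gauss_stable (f := fun x => (G (w + x *: v))%:E) a0 b0 r0 e).
- by apply: eq_integral => t _; rewrite scalerA mulrC.
- by apply/measurable_EFinP; exact: (bcm_line _ _ bG.1).
- by move=> x; rewrite lee_fin.
Qed.

Lemma gauss_ops_bcm l F : bounded_coord_measurable F -> bounded_coord_measurable (gauss_ops l F).
Proof. by move=> bF; elim: l => //= v l; exact: gauss_op_bcm. Qed.

Lemma gauss_ops_cat l1 l2 F : gauss_ops (l1 ++ l2) F = gauss_ops l1 (gauss_ops l2 F).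
Proof. by rewrite /gauss_ops foldr_cat. Qed.

Lemma gauss_ops_lin (a b : R) l F G w :
  bounded_coord_measurable F -> bounded_coord_measurable G ->
  gauss_ops l (fun w => a * F w + b * G w) w = a * gauss_ops l F w + b * gauss_ops l G w.
Proof.
move=> bF bG; elim: l w => //= v l IH w.
rewrite -gauss_op_lin; [|exact: gauss_ops_bcm..].
by congr (gauss_op v _ w); apply/funext.
Qed.

Lemma gauss_ops_le l F G w :
  bounded_coord_measurable F -> bounded_coord_measurable G ->
  (forall w, F w <= G w) -> gauss_ops l F w <= gauss_ops l G w.
Proof.
move=> bF bG FG; elim: l w => //= v l IH w.
by apply: gauss_op_le => //; exact: gauss_ops_bcm.
Qed.

Lemma gauss_ops_cst l (c : R) w : gauss_ops l (fun=> c) w = c.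
Proof.
elim: l w => //= v l IH w; rewrite -[RHS](gauss_op_cst v c w).
by congr (gauss_op v _ w); apply/funext.
Qed.

Lemma gauss_op_opsC v l F : bounded_coord_measurable F ->
  gauss_op v (gauss_ops l F) = gauss_ops l (gauss_op v F).
Proof.
move=> bF; elim: l => //= u l IH; rewrite -IH.
by apply/funext => w; rewrite gauss_opC//; exact: gauss_ops_bcm.
Qed.

Lemma gauss_opsC l1 l2 F : bounded_coord_measurable F ->
  gauss_ops l1 (gauss_ops l2 F) = gauss_ops l2 (gauss_ops l1 F).
Proof.
move=> bF; elim: l1 => //= v l1 IH; rewrite IH gauss_op_opsC//.
exact: gauss_ops_bcm.
Qed.

Lemma gauss_ops_nseq (k : nat) (c : R) v F : 0 < c -> bounded_coord_measurable F ->
  gauss_ops (nseq k.+1 (c *: v)) F = gauss_op (Num.sqrt k.+1%:R * c *: v) F.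
Proof.
move=> c0 bF; elim: k => [|k IH]; first by rewrite sqrtr1 mul1r.
have -> : gauss_ops (nseq k.+2 (c *: v)) F =
  gauss_op (c *: v) (gauss_ops (nseq k.+1 (c *: v)) F) by [].
rewrite IH; apply/funext => w; apply: gauss_op_stable => //.
- by rewrite mulr_gt0// sqrtr_gt0.
- by rewrite mulr_gt0// sqrtr_gt0.
- by rewrite !exprMn !sqr_sqrtr// -[k.+2]addn1 natrD; ring.
Qed.

End gauss_op_theory.

(** * Lindeberg comparison *)

Lemma le_1Dcube (R : realType) (y : R) : 0 <= y -> y <= 1 + y ^+ 3.
Proof.
move=> y0; rewrite -subr_ge0 (_ : _ - _ = (y - 1) ^+ 2 * (y + 1) + y ^+ 2); last by ring.
by apply: addr_ge0 => //; rewrite ?sqr_ge0//; apply: mulr_ge0; rewrite ?sqr_ge0// addr_ge0.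
Qed.

Lemma sqr_le_1Dcube (R : realType) (y : R) : 0 <= y -> y ^+ 2 <= 1 + y ^+ 3.
Proof.
move=> y0; rewrite -subr_ge0 (_ : _ - _ = (y - 1) ^+ 2 * (y + 1) + y); last by ring.
by apply: addr_ge0 => //; rewrite ?sqr_ge0//; apply: mulr_ge0; rewrite ?sqr_ge0// addr_ge0.
Qed.

Section lindeberg.
Variables (R : realType) (J : Type).
Implicit Types (u v w : J -> R) (l : seq (J -> R)).

(** The moments stay symbolic: both sides of the comparison carry the same [m2], of which only the
    sign matters. *)
Let m1 : R := \int[normal_prob 0 1]_s `|s|.
Let m2 : R := \int[normal_prob 0 1]_s s ^+ 2.
Let m3 : R := \int[normal_prob 0 1]_s `|s| ^+ 3.

Let m1_ge0 : 0 <= m1. Proof. exact: Rintegral_ge0. Qed.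
Let m2_ge0 : 0 <= m2. Proof. by apply: Rintegral_ge0 => x _; exact: sqr_ge0. Qed.
Let m3_ge0 : 0 <= m3. Proof. by apply: Rintegral_ge0 => x _; exact: exprn_ge0. Qed.

Let int1 : (@normal_prob R 0 1).-integrable setT (fun s => s%:E).
Proof.
apply: (gauss_integrable_cubic (f := id) (C := 1)) => //= x.
by rewrite mul1r le_1Dcube.
Qed.

Let intn1 : (@normal_prob R 0 1).-integrable setT (fun s => `|s|%:E).
Proof.
apply: (gauss_integrable_cubic (f := fun s => `|s|) (C := 1)) => [|x].
  exact: measurable_normr_id.
by rewrite mul1r normr_id le_1Dcube.
Qed.

Let int2 : (@normal_prob R 0 1).-integrable setT (fun s => (s ^+ 2)%:E).
Proof.
apply: (gauss_integrable_cubic (f := fun s => s ^+ 2) (C := 1)) => [|x].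
  exact: measurable_funX.
by rewrite mul1r normrX sqr_le_1Dcube.
Qed.

Let int3 : (@normal_prob R 0 1).-integrable setT (fun s => (`|s| ^+ 3)%:E).
Proof.
apply: (gauss_integrable_cubic (f := fun s => `|s| ^+ 3) (C := 1)) => [|x].
  by apply: measurable_funX; exact: measurable_normr_id.
by rewrite mul1r normrX normr_id lerDr.
Qed.

Let mean0 : \int[normal_prob 0 1]_s s = 0 :> R.
Proof.
have mpos : measurable_fun [set: R] (fun s : R => (Num.max s 0)%:E).
  by apply/measurable_EFinP; exact: measurable_maxr.
have pos0 (s : R) : (0 <= (Num.max s 0)%:E)%E by rewrite lee_fin le_max lexx orbT.
rewrite /Rintegral integralE.
rewrite (_ : (\int[normal_prob 0 1]_x (fun s : R => s%:E)^\- x =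
  \int[normal_prob 0 1]_x (fun s : R => s%:E)^\+ x)%E).
  by rewrite subee//; exact: (integrable_pos_fin_num measurableT int1).
under eq_integral do rewrite funenegE -EFinN -EFin_max.
under [RHS]eq_integral do rewrite funeposE -EFin_max.
exact: (ge0_gauss_sym mpos).
Qed.

Lemma gauss_op_lipschitz v (F : (J -> R) -> R) (C c : R) w :
  bounded_coord_measurable F -> 0 <= c ->
  (forall w r, `|F (w + r *: v) - F w| <= C * `|r|) ->
  `|gauss_op (c *: v) F w - F w| <= C * c * m1.
Proof.
move=> bF c0 FC; have iF := bcm_integrable (c *: v) w bF.
have ic : (@normal_prob R 0 1).-integrable setT (fun=> (F w)%:E).
  exact: (bcm_integrable v w (bcm_cst J (F w))).
have -> : gauss_op (c *: v) F w - F w =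
    \int[normal_prob 0 1]_s (F (w + s *: (c *: v)) - F w).
  rewrite RintegralB//; congr (_ - _); exact/esym/(gauss_op_cst v (F w) w).
have iFc := integrableB measurableT iF ic.
apply: (le_trans (le_normr_Rintegral measurableT iFc)).
rewrite /m1 -RintegralZl//; apply: le_Rintegral => //.
- exact: integrable_norm iFc.
- exact: integrableZl intn1.
- move=> s _ /=; rewrite scalerA (le_trans (FC _ _))//.
  by rewrite normrM (ger0_norm c0) -mulrA (mulrC c).
Qed.

(** Integrate the expansion along the line; its linear term disappears because the Gaussian is
    centred. *)
Lemma gauss_op_taylor v (F : (J -> R) -> R) (C c d1 d2 : R) w :
  bounded_coord_measurable F -> 0 <= c ->
  (forall r, `|F (w + r *: v) - F w - r * d1 - r ^+ 2 / 2 * d2| <= C * `|r| ^+ 3) ->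
  `|gauss_op (c *: v) F w - F w - c ^+ 2 * m2 / 2 * d2| <= C * c ^+ 3 * m3.
Proof.
move=> bF c0 FC; have iF := bcm_integrable (c *: v) w bF.
have ic : (@normal_prob R 0 1).-integrable setT (fun=> (F w)%:E).
  exact: (bcm_integrable v w (bcm_cst J (F w))).
have iFc := integrableB measurableT iF ic.
have id1 := integrableZl measurableT (c * d1) int1.
have id2 := integrableZl measurableT (c ^+ 2 / 2 * d2) int2.
have iA := integrableB measurableT iFc id1.
have iB := integrableB measurableT iA id2.
have -> : gauss_op (c *: v) F w - F w - c ^+ 2 * m2 / 2 * d2 =
    \int[normal_prob 0 1]_s (F (w + s *: (c *: v)) - F w - c * d1 * s - c ^+ 2 / 2 * d2 * s ^+ 2).
  rewrite RintegralB// RintegralB// RintegralB// !RintegralZl// mean0 mulr0 subr0.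
  rewrite [X in _ = _ - X - _](_ : _ = F w); last exact: (gauss_op_cst v (F w) w).
  by rewrite /m2 /gauss_op; ring.
apply: (le_trans (le_normr_Rintegral measurableT iB)).
rewrite /m3 -RintegralZl//; apply: le_Rintegral => //.
- exact: integrable_norm iB.
- exact: integrableZl int3.
- move=> s _ /=; rewrite scalerA.
  rewrite (_ : _ - _ - _ = F (w + (s * c) *: v) - F w - (s * c) * d1 - (s * c) ^+ 2 / 2 * d2); last by ring.
  by rewrite (le_trans (FC _))// normrM (ger0_norm c0) exprMn -mulrA (mulrC (c ^+ 3)).
Qed.

Variables (F : (J -> R) -> R) (D1 D2 : (J -> R) -> (J -> R) -> R).
Hypothesis bF : bounded_coord_measurable F.
Hypothesis bD2 : forall v, bounded_coord_measurable (D2 v).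
Hypothesis taylorF : forall v, exists C : R, 0 <= C /\ forall w r,
  `|F (w + r *: v) - F w - r * D1 v w - r ^+ 2 / 2 * D2 v w| <= C * `|r| ^+ 3.
Hypothesis lipD2 : forall u v, exists C : R, 0 <= C /\ forall w r,
  `|D2 v (w + r *: u) - D2 v w| <= C * `|r|.

Let sumD2 l w := \sum_(v <- l) D2 v w.

Let bsumD2 l : bounded_coord_measurable (sumD2 l).
Proof.
elim: l => [|v l IH].
  rewrite (_ : sumD2 _ = fun=> 0); first exact: bcm_cst.
  by apply/funext => w; rewrite /sumD2 big_nil.
rewrite (_ : sumD2 _ = fun w => 1 * D2 v w + 1 * sumD2 l w).
  exact: bcm_lin.
by apply/funext => w; rewrite /sumD2 big_cons !mul1r.
Qed.

Let lipsumD2 l u : exists C : R, 0 <= C /\ forall w r,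
  `|sumD2 l (w + r *: u) - sumD2 l w| <= C * `|r|.
Proof.
elim: l => [|v l [C [C0 HC]]].
  by exists 0; split => // w r; rewrite /sumD2 !big_nil subrr normr0 mul0r.
have [K [K0 HK]] := lipD2 u v; exists (K + C); split; first exact: addr_ge0.
move=> w r; rewrite /sumD2 !big_cons opprD addrACA mulrDl.
by rewrite (le_trans (ler_normD _ _))// lerD// HC.
Qed.

(** In the induction the inner operators are replaced by their expansion [H], at a cost of order
    $c^3$, and the outer operator is applied to [H]. The second-order sum already carries $c^2$, so
    a Lipschitz bound suffices to move the outer operator past it. *)
Lemma gauss_ops_taylor l : exists C : R, 0 <= C /\ forall c w, 0 <= c <= 1 ->
  `|gauss_ops (map (fun v => c *: v) l) F w - F w - c ^+ 2 * m2 / 2 * sumD2 l w|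
    <= C * c ^+ 3.
Proof.
elim: l => [|v l [C [C0 HC]]].
  exists 0; split => // c w _.
  by rewrite [sumD2 _ _]big_nil mulr0 !subr0 subrr normr0 mul0r.
have [K [K0 HK]] := taylorF v.
have [L [L0 HL]] := lipsumD2 l v.
exists (C + K * m3 + m2 / 2 * (L * m1)); split.
  by rewrite !addr_ge0 ?mulr_ge0 ?divr_ge0.
move=> c w /andP[c0 c1] /=.
set G := gauss_ops _ F.
have bG : bounded_coord_measurable G by exact: gauss_ops_bcm.
pose H x := 1 * F x + c ^+ 2 * m2 / 2 * sumD2 l x.
have bH : bounded_coord_measurable H by exact: bcm_lin.
have e1 : `|gauss_op (c *: v) G w - gauss_op (c *: v) H w| <= C * c ^+ 3.
  have GH x : `|G x - H x| <= C * c ^+ 3.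
    by rewrite /H mul1r opprD addrA HC ?c0.
  rewrite -gauss_opB// ler_norml.
  rewrite -[X in X <= _](gauss_op_cst (c *: v) (- (C * c ^+ 3)) w).
  rewrite -[X in _ && (_ <= X)](gauss_op_cst (c *: v) (C * c ^+ 3) w).
  by apply/andP; split; apply: gauss_op_le; try exact: bcm_cst; try exact: bcmB;
    move=> x; have := GH x; rewrite ler_norml => /andP[].
have e2 : `|gauss_op (c *: v) F w - F w - c ^+ 2 * m2 / 2 * D2 v w| <= K * c ^+ 3 * m3.
  by apply: gauss_op_taylor => // r; exact: HK.
have e3 : `|gauss_op (c *: v) (sumD2 l) w - sumD2 l w| <= L * c * m1.
  exact: gauss_op_lipschitz.
rewrite (_ : sumD2 (v :: l) w = D2 v w + sumD2 l w); last exact: big_cons.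
move: e1; rewrite /H gauss_op_lin// mul1r => e1.
set A := gauss_op _ G w in e1 *.
set B := gauss_op _ F w in e1 e2.
set S := gauss_op _ (sumD2 l) w in e1 e3.
rewrite [X in `|X|](_ : _ = (A - (B + c ^+ 2 * m2 / 2 * S)) +
   (B - F w - c ^+ 2 * m2 / 2 * D2 v w) + c ^+ 2 * m2 / 2 * (S - sumD2 l w)); last by ring.
apply: (le_trans (ler_normD _ _)); rewrite !mulrDl; apply: lerD.
  apply: (le_trans (ler_normD _ _)); apply: lerD => //.
  by rewrite [K * m3 * _]mulrAC.
rewrite normrM ger0_norm ?divr_ge0 ?mulr_ge0 ?sqr_ge0//.
apply: (le_trans (ler_wpM2l _ e3)); first by rewrite ?divr_ge0 ?mulr_ge0 ?sqr_ge0.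
by rewrite le_eqVlt; apply/orP; left; apply/eqP; ring.
Qed.

Lemma gauss_ops_flatten_nseq k v l G : bounded_coord_measurable G ->
  gauss_ops (flatten (nseq k (v :: l))) G =
  gauss_ops (nseq k v) (gauss_ops (flatten (nseq k l)) G).
Proof.
move=> bG; elim: k => //= k IH.
rewrite !gauss_ops_cat IH; congr (gauss_op v _).
by rewrite gauss_opsC//; exact: gauss_ops_bcm.
Qed.

(** Each direction splits into [k.+1] independent copies of variance $1/(k+1)$. Commutation
    rearranges them into rounds, each round applying one copy of every direction of [l]. *)
Lemma gauss_ops_scaled k l G : bounded_coord_measurable G ->
  gauss_ops (flatten (nseq k.+1 (map (fun v => (Num.sqrt k.+1%:R)^-1 *: v) l))) G =
  gauss_ops l G.
Proof.
move=> bG; have s0 : 0 < Num.sqrt k.+1%:R :> R by rewrite sqrtr_gt0.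
elim: l => [|v l IH]; first by rewrite /=; elim: k {s0}.
rewrite [map _ _]/= gauss_ops_flatten_nseq// IH gauss_ops_nseq ?invr_gt0//.
  by rewrite mulfV ?gt_eqF// scale1r.
exact: gauss_ops_bcm.
Qed.

(* Telescoping: since all operators commute, [A^k - B^k] is a sum of [k] terms
   [A^i B^(k-1-i) (A - B) F], and [A - B] is only ever applied to [F]. *)
Lemma gauss_ops_telescope k l1 l2 (e : R) :
  (forall w, gauss_ops l1 F w <= gauss_ops l2 F w + e) ->
  forall w, gauss_ops (flatten (nseq k l1)) F w <=
            gauss_ops (flatten (nseq k l2)) F w + k%:R * e.
Proof.
move=> le12; elim: k => [|k IH] w; first by rewrite mul0r addr0.
rewrite /= !gauss_ops_cat gauss_opsC//.
set A := flatten (nseq k l1); set B := flatten (nseq k l2).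
have b2 : bounded_coord_measurable (gauss_ops l2 F) by exact: gauss_ops_bcm.
have bA : bounded_coord_measurable (gauss_ops A F) by exact: gauss_ops_bcm.
have bB : bounded_coord_measurable (gauss_ops B F) by exact: gauss_ops_bcm.
have shift l (c : R) G x : bounded_coord_measurable G ->
    gauss_ops l (fun y => 1 * G y + 1 * c) x = gauss_ops l G x + c.
  by move=> bG; rewrite gauss_ops_lin ?gauss_ops_cst ?mul1r//; exact: bcm_cst.
apply: (@le_trans _ _ (gauss_ops A (gauss_ops l2 F) w + e)).
  rewrite -shift//; apply: gauss_ops_le; [exact: gauss_ops_bcm|exact: bcm_lin (bcm_cst _ _)|].
  by move=> x; rewrite !mul1r.
rewrite gauss_opsC// -natr1 mulrDl mul1r addrA lerD2r.
rewrite -shift//; apply: gauss_ops_le => //; first exact: bcm_lin (bcm_cst _ _).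
by move=> x; rewrite !mul1r.
Qed.

(** Within one round the second-order terms compare by hypothesis and the error is $C(k+1)^{-3/2}$.
    The [k.+1] rounds lose $C/\sqrt{k+1}$ in total, which tends to 0. *)
Lemma gauss_ops_comparison l1 l2 :
  (forall w, \sum_(v <- l1) D2 v w <= \sum_(v <- l2) D2 v w) ->
  forall w, gauss_ops l1 F w <= gauss_ops l2 F w.
Proof.
move=> le12 w.
have [C1 [C10 H1]] := gauss_ops_taylor l1.
have [C2 [C20 H2]] := gauss_ops_taylor l2.
pose C := C1 + C2.
have C0 : 0 <= C by exact: addr_ge0.
have step k : gauss_ops l1 F w <= gauss_ops l2 F w + C * (Num.sqrt k.+1%:R)^-1.
  have s0 : 0 < Num.sqrt k.+1%:R :> R by rewrite sqrtr_gt0.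
  have s1 : 0 <= (Num.sqrt k.+1%:R : R)^-1 <= 1.
    by rewrite invr_ge0 (ltW s0)/= invf_le1// -[X in X <= _]sqrtr1; apply: ler_wsqrtr; rewrite ler1n.
  rewrite -(gauss_ops_scaled k l1 bF) -(gauss_ops_scaled k l2 bF).
  set c := (Num.sqrt _)^-1 in s1 *.
  rewrite (_ : C * c = k.+1%:R * (C * c ^+ 3)); last first.
    rewrite (_ : c ^+ 3 = c * (k.+1%:R)^-1); first by rewrite mulrCA (mulrCA k.+1%:R) mulfV ?mulr1// pnatr_eq0.
    by rewrite exprS; congr (_ * _); rewrite /c exprVn sqr_sqrtr.
  apply: gauss_ops_telescope => x.
  have := H1 c x s1; have := H2 c x s1; have := le12 x.
  rewrite -/(sumD2 l1 x) -/(sumD2 l2 x) !ler_norml /C mulrDl => h12 /andP[h3 _] /andP[_ h4].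
  have : c ^+ 2 * m2 / 2 * sumD2 l1 x <= c ^+ 2 * m2 / 2 * sumD2 l2 x.
    by rewrite ler_wpM2l// divr_ge0// mulr_ge0// sqr_ge0.
  by lra.
apply/ler_addgt0Pr => e e0.
(* Chosen so that $C/\sqrt{N+1}\le e$. *)
pose N := Num.truncn ((C / e) ^+ 2).
apply: (le_trans (step N)); rewrite lerD2l.
rewrite ler_pdivrMr ?sqrtr_gt0// -ler_pdivrMl// mulrC.
have Ce0 : 0 <= C / e by rewrite divr_ge0// ltW.
rewrite -[leLHS](ger0_norm Ce0) -sqrtr_sqr; apply: ler_wsqrtr.
by apply: ltW; apply: truncnS_gt.
Qed.

End lindeberg.

(** * Expectations of i.i.d. Gaussian families *)

(** Rectangles are stable under intersection and generate the product sigma-algebra. *)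
Lemma measure_rect_unique (R : realType) (d1 d2 : measure_display)
    (T1 : measurableType d1) (T2 : measurableType d2)
    (m m' : {measure set (T1 * T2)%type -> \bar R}) :
  (m setT < +oo)%E ->
  (forall A B, measurable A -> measurable B -> m (A `*` B) = m' (A `*` B)) ->
  forall C, measurable C -> m C = m' C.
Proof.
move=> mfin mE C mC.
pose G : set (set (T1 * T2)) :=
  [set C | exists A, measurable A /\ exists B, measurable B /\ C = A `*` B].
apply: (measure_unique G (fun=> setT)) => //.
- rewrite measurable_prod_measurableType //; congr (<<s _ >>).
  rewrite predeqE; split => [[A mA [B mB <-]]|[A [mA [B [mB ->]]]]].
    by exists A; split => //; exists B.
  by exists A => //; exists B.
- move=> /= _ _ [X1 [mX1 [X2 [mX2 ->]]]] [Y1 [mY1 [Y2 [mY2 ->]]]].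
  rewrite -setXI; exists (X1 `&` Y1); split; first exact: measurableI.
  by exists (X2 `&` Y2); split => //; exact: measurableI.
- move=> _; exists setT; split => //; exists setT; split => //.
  by rewrite setXTT.
- by rewrite bigcup_const.
- by move=> _ [A [mA [B [mB ->]]]]; exact: mE.
Qed.

Section joint_law.
Variables (R : realType) (d : measure_display) (T : measurableType d).
Variables (P : probability T R) (I : choiceType).
Variable G : I -> {RV P >-> R}.
Hypothesis normalG : forall i B, measurable B -> P (G i @^-1` B) = normal_prob 0 1 B.

Definition event_on (L : seq I) (B : I -> set R) : set T :=
  [set w | forall i, i \in L -> B i (G i w)].

(* [Z] is independent of the family [(G i)_(i <- L)], itself independent. *)
Definition indep_of (d' : measure_display) (U : measurableType d') (Z : T -> U)
    (L : seq I) : Prop :=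
  forall (A : set U) (B : I -> set R), measurable A -> (forall i, measurable (B i)) ->
  (P ((Z @^-1` A) `&` event_on L B) =
   P (Z @^-1` A) * \prod_(i <- L) normal_prob 0 1 (B i))%E.

Lemma measurable_event_on L B : (forall i, measurable (B i)) -> measurable (event_on L B).
Proof.
move=> mB; elim: L => [|i L IH].
  by rewrite (_ : event_on _ _ = setT)//; apply/seteqP; split.
rewrite (_ : event_on _ _ = (G i @^-1` B i) `&` event_on L B).
  by apply: measurableI => //; rewrite -[_ @^-1` _]setTI; exact: measurable_funP.
apply/seteqP; split => w /=.
  by move=> h; split => [|j jL]; apply: h; rewrite in_cons ?eqxx// jL orbT.
by move=> [h1 h2] j; rewrite in_cons => /orP[/eqP ->//|]; exact: h2.
Qed.

(** Moves one variable from the family into [Z]. The product formula for the pair is checked on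
    rectangles, where the set attached to [i] is replaced by the second side, and extends to all
    measurable sets by uniqueness of measures. *)
Lemma indep_of_cons (d' : measure_display) (U : measurableType d') (Z : T -> U) i L :
  measurable_fun setT Z -> uniq (i :: L) -> indep_of Z (i :: L) ->
  (forall A D, measurable A -> measurable D ->
    (P ((Z @^-1` A) `&` (G i @^-1` D)) = P (Z @^-1` A) * normal_prob 0 1 D)%E) /\
  indep_of (fun w => (Z w, G i w)) L.
Proof.
move=> mZ /andP[iL uL] ind.
have g1 : normal_prob (0 : R) 1 setT = 1%E := @probability_setT _ _ R (normal_prob 0 1).
have rect A D B : measurable A -> measurable D -> (forall j, measurable (B j)) ->
    (P ((Z @^-1` A) `&` (G i @^-1` D) `&` event_on L B) =
     P (Z @^-1` A) * normal_prob 0 1 D * \prod_(j <- L) normal_prob 0 1 (B j))%E.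
  move=> mA mD mB; pose B' j := if j == i then D else B j.
  have mB' j : measurable (B' j) by rewrite /B'; case: ifP.
  have B'i : B' i = D by rewrite /B' eqxx.
  have := ind A B' mA mB'; rewrite big_cons B'i muleA.
  have -> : (\prod_(j <- L) normal_prob 0 1 (B' j) = \prod_(j <- L) normal_prob (0 : R) 1 (B j))%E.
    apply: eq_big_seq => j jL; rewrite /B'; case: eqP => // ji.
    by move: iL; rewrite -ji jL.
  move=> <-; congr (P _); rewrite -setIA; congr (_ `&` _).
  apply/seteqP; split => w /=.
    move=> [h1 h2] j; rewrite in_cons /B'; case: eqP => [->//|_ /=]; exact: h2.
  move=> h; split; first by have := h i; rewrite in_cons /B' eqxx; exact.
  move=> j jL; have := h j; rewrite in_cons /B' jL orbT; case: eqP => [ji|_]; last exact.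
  by move: iL; rewrite -ji jL.
have pair A D : measurable A -> measurable D ->
    (P ((Z @^-1` A) `&` (G i @^-1` D)) = P (Z @^-1` A) * normal_prob 0 1 D)%E.
  move=> mA mD; have := rect A D (fun=> setT) mA mD (fun=> measurableT).
  rewrite (_ : event_on _ _ = setT) ?setIT; last by apply/seteqP; split.
  by rewrite [X in (_ * X)%E]big1 ?mule1.
split => // C B mC mB.
pose Z' w := (Z w, G i w).
have mZ' : measurable_fun setT Z' by apply: measurable_fun_pair.
have mE := measurable_event_on L mB.
(* With the sets [B] fixed, both sides are measures in [C]: the law of [Z'] restricted to the event
   on [L], and the law of [Z'] scaled by a constant. *)
pose nu0 : {measure set _ -> \bar R} := pushforward (mrestr P mE) Z'.
pose nu := nu0 mZ'.
pose law0 : {measure set _ -> \bar R} := pushforward P Z'.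
pose law := law0 mZ'.
have c0 : 0 <= \prod_(j <- L) fine (normal_prob (0 : R) 1 (B j)).
  by apply: prodr_ge0 => j _; rewrite fine_ge0.
pose c := NngNum c0.
have cE : (\prod_(j <- L) normal_prob (0 : R) 1 (B j) = c%:num%:E)%E.
  rewrite /= ; elim: (L) => [|j l IH]; first by rewrite !big_nil.
  rewrite !big_cons EFinM fineK ?IH//.
  rewrite -(normalG i (mB j)); apply: fin_num_measure.
  by rewrite -[_ @^-1` _]setTI; exact: measurable_funP.
rewrite cE muleC.
apply: (measure_rect_unique (m := nu) (m' := mscale c law)) => //.
  rewrite /nu/= /pushforward /mrestr.
  by rewrite (le_lt_trans (probability_le1 _ _)) ?ltry// preimage_setT setTI.
move=> A D mA mD.
rewrite /nu /law/= /mscale/= /pushforward/= /mrestr.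
rewrite (_ : Z' @^-1` _ = (Z @^-1` A) `&` (G i @^-1` D)); last by apply/seteqP; split.
by rewrite rect// pair// cE muleC.
Qed.

(** The factorisation on rectangles identifies the law of the pair with a product measure; Tonelli
    does the rest. *)
Lemma pair_integral (d' : measure_display) (U : measurableType d') (Z : T -> U) i
    (h : U * measurableTypeR R -> R) :
  measurable_fun setT Z -> measurable_fun setT h -> (forall z, 0 <= h z) ->
  (forall A D, measurable A -> measurable D ->
    (P ((Z @^-1` A) `&` (G i @^-1` D)) = P (Z @^-1` A) * normal_prob 0 1 D)%E) ->
  (\int[P]_w (h (Z w, G i w))%:E =
   \int[P]_w \int[normal_prob 0 1]_s (h (Z w, s))%:E)%E.
Proof.
move=> mZ mh h0 pair.
pose Z' w : U * measurableTypeR R := (Z w, G i w).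
have mZ' : measurable_fun setT Z'.
  by apply: measurable_fun_pair => //; exact: (measurable_funP (G i)).
pose mixZ := isMeasurableFun.Build _ _ _ _ _ mZ.
pose mixZ' := isMeasurableFun.Build _ _ _ _ _ mZ'.
pose RZ : {RV P >-> U} := HB.pack Z mixZ.
pose RZ' : {RV P >-> (U * measurableTypeR R)%type} := HB.pack Z' mixZ'.
have lawE C : measurable C -> (distribution P RZ \x normal_prob (0 : R) 1)%E C = distribution P RZ' C.
  apply: product_measure_unique => A D mA mD.
  by rewrite -pair//; congr (P _); apply/seteqP; split.
have mh' : measurable_fun setT (fun z => (h z)%:E) by exact/measurable_EFinP.
have h0' z : (0 <= (h z)%:E)%E by rewrite lee_fin.
transitivity (\int[distribution P RZ']_z (h z)%:E)%E.
  by rewrite ge0_integral_distribution.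
transitivity (\int[(distribution P RZ \x normal_prob (0 : R) 1)%E]_z (h z)%:E)%E.
  by apply: eq_measure_integral => C mC _; apply/esym; exact: lawE.
rewrite (fubini_tonelli1 _ mh' h0') ge0_integral_distribution//.
  exact: measurable_fun_fubini_tonelli_F mh' h0'.
by move=> x; exact: integral_ge0.
Qed.

(* Adding [G i] to the vector [Z] one coordinate at a time turns the expectation
   into the iterated Gaussian integral. *)
Lemma expectation_gauss_ops (J : Type) (F : (J -> R) -> R) (a : I -> J -> R) (L : seq I) :
  bounded_coord_measurable F -> (forall w, 0 <= F w) -> uniq L ->
  forall (d' : measure_display) (U : measurableType d') (Z : T -> U) (W : U -> J -> R),
  measurable_fun setT Z -> (forall j, measurable_fun setT (fun u => W u j)) ->
  indep_of Z L ->
  \int[P]_w F (W (Z w) + \sum_(i <- L) G i w *: a i) =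
  \int[P]_w gauss_ops (map a L) F (W (Z w)).
Proof.
move=> bF F0; elim: L => [_ d' U Z W _ _ _|i L IH uL d' U Z W mZ mW ind].
  by apply: eq_Rintegral => w _; rewrite big_nil addr0.
have [pair ind'] := indep_of_cons mZ uL ind.
have uL' : uniq L by case/andP: uL.
pose W' (z : U * measurableTypeR R) := W z.1 + z.2 *: a i.
have mW' j : measurable_fun setT (fun z => W' z j).
  apply: measurable_funD; first exact: (measurableT_comp (mW j)).
  by apply: measurable_funM.
have mZ' : measurable_fun setT (fun w => (Z w, G i w)) by apply: measurable_fun_pair.
transitivity (\int[P]_w gauss_ops (map a L) F (W' (Z w, G i w))).
  rewrite -(IH uL' _ _ _ W' mZ' mW' ind').
  by apply: eq_Rintegral => w _; rewrite big_cons addrA.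
have bL := gauss_ops_bcm (map a L) bF.
have [mL _] := bL.
have L0 w : 0 <= gauss_ops (map a L) F w.
  rewrite -[leLHS](gauss_ops_cst (map a L) 0 w); apply: gauss_ops_le => //.
  exact: bcm_cst.
have mh : measurable_fun setT (fun z => gauss_ops (map a L) F (W' z)).
  exact: (mL _ _ W' mW').
rewrite /Rintegral (pair_integral mZ mh _ pair)//.
by congr fine; apply: eq_integral => w _; rewrite /= gauss_opE.
Qed.

End joint_law.

Lemma iid_expectation_gauss_ops (R : realType) (d : measure_display)
    (T : measurableType d) (P : probability T R) (I : finType) (G : I -> {RV P >-> R})
    (J : Type) (F : (J -> R) -> R) (a : I -> J -> R) (w0 : J -> R) :
  iid_standard_normal G -> bounded_coord_measurable F -> (forall w, 0 <= F w) ->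
  \int[P]_w F (w0 + \sum_(i <- enum I) G i w *: a i) =
  gauss_ops (map a (enum I)) F w0.
Proof.
move=> [ind normalG] bF F0.
have nG i B : measurable B -> P (G i @^-1` B) = normal_prob 0 1 B by exact: normalG.
(* The induction starts from a constant [Z]. Its preimages are everything or nothing, so it is
   independent of the whole family. *)
rewrite (expectation_gauss_ops nG a bF F0 (enum_uniq I) (d' := d) (U := T) (Z := cst point) (W := fun=> w0))//.
  rewrite Rintegral_cst//= probability_setT mulr1 //.
move=> A B mA mB.
have E : P (event_on G (enum I) B) = (\prod_(i <- enum I) normal_prob 0 1 (B i))%E.
  rewrite big_enum/=; rewrite -(eq_bigr _ (fun i _ => nG i _ (mB i))).
  have := ind [set: I]%SET B mB.
  rewrite [X in _ = X -> _](eq_bigl (fun i => i \in I)); last by move=> i; rewrite finset.in_setT.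
  move=> <-; congr (P _); apply/seteqP; split => w /= h i.
    by move=> _; apply: h; rewrite mem_enum.
  by move=> _; apply: h; rewrite /= finset.in_setT.
rewrite -E; have [Ap|Ap] := pselect (A point).
  rewrite (_ : cst point @^-1` A = setT) ?setTI ?probability_setT ?mul1e//.
  by apply/seteqP; split.
rewrite (_ : cst point @^-1` A = set0) ?set0I ?measure0 ?mul0e//.
by apply/seteqP; split.
Qed.

(** * The smoothed indicator of Gordon's comparison *)

Section smooth.
Variables (R : realType) (J : Type).
Implicit Types (f g : (J -> R) -> R) (D : (J -> R) -> (J -> R) -> R) (u v w : J -> R).

(** Regularity is asked along lines only, with constants that may depend on the direction but not on
    the base point. A comparison involves finitely many directions, so no norm on [J -> R] is
    required. *)
Definition line_lipschitz f := forall v, exists C : R, 0 <= C /\ forall w r,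
  `|f (w + r *: v) - f w| <= C * `|r|.

Definition bounded_fct f := exists C : R, 0 <= C /\ forall w, `|f w| <= C.

Definition taylor2 f D1 D2 := forall v, exists C : R, 0 <= C /\ forall w r,
  `|f (w + r *: v) - f w - r * D1 v w - r ^+ 2 / 2 * D2 v w| <= C * `|r| ^+ 3.

(** [D1 v] and [D2 v] stand for the first and second derivatives in the direction [v]; they are
    supplied as formulas and tied to [f] by the Taylor bound, without any notion of limit. *)
Record smooth f D1 D2 : Prop := Smooth {
  smooth_lip : line_lipschitz f ;
  smooth_taylor : taylor2 f D1 D2 ;
  smooth_bdd1 : forall v, bounded_fct (D1 v) ;
  smooth_bdd2 : forall v, bounded_fct (D2 v) ;
  smooth_lip1 : forall v, line_lipschitz (D1 v) ;
  smooth_lip2 : forall v, line_lipschitz (D2 v) }.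

Lemma bounded_fct_cst (c : R) : bounded_fct (fun=> c).
Proof. by exists `|c|. Qed.

Lemma bounded_fctD f g : bounded_fct f -> bounded_fct g -> bounded_fct (fun w => f w + g w).
Proof.
move=> [C [C0 fC]] [K [K0 gK]]; exists (C + K); split; first exact: addr_ge0.
by move=> w; rewrite (le_trans (ler_normD _ _))// lerD.
Qed.

Lemma bounded_fctM f g : bounded_fct f -> bounded_fct g -> bounded_fct (fun w => f w * g w).
Proof.
move=> [C [C0 fC]] [K [K0 gK]]; exists (C * K); split; first exact: mulr_ge0.
by move=> w; rewrite normrM ler_pM.
Qed.

Lemma lip_cst (c : R) : line_lipschitz (fun=> c).
Proof. by move=> v; exists 0; split => // w r; rewrite subrr normr0 mul0r. Qed.

Lemma lipD f g : line_lipschitz f -> line_lipschitz g -> line_lipschitz (fun w => f w + g w).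
Proof.
move=> lf lg v; have [C [C0 fC]] := lf v; have [K [K0 gK]] := lg v.
exists (C + K); split; first exact: addr_ge0.
by move=> w r; rewrite opprD addrACA mulrDl (le_trans (ler_normD _ _))// lerD.
Qed.

Lemma lipM f g : bounded_fct f -> bounded_fct g ->
  line_lipschitz f -> line_lipschitz g -> line_lipschitz (fun w => f w * g w).
Proof.
move=> [A [A0 fA]] [B [B0 gB]] lf lg v; have [C [C0 fC]] := lf v; have [K [K0 gK]] := lg v.
exists (C * B + A * K); split; first by rewrite addr_ge0// mulr_ge0.
move=> w r.
rewrite (_ : _ - _ = (f (w + r *: v) - f w) * g (w + r *: v) + f w * (g (w + r *: v) - g w)); last by ring.
rewrite [leRHS]mulrDl (le_trans (ler_normD _ _))// lerD// normrM.
  by rewrite mulrAC ler_pM.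
by rewrite -mulrA ler_pM.
Qed.

Lemma bounded_fct_sum (I : Type) (s : seq I) (f : I -> (J -> R) -> R) :
  (forall i, bounded_fct (f i)) -> bounded_fct (fun w => \sum_(i <- s) f i w).
Proof.
move=> bf; elim: s => [|i s IH].
  rewrite (_ : (fun _ => _) = fun=> 0); first exact: bounded_fct_cst.
  by apply/funext => w; rewrite big_nil.
rewrite (_ : (fun _ => _) = fun w => f i w + \sum_(i <- s) f i w); first exact: bounded_fctD.
by apply/funext => w; rewrite big_cons.
Qed.

Lemma lip_sum (I : Type) (s : seq I) (f : I -> (J -> R) -> R) :
  (forall i, line_lipschitz (f i)) -> line_lipschitz (fun w => \sum_(i <- s) f i w).
Proof.
move=> bf; elim: s => [|i s IH].
  rewrite (_ : (fun _ => _) = fun=> 0); first exact: lip_cst.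
  by apply/funext => w; rewrite big_nil.
rewrite (_ : (fun _ => _) = fun w => f i w + \sum_(i <- s) f i w); first exact: lipD.
by apply/funext => w; rewrite big_cons.
Qed.

Lemma smooth_sum (I : Type) (s : seq I) (f : I -> (J -> R) -> R)
    (E1 E2 : I -> (J -> R) -> (J -> R) -> R) :
  (forall i, smooth (f i) (E1 i) (E2 i)) ->
  smooth (fun w => \sum_(i <- s) f i w) (fun v w => \sum_(i <- s) E1 i v w)
         (fun v w => \sum_(i <- s) E2 i v w).
Proof.
move=> sf; split.
- by apply: lip_sum => i; case: (sf i).
- move=> v; elim: s => [|i s [C [C0 HC]]].
    by exists 0; split => // w r; rewrite !big_nil !mulr0 !subrr normr0 mul0r.
  have [K [K0 HK]] := smooth_taylor (sf i) v.
  exists (K + C); split; first exact: addr_ge0.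
  move=> w r; rewrite !big_cons mulrDl.
  rewrite (_ : _ - _ - _ - _ = (f i (w + r *: v) - f i w - r * E1 i v w - r ^+ 2 / 2 * E2 i v w) +
    (\sum_(j <- s) f j (w + r *: v) - \sum_(j <- s) f j w - r * (\sum_(j <- s) E1 j v w)
     - r ^+ 2 / 2 * (\sum_(j <- s) E2 j v w))); last by ring.
  by rewrite (le_trans (ler_normD _ _))// lerD.
- by move=> v; apply: bounded_fct_sum => i; case: (sf i).
- by move=> v; apply: bounded_fct_sum => i; case: (sf i).
- by move=> v; apply: lip_sum => i; case: (sf i).
- by move=> v; apply: lip_sum => i; case: (sf i).
Qed.

(** For $|r|\le 1$ it follows from the second-order expansion; for $|r|>1$ from the Lipschitz bound
    on [f] and the bound on [D1], since then $|r|\le r^2$. *)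
Lemma taylor1 f D1 D2 : smooth f D1 D2 -> forall v, exists C : R, 0 <= C /\ forall w r,
  `|f (w + r *: v) - f w - r * D1 v w| <= C * `|r| ^+ 2.
Proof.
move=> sf v.
have [A [A0 HA]] := smooth_lip sf v; have [B [B0 HB]] := smooth_taylor sf v.
have [C [C0 HC]] := smooth_bdd1 sf v; have [E [E0 HE]] := smooth_bdd2 sf v.
exists (A + C + B + E); split; first by rewrite !addr_ge0.
move=> w r; have r0 := normr_ge0 r.
have [r1|r1] := leP `|r| 1.
  apply: (@le_trans _ _ (B * `|r| ^+ 3 + `|r| ^+ 2 / 2 * E)).
    rewrite -[X in `|X|](subrK (r ^+ 2 / 2 * D2 v w)) (le_trans (ler_normD _ _))// lerD//.
    by rewrite normrM normrM normrX [`|2^-1|]ger0_norm// ler_wpM2l// mulr_ge0// exprn_ge0.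
  have h3 : `|r| ^+ 3 <= `|r| ^+ 2 by rewrite exprS ler_piMl// exprn_ge0.
  have h2 : 0 <= `|r| ^+ 2 by rewrite exprn_ge0.
  by move: h3 h2; set y := `|r| ^+ 3; set x := `|r| ^+ 2; nra.
apply: (@le_trans _ _ (A * `|r| + `|r| * C)).
  by rewrite (le_trans (ler_normB _ _))// lerD// normrM ler_wpM2l.
have h2 : `|r| <= `|r| ^+ 2 by rewrite expr2 ler_peMl// ltW.
by move: h2; set x := `|r| ^+ 2; nra.
Qed.

Lemma lip_comp (h : R -> R) (K : R) (Dm : R -> Prop) f : 0 <= K ->
  (forall x y, Dm x -> Dm y -> `|h y - h x| <= K * `|y - x|) ->
  (forall w, Dm (f w)) -> line_lipschitz f -> line_lipschitz (fun w => h (f w)).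
Proof.
move=> K0 hK fD lf v; have [C [C0 fC]] := lf v.
exists (K * C); split; first exact: mulr_ge0.
by move=> w r; rewrite (le_trans (hK _ _ _ _))// -mulrA ler_wpM2l.
Qed.

(** The chain rule to second order, with [h1] and [h2] as derivatives of [h]. The predicate [Dm]
    confines the outer estimates to the range of [f], as needed for a function such as $1/(1+x)$. *)
Lemma smooth_comp (h h1 h2 : R -> R) (K : R) (Dm : R -> Prop) f D1 D2 : 0 <= K ->
  (forall x y, Dm x -> Dm y -> `|h y - h x| <= K * `|y - x|) ->
  (forall x y, Dm x -> Dm y -> `|h1 y - h1 x| <= K * `|y - x|) ->
  (forall x y, Dm x -> Dm y -> `|h2 y - h2 x| <= K * `|y - x|) ->
  (forall x, Dm x -> `|h1 x| <= K) -> (forall x, Dm x -> `|h2 x| <= K) ->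
  (forall x y, Dm x -> Dm y ->
     `|h y - h x - h1 x * (y - x) - h2 x / 2 * (y - x) ^+ 2| <= K * `|y - x| ^+ 3) ->
  (forall w, Dm (f w)) -> smooth f D1 D2 ->
  smooth (fun w => h (f w)) (fun v w => h1 (f w) * D1 v w)
         (fun v w => h1 (f w) * D2 v w + h2 (f w) * (D1 v w * D1 v w)).
Proof.
move=> K0 lh lh1 lh2 bh1 bh2 th fD sf.
have L0 : line_lipschitz (fun w => h1 (f w)) := lip_comp K0 lh1 fD (smooth_lip sf).
have L2 : line_lipschitz (fun w => h2 (f w)) := lip_comp K0 lh2 fD (smooth_lip sf).
have B1 : bounded_fct (fun w => h1 (f w)) by exists K; split => // w; exact: bh1.
have B2 : bounded_fct (fun w => h2 (f w)) by exists K; split => // w; exact: bh2.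
have [_ _ d1b d2b d1l d2l] := sf.
split.
- exact: lip_comp K0 lh fD (smooth_lip sf).
- move=> v.
  have [A [A0 HA]] := smooth_lip sf v; have [B [B0 HB]] := smooth_taylor sf v.
  have [C [C0 HC]] := smooth_bdd1 sf v; have [E [E0 HE]] := taylor1 sf v.
  exists (K * A ^+ 3 + K * B + K / 2 * (E * (A + C))); split.
    by rewrite !addr_ge0// ?mulr_ge0 ?exprn_ge0 ?addr_ge0// divr_ge0.
  move=> w r.
  set x := f w; set y := f (w + r *: v); set d := y - x.
  have e1 : `|d - r * D1 v w| <= E * `|r| ^+ 2 by exact: HE.
  have e2 : `|d + r * D1 v w| <= (A + C) * `|r|.
    by rewrite mulrDl (le_trans (ler_normD _ _))// lerD ?HA// normrM mulrC ler_wpM2r.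
  have e3 : `|d - r * D1 v w - r ^+ 2 / 2 * D2 v w| <= B * `|r| ^+ 3 by exact: HB.
  have e4 : `|h y - h x - h1 x * d - h2 x / 2 * d ^+ 2| <= K * `|d| ^+ 3.
    by apply: th; exact: fD.
  have e5 : `|d| ^+ 3 <= A ^+ 3 * `|r| ^+ 3.
    by rewrite -exprMn lerXn2r ?nnegrE ?mulr_ge0 ?HA.
  (* Three cubic errors: the remainder of [h], the remainder of [f] times [h1], and $d^2-(r D_1)^2$,
     factored into a difference of order $r^2$ and a sum of order $r$. *)
  rewrite (_ : _ - _ - _ - _ = (h y - h x - h1 x * d - h2 x / 2 * d ^+ 2) +
     h1 x * (d - r * D1 v w - r ^+ 2 / 2 * D2 v w) +
     h2 x / 2 * ((d - r * D1 v w) * (d + r * D1 v w))); last by rewrite /d; field.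
  rewrite [leRHS]mulrDl [X in _ <= X + _]mulrDl (le_trans (ler_normD _ _))// lerD//.
    rewrite (le_trans (ler_normD _ _))// lerD//.
      by rewrite (le_trans e4)// -mulrA ler_wpM2l.
    rewrite normrM -[leRHS]mulrA; apply: ler_pM => //; apply: bh1; exact: fD.
  rewrite normrM normrM [`|2^-1|]ger0_norm//.
  rewrite -[leRHS]mulrA; apply: ler_pM => //.
    by apply: ler_wpM2r => //; apply: bh2; exact: fD.
  rewrite normrM.
  rewrite (_ : E * (A + C) * `|r| ^+ 3 = (E * `|r| ^+ 2) * ((A + C) * `|r|)); last by ring.
  exact: ler_pM.
- by move=> v; exact: bounded_fctM.
- by move=> v; apply: bounded_fctD; apply: bounded_fctM => //; exact: bounded_fctM.
- by move=> v; exact: lipM.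
- move=> v; apply: lipD; apply: lipM => //; [exact: bounded_fctM|exact: lipM].
Qed.

End smooth.

(** * A twice differentiable step function from B-splines *)

Section spline_step.
Variable R : realType.
Implicit Types x y v : R.

Definition truncated_pow (k : nat) (x : R) : R := Num.max 0 x ^+ k.

(** Third finite difference of the truncated power. Beyond 3 it is the third difference of $x^k$:
    the constant $3!=6$ for $k=3$ and 0 for $k=1,2$. *)
Definition spline (k : nat) (x : R) : R :=
  truncated_pow k x - 3 * truncated_pow k (x - 1) + 3 * truncated_pow k (x - 2)
  - truncated_pow k (x - 3).

(* The integral of the quadratic B-spline: a nonincreasing C^2 step from 1 to 0 on [0, 3]. *)
Definition step x : R := 1 - spline 3 x / 6.
Definition step1 x : R := - (spline 2 x / 2).
Definition step2 x : R := - spline 1 x.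

Lemma step_le0 x : x <= 0 -> step x = 1.
Proof.
move=> x0; rewrite /step /spline /truncated_pow !max_l; [by rewrite !expr0n /=; field|lra..].
Qed.

Lemma step_ge3 x : 3 <= x -> step x = 0.
Proof.
move=> x0; rewrite /step /spline /truncated_pow !max_r; [by field|lra..].
Qed.

Lemma step_bounds x : 0 <= step x <= 1.
Proof.
rewrite /step /spline /truncated_pow.
have [x0|x0] := leP x 0; first by rewrite !max_l; [rewrite !expr0n /=; lra|lra..].
have [x1|x1] := leP x 1.
  rewrite !max_l; [|lra..].
  have h : 0 <= x ^+ 3 by rewrite exprn_ge0// ltW.
  have h1 : x ^+ 3 <= 1 by rewrite exprn_ile1// ltW.
  by rewrite !expr0n /=; lra.
have [x2|x2] := leP x 2.
  rewrite (max_r (y := x - 1)); last lra.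
  rewrite !max_l; [|lra..].
  have -> : x = (x - 1) + 1 by lra.
  rewrite addrK; set u := x - 1; have u0 : 0 <= u by rewrite /u; lra.
  have u1 : u <= 1 by rewrite /u; lra.
  have h : 0 <= u ^+ 3 by rewrite exprn_ge0.
  have h1 : u ^+ 3 <= u ^+ 2 by rewrite exprS ler_piMl// exprn_ge0.
  have h2 : u ^+ 2 <= u by rewrite expr2 ler_piMl.
  have e : (u + 1) ^+ 3 = u ^+ 3 + 3 * u ^+ 2 + 3 * u + 1 by ring.
  have h3 : (1 - u) ^+ 2 * (1 + 2 * u) >= 0 by rewrite mulr_ge0 ?sqr_ge0//; lra.
  have e3 : (1 - u) ^+ 2 * (1 + 2 * u) = 1 - 3 * u ^+ 2 + 2 * u ^+ 3 by ring.
  by rewrite e !expr0n /=; lra.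
have [x3|x3] := leP x 3.
  rewrite (max_r (y := x - 1)); last lra.
  rewrite (max_r (y := x - 2)); last lra.
  rewrite !max_l; [|lra..].
  have -> : 1 - (x ^+ 3 - 3 * (x - 1) ^+ 3 + 3 * (x - 2) ^+ 3 - 0 ^+ 3) / 6 = (3 - x) ^+ 3 / 6.
    by rewrite expr0n /=; field.
  have y0 : 0 <= 3 - x by lra.
  have y1 : 3 - x <= 1 by lra.
  have h : 0 <= (3 - x) ^+ 3 by rewrite exprn_ge0.
  have h1 : (3 - x) ^+ 3 <= 1 by rewrite exprn_ile1.
  by move: h h1; set z := (3 - x) ^+ 3; lra.
rewrite !max_r; [|lra..].
rewrite (_ : 1 - _ / 6 = 0); [by rewrite lexx ler01|by field].
Qed.

Lemma step1_bounds x : -1 <= step1 x <= 0.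
Proof.
rewrite /step1 /spline /truncated_pow.
have [x0|x0] := leP x 0; first by rewrite !max_l; [rewrite !expr0n /=; lra|lra..].
have [x1|x1] := leP x 1.
  rewrite !max_l; [|lra..].
  by rewrite !expr0n /=; nra.
have [x2|x2] := leP x 2.
  rewrite (max_r (y := x - 1)); last lra.
  rewrite !max_l; [|lra..].
  by rewrite !expr0n /=; nra.
have [x3|x3] := leP x 3.
  rewrite (max_r (y := x - 1)); last lra.
  rewrite (max_r (y := x - 2)); last lra.
  rewrite !max_l; [|lra..].
  by rewrite !expr0n /=; nra.
rewrite !max_r; [|lra..].
rewrite (_ : - (_ / 2) = 0); [by rewrite lexx oppr_le0 ler01|by field].
Qed.

Lemma step2_bound x : `|step2 x| <= 1.
Proof.
rewrite /step2 /spline /truncated_pow normrN ler_norml.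
have [x0|x0] := leP x 0; first by rewrite !max_l; [rewrite !expr0n /=; lra|lra..].
have [x1|x1] := leP x 1.
  rewrite !max_l; [|lra..].
  by rewrite !expr0n /=; lra.
have [x2|x2] := leP x 2.
  rewrite (max_r (y := x - 1)); last lra.
  rewrite !max_l; [|lra..].
  by rewrite !expr0n /=; lra.
have [x3|x3] := leP x 3.
  rewrite (max_r (y := x - 1)); last lra.
  rewrite (max_r (y := x - 2)); last lra.
  rewrite !max_l; [|lra..].
  by rewrite !expr0n /=; lra.
by rewrite !max_r; lra.
Qed.

Lemma truncated_pow1_lip x y : `|truncated_pow 1 y - truncated_pow 1 x| <= `|y - x|.
Proof.
rewrite /truncated_pow !expr1.
have h1 := ler_norm (y - x); have h2 := ler_norm (x - y); rewrite distrC in h2.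
rewrite ler_norml; case: (leP 0 x) => x0; case: (leP 0 y) => y0; lra.
Qed.

Lemma truncated_pow2_taylor x y :
  `|truncated_pow 2 y - truncated_pow 2 x - 2 * truncated_pow 1 x * (y - x)| <= `|y - x| ^+ 2.
Proof.
rewrite /truncated_pow !expr1 real_normK ?num_real// ler_norml.
case: (leP 0 x) => x0; case: (leP 0 y) => y0; rewrite ?expr0n /=.
- have := sqr_ge0 (y - x); set a := (y - x) ^+ 2 => a0.
  rewrite (_ : _ - _ = a); last by rewrite /a; ring.
  by rewrite lexx andbT; lra.
- have h := mulr_ge0 x0 (ltW (_ : 0 < - y)); have {}h : 0 <= x * - y by apply: h; lra.
  by apply/andP; split; nra.
- have h := mulr_ge0 y0 (ltW (_ : 0 < - x)); have {}h : 0 <= y * - x by apply: h; lra.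
  by apply/andP; split; nra.
- by have := sqr_ge0 (y - x); lra.
Qed.

Lemma truncated_pow3_taylor x y :
  `|truncated_pow 3 y - truncated_pow 3 x - 3 * truncated_pow 2 x * (y - x)
    - 3 * truncated_pow 1 x * (y - x) ^+ 2| <= `|y - x| ^+ 3.
Proof.
rewrite /truncated_pow !expr1.
case: (leP 0 x) => x0; case: (leP 0 y) => y0.
- rewrite (_ : _ - _ = (y - x) ^+ 3); last by ring.
  by rewrite normrX.
- rewrite (_ : _ - _ = (- y) ^+ 3 - (x - y) ^+ 3); last by rewrite expr0n /=; ring.
  rewrite (distrC y x) [`|x - y|]ger0_norm ?subr_ge0 ?(le_trans (ltW y0) x0)//.
  have h1 : (- y) ^+ 3 <= (x - y) ^+ 3 by rewrite lerXn2r ?nnegrE//; lra.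
  have h2 : 0 <= (- y) ^+ 3 by rewrite exprn_ge0//; lra.
  by move: h1 h2; set a := (- y) ^+ 3; set b := (x - y) ^+ 3 => h1 h2; rewrite ler_norml; lra.
- rewrite (_ : _ - _ = y ^+ 3); last by rewrite !expr0n /=; ring.
  rewrite normrX lerXn2r ?nnegrE// (ger0_norm y0) [`|y - x|]ger0_norm; lra.
- by rewrite !expr0n /= mulr0 !mul0r !subr0 normr0 exprn_ge0.
Qed.

Let shift x y (a : R) : y - a - (x - a) = y - x. Proof. by ring. Qed.

(** The constant is $1+3+3+1$, the sum of the absolute coefficients of the spline; the truncated
    power itself has constant 1. *)
Lemma step2_lip x y : `|step2 y - step2 x| <= 8 * `|y - x|.
Proof.
have t0 := truncated_pow1_lip x y.
have := truncated_pow1_lip (x - 1) (y - 1); have := truncated_pow1_lip (x - 2) (y - 2).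
have := truncated_pow1_lip (x - 3) (y - 3); rewrite !shift.
move: t0; rewrite /step2 /spline !ler_norml; lra.
Qed.

Lemma step1_taylor x y : `|step1 y - step1 x - step2 x * (y - x)| <= 4 * `|y - x| ^+ 2.
Proof.
have t0 := truncated_pow2_taylor x y.
have := truncated_pow2_taylor (x - 1) (y - 1); have := truncated_pow2_taylor (x - 2) (y - 2).
have := truncated_pow2_taylor (x - 3) (y - 3); rewrite !shift.
move: t0; rewrite /step1 /step2 /spline !ler_norml; lra.
Qed.

Lemma step_taylor x y :
  `|step y - step x - step1 x * (y - x) - step2 x / 2 * (y - x) ^+ 2| <= 8 * `|y - x| ^+ 3.
Proof.
have t0 := truncated_pow3_taylor x y.
have := truncated_pow3_taylor (x - 1) (y - 1); have := truncated_pow3_taylor (x - 2) (y - 2).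
have := truncated_pow3_taylor (x - 3) (y - 3); rewrite !shift.
have n0 : 0 <= `|y - x| ^+ 3 by rewrite exprn_ge0.
move: t0 n0; rewrite /step /step1 /step2 /spline !ler_norml.
by set r := `|y - x| ^+ 3; lra.
Qed.

Lemma step1_lip x y : `|step1 y - step1 x| <= 8 * `|y - x|.
Proof.
have /andP[a1 a2] := step1_bounds x; have /andP[b1 b2] := step1_bounds y.
have [r1|r1] := leP `|y - x| 1; last by rewrite ler_norml; lra.
have t := step1_taylor x y; have b := step2_bound x.
have r2 : `|y - x| ^+ 2 <= `|y - x| by rewrite expr2 ler_piMl.
rewrite -[X in `|X|](subrK (step2 x * (y - x))) (le_trans (ler_normD _ _))//.
have h : `|step2 x * (y - x)| <= `|y - x| by rewrite normrM ler_piMl.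
have := normr_ge0 (y - x); lra.
Qed.

Lemma step_lip x y : `|step y - step x| <= 10 * `|y - x|.
Proof.
have /andP[a1 a2] := step_bounds x; have /andP[b1 b2] := step_bounds y.
have [r1|r1] := leP `|y - x| 1; last by rewrite ler_norml; lra.
have t := step_taylor x y; have b := step2_bound x.
have b' : `|step1 x| <= 1 by have /andP[? ?] := step1_bounds x; rewrite ler_norml; lra.
have r0 := normr_ge0 (y - x).
have r2 : `|y - x| ^+ 2 <= `|y - x| by rewrite expr2 ler_piMl.
have r3 : `|y - x| ^+ 3 <= `|y - x| by rewrite exprS ler_piMr// (le_trans r2).
have -> : step y - step x = (step y - step x - step1 x * (y - x) - step2 x / 2 * (y - x) ^+ 2)
  + step1 x * (y - x) + step2 x * ((y - x) ^+ 2 / 2) by field.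
have h : `|step1 x * (y - x)| <= `|y - x| by rewrite normrM ler_piMl.
have h2 : `|step2 x * ((y - x) ^+ 2 / 2)| <= `|y - x|.
  rewrite normrM; apply: (@le_trans _ _ (1 * `|y - x|)); last by rewrite mul1r.
  apply: ler_pM => //; rewrite normrM normrX [`|2^-1|]ger0_norm//.
  by have : 0 <= `|y - x| ^+ 2 by []; lra.
rewrite (le_trans (ler_normD _ _))//.
have := ler_normD (step y - step x - step1 x * (y - x) - step2 x / 2 * (y - x) ^+ 2) (step1 x * (y - x)).
lra.
Qed.

Lemma measurable_truncated_pow k : measurable_fun [set: R] (truncated_pow k).
Proof. by apply: measurable_funX; exact: measurable_maxr. Qed.

Lemma measurable_spline k : measurable_fun [set: R] (spline k).
Proof.
have mt (a : R) : measurable_fun [set: R] (fun x => truncated_pow k (x - a)).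
  by apply: (measurableT_comp (measurable_truncated_pow k)); exact: measurable_funB.
apply: measurable_funB => //; apply: measurable_funD; last exact: measurable_funM.
by apply: measurable_funB; [exact: measurable_truncated_pow|exact: measurable_funM].
Qed.

Lemma measurable_step : measurable_fun [set: R] step.
Proof.
apply: measurable_funB => //; apply: measurable_funM => //; exact: measurable_spline.
Qed.

Lemma measurable_step1 : measurable_fun [set: R] step1.
Proof.
apply: measurable_funN; apply: measurable_funM => //; exact: measurable_spline.
Qed.

Lemma measurable_step2 : measurable_fun [set: R] step2.
Proof. by apply: measurable_funN; exact: measurable_spline. Qed.

End spline_step.

(** * Closure properties of coordinatewise measurability *)

Section coord_measurable_closure.
Variables (R : realType) (J : Type).
Implicit Types (f g : (J -> R) -> R).

Lemma cm_coord (j : J) : coord_measurable (fun w : J -> R => w j).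
Proof. by move=> d U W mW; exact: mW. Qed.

Lemma cm_cst (c : R) : coord_measurable (fun _ : J -> R => c).
Proof. by move=> d U W mW. Qed.

Lemma cmD f g : coord_measurable f -> coord_measurable g -> coord_measurable (fun w => f w + g w).
Proof. by move=> mf mg d U W mW; apply: measurable_funD; [exact: mf|exact: mg]. Qed.

Lemma cmM f g : coord_measurable f -> coord_measurable g -> coord_measurable (fun w => f w * g w).
Proof. by move=> mf mg d U W mW; apply: measurable_funM; [exact: mf|exact: mg]. Qed.

Lemma cm_comp (h : R -> R) f : measurable_fun [set: R] h -> coord_measurable f ->
  coord_measurable (fun w => h (f w)).
Proof. by move=> mh mf d U W mW; apply: (measurableT_comp mh); exact: mf. Qed.

Lemma cm_sum (I : Type) (s : seq I) (f : I -> (J -> R) -> R) :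
  (forall i, coord_measurable (f i)) -> coord_measurable (fun w => \sum_(i <- s) f i w).
Proof.
move=> mf; elim: s => [|i s IH].
  rewrite (_ : (fun _ => _) = fun=> 0); first exact: cm_cst.
  by apply/funext => w; rewrite big_nil.
rewrite (_ : (fun _ => _) = fun w => f i w + \sum_(i <- s) f i w); first exact: cmD.
by apply/funext => w; rewrite big_cons.
Qed.

Lemma cm_sqrt f : coord_measurable f -> coord_measurable (fun w => Num.sqrt (f w)).
Proof.
apply: cm_comp; apply: nondecreasing_measurable => //.
by move=> x y xy; exact: ler_wsqrtr.
Qed.

(** Capping the argument below at 1 turns inversion into a monotone, hence measurable, function on
    the whole line. *)
Lemma cm_inv f : (forall w, 1 <= f w) -> coord_measurable f -> coord_measurable (fun w => (f w)^-1).
Proof.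
move=> f1 mf; have -> : (fun w => (f w)^-1) = (fun w => (Num.max (f w) 1)^-1).
  by apply/funext => w; rewrite max_l.
apply: (cm_comp (h := fun x => (Num.max x 1)^-1)) => //.
apply: nonincreasing_measurable => //.
move=> x y xy; rewrite lef_pV2 ?posrE ?lt_max ?ltr01 ?orbT//.
by rewrite ge_max !le_max xy lexx !orbT.
Qed.

End coord_measurable_closure.

Lemma line_coordE (R : realType) (J : Type) (w v : J -> R) r j :
  (w + r *: v) j = w j + r * v j.
Proof. by []. Qed.

Lemma sum_norm_ge0 (R : realType) (I : Type) (s : seq I) (f : I -> R) :
  0 <= \sum_(i <- s) `|f i|.
Proof. by apply: sumr_ge0 => i _; exact: normr_ge0. Qed.

(** * The levels of the processes and the functional compared *)

Section gordon_functional.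
Variables (R : realType) (m p : nat).
Local Notation J := (option 'I_m * 'I_p)%type.
Implicit Types (u v w : J -> R) (h : 'I_p) (k : 'I_m) (c : R).

(* The coordinates [(Some k, h)] carry the image of the [h]-th direction and
   [(None, h)] a scalar process; the [1] makes the norm smooth at 0. *)
Definition smooth_norm h w : R := Num.sqrt (1 + \sum_k w (Some k, h) ^+ 2).

Definition unit_coord h k w : R := w (Some k, h) * (smooth_norm h w)^-1.

Definition level c h w : R := smooth_norm h w + w (None, h) - c.

(* Here and below the suffixes 1 and 2 mark the first and second derivatives in
   the direction [v]. *)
Definition level1 h v w : R := \sum_k v (Some k, h) * unit_coord h k w + v (None, h).

Definition level2 h v w : R := (\sum_k v (Some k, h) ^+ 2) * (smooth_norm h w)^-1 -
  (smooth_norm h w)^-1 * ((\sum_k v (Some k, h) * unit_coord h k w) *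
                          (\sum_k v (Some k, h) * unit_coord h k w)).

Let arg_ge1 h w : 1 <= 1 + \sum_k w (Some k, h) ^+ 2.
Proof. by rewrite lerDl sumr_ge0// => k _; exact: sqr_ge0. Qed.

Lemma smooth_norm_ge1 h w : 1 <= smooth_norm h w.
Proof. by rewrite /smooth_norm -[X in X <= _]sqrtr1; exact: ler_wsqrtr. Qed.

Lemma smooth_norm_gt0 h w : 0 < smooth_norm h w.
Proof. exact: lt_le_trans ltr01 (smooth_norm_ge1 h w). Qed.

Lemma sqr_smooth_norm h w : smooth_norm h w ^+ 2 = 1 + \sum_k w (Some k, h) ^+ 2.
Proof. by rewrite /smooth_norm sqr_sqrtr// (le_trans ler01). Qed.

Lemma coord_le_smooth_norm h k w : `|w (Some k, h)| <= smooth_norm h w.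
Proof.
rewrite -(ler_pXn2r (n := 2))// ?nnegrE ?(ltW (smooth_norm_gt0 _ _))//.
rewrite sqr_smooth_norm real_normK ?num_real// (bigD1 k)//= addrCA lerDl.
by rewrite addr_ge0// sumr_ge0// => i _; exact: sqr_ge0.
Qed.

(** After multiplication by the sum of the two norms it becomes a bound on a difference of squares,
    a finite sum in which each coordinate is at most its norm. *)
Lemma smooth_norm_lip_bound h v w r :
  `|smooth_norm h (w + r *: v) - smooth_norm h w| <= (\sum_k `|v (Some k, h)|) * `|r|.
Proof.
set Q := smooth_norm h w; set Q' := smooth_norm h (w + r *: v).
have Q0 : 0 < Q by exact: smooth_norm_gt0.
have Q'0 : 0 < Q' by exact: smooth_norm_gt0.
rewrite -(ler_pM2r (addr_gt0 Q'0 Q0)) -[X in _ * X]gtr0_norm ?addr_gt0//.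
rewrite -normrM -subr_sqr !sqr_smooth_norm opprD addrACA subrr add0r -sumrB.
rewrite (le_trans (ler_norm_sum _ _ _))// [X in _ <= X * _]mulrC mulr_sumr mulr_suml; apply: ler_sum => k _.
rewrite subr_sqr normrM; apply: ler_pM => //.
  by rewrite line_coordE addrAC subrr add0r /= normrM.
rewrite (le_trans (ler_normD _ _))// lerD//; exact: coord_le_smooth_norm.
Qed.

Lemma smooth_norm_lip h : line_lipschitz (smooth_norm h).
Proof.
move=> v; exists (\sum_k `|v (Some k, h)|); split; first exact: sum_norm_ge0.
by move=> w r; exact: smooth_norm_lip_bound.
Qed.

Lemma inv_smooth_norm_bounded h : bounded_fct (fun w => (smooth_norm h w)^-1).
Proof.
exists 1; split => // w; rewrite gtr0_norm ?invr_gt0 ?smooth_norm_gt0//.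
by rewrite invf_le1 ?smooth_norm_gt0// smooth_norm_ge1.
Qed.

Lemma inv_smooth_norm_lip h : line_lipschitz (fun w => (smooth_norm h w)^-1).
Proof.
apply: (lip_comp (K := 1) (Dm := fun x => 1 <= x) (h := fun x => x^-1)) => //.
- move=> x y x1 y1; have x0 : 0 < x by exact: lt_le_trans x1.
  have y0 : 0 < y by exact: lt_le_trans y1.
  rewrite mul1r (_ : y^-1 - x^-1 = (x - y) * (x * y)^-1); last by field; rewrite !gt_eqF.
  rewrite normrM distrC ler_piMr// gtr0_norm ?invr_gt0 ?mulr_gt0//.
  by rewrite invf_le1 ?mulr_gt0//; nra.
- by move=> w; exact: smooth_norm_ge1.
- exact: smooth_norm_lip.
Qed.

Lemma unit_coord_bounded h k : bounded_fct (unit_coord h k).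
Proof.
exists 1; split => // w; rewrite /unit_coord normrM [`|_^-1|]gtr0_norm ?invr_gt0 ?smooth_norm_gt0//.
by rewrite ler_pdivrMr ?smooth_norm_gt0// mul1r coord_le_smooth_norm.
Qed.

Lemma unit_coord_lip h k : line_lipschitz (unit_coord h k).
Proof.
move=> v; exists (`|v (Some k, h)| + \sum_k `|v (Some k, h)|); split.
  by rewrite addr_ge0// sum_norm_ge0.
move=> w r; rewrite /unit_coord line_coordE.
have := smooth_norm_lip_bound h v w r.
set Q' := smooth_norm h (_ + _); set Q := smooth_norm h w => hQ.
have Q1 : 1 <= Q by exact: smooth_norm_ge1.
have Q'1 : 1 <= Q' by exact: smooth_norm_ge1.
have Q0 : 0 < Q by exact: lt_le_trans Q1.
have Q'0 : 0 < Q' by exact: lt_le_trans Q'1.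
rewrite (_ : _ - _ = r * v (Some k, h) / Q' + (w (Some k, h) / Q) * ((Q - Q') / Q')); last first.
  by field; rewrite !gt_eqF.
have i1 : `|Q'^-1| <= 1 by rewrite gtr0_norm ?invr_gt0// invf_le1.
have i0 : `|w (Some k, h) / Q| <= 1.
  by rewrite normrM [`|Q^-1|]gtr0_norm ?invr_gt0// ler_pdivrMr// mul1r coord_le_smooth_norm.
rewrite [leRHS]mulrDl (le_trans (ler_normD _ _))// lerD//.
  by rewrite (normrM (r * _)) (normrM r) [leRHS]mulrC ler_piMr// mulr_ge0.
rewrite normrM (le_trans (ler_piMl _ i0))// normrM distrC.
by rewrite (le_trans (ler_piMr _ i1)).
Qed.

(** No derivative of the square root is taken. Let $A=\langle v,u\rangle$ with $u$ the normalised
    vector, $B=|v|^2$ and $D=Q'-Q$. From $Q'^2=Q^2+2rQA+r^2B$ one gets $D-rA=(r^2B-D^2)/(2Q)$, of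
    order $r^2$; the full remainder equals $-(D-rA)(D+rA)/(2Q)$, of order $r^3$. *)
Lemma level_taylor c h v : exists C : R, 0 <= C /\ forall w r,
  `|level c h (w + r *: v) - level c h w - r * level1 h v w - r ^+ 2 / 2 * level2 h v w|
    <= C * `|r| ^+ 3.
Proof.
pose L := \sum_k `|v (Some k, h)|; pose B := \sum_k v (Some k, h) ^+ 2.
have L0 : 0 <= L by exact: sum_norm_ge0.
have B0 : 0 <= B by apply: sumr_ge0 => k _; exact: sqr_ge0.
exists ((B + L ^+ 2) * L / 2); split; first by rewrite divr_ge0// mulr_ge0// addr_ge0// sqr_ge0.
move=> w r; pose A := \sum_k v (Some k, h) * unit_coord h k w.
have := smooth_norm_lip_bound h v w r; rewrite -/L.
have := sqr_smooth_norm h (w + r *: v); have := sqr_smooth_norm h w.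
have := smooth_norm_ge1 h w.
rewrite /level /level1 /level2 -/A -/B.
have AE : \sum_k w (Some k, h) * v (Some k, h) = smooth_norm h w * A.
  rewrite /A mulr_sumr; apply: eq_bigr => k _; rewrite /unit_coord.
  by field; rewrite gt_eqF// smooth_norm_gt0.
have AL : `|A| <= L.
  rewrite (le_trans (ler_norm_sum _ _ _))//; apply: ler_sum => k _.
  rewrite normrM ler_piMr// /unit_coord normrM [`|_^-1|]gtr0_norm ?invr_gt0 ?smooth_norm_gt0//.
  by rewrite ler_pdivrMr ?smooth_norm_gt0// mul1r coord_le_smooth_norm.
set Q' := smooth_norm h (_ + _); set Q := smooth_norm h w in AE *.
move=> Q1 eQ; under eq_bigr do rewrite line_coordE; rewrite !line_coordE.
have -> : \sum_k (w (Some k, h) + r * v (Some k, h)) ^+ 2 =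
    \sum_k w (Some k, h) ^+ 2 + 2 * r * (Q * A) + r ^+ 2 * B.
  rewrite -AE /B !mulr_sumr -!big_split/=; apply: eq_bigr => k _; ring.
rewrite addrA addrA -eQ => eQ' hL.
have Q0 : 0 < Q by exact: lt_le_trans Q1.
pose D := Q' - Q.
have eD : 2 * Q * D = 2 * r * (Q * A) + r ^+ 2 * B - D ^+ 2.
  by rewrite /D; apply/eqP; rewrite -subr_eq0; apply/eqP; transitivity (Q' ^+ 2 - (Q ^+ 2 + 2 * r * (Q * A) + r ^+ 2 * B)); [ring|rewrite eQ' subrr].
have e1 : D - r * A = (r ^+ 2 * B - D ^+ 2) / (2 * Q).
  by apply: (@mulfI _ (2 * Q)); [rewrite mulf_neq0// gt_eqF|rewrite mulrBr eD; field; rewrite gt_eqF].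
rewrite (_ : _ - _ = - ((D - r * A) * (D + r * A)) / (2 * Q)); last first.
  have -> : Q' + (w (None, h) + r * v (None, h)) - c - (Q + w (None, h) - c) -
     r * (A + v (None, h)) = D - r * A by rewrite /D; ring.
  rewrite {1}e1; field.
  by rewrite gt_eqF.
have i1 : 0 <= (2 * Q)^-1 <= 2^-1.
  rewrite invr_ge0 mulr_ge0 ?(ltW Q0)//= lef_pV2 ?posrE ?mulr_gt0//.
  by rewrite ler_peMr.
have D2 : D ^+ 2 <= L ^+ 2 * `|r| ^+ 2.
  by rewrite -exprMn -(real_normK (num_real D)) lerXn2r ?nnegrE ?mulr_ge0.
have e2 : `|D - r * A| <= (B + L ^+ 2) * `|r| ^+ 2 / 2.
  rewrite e1 normrM; apply: ler_pM => //.
    rewrite (le_trans (ler_normB _ _))// mulrDl lerD//.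
      by rewrite normrM normrX (ger0_norm B0) mulrC.
    by rewrite ger0_norm ?sqr_ge0.
  by move: i1 => /andP[i1 i2]; rewrite ger0_norm.
have e3 : `|D + r * A| <= 2 * L * `|r|.
  rewrite (le_trans (ler_normD _ _))// (_ : 2 * L * `|r| = L * `|r| + `|r| * L); last by ring.
  by rewrite lerD// normrM ler_wpM2l.
rewrite normrM normrN normrM.
apply: (@le_trans _ _ ((B + L ^+ 2) * `|r| ^+ 2 / 2 * (2 * L * `|r|) * 2^-1)); last first.
  by rewrite le_eqVlt; apply/orP; left; apply/eqP; field.
apply: ler_pM => //; first by apply: ler_pM.
by move: i1 => /andP[i1 i2]; rewrite ger0_norm.
Qed.

Lemma smooth_level c h : smooth (level c h) (level1 h) (level2 h).
Proof.
have bA v : bounded_fct (fun w => \sum_k v (Some k, h) * unit_coord h k w).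
  by apply: bounded_fct_sum => k; apply: bounded_fctM; [exact: bounded_fct_cst|exact: unit_coord_bounded].
have lA v : line_lipschitz (fun w => \sum_k v (Some k, h) * unit_coord h k w).
  apply: lip_sum => k; apply: lipM; [exact: bounded_fct_cst|exact: unit_coord_bounded|exact: lip_cst|exact: unit_coord_lip].
have bQ := inv_smooth_norm_bounded h; have lQ := inv_smooth_norm_lip h.
split.
- rewrite /level; apply: lipD; last exact: lip_cst.
  apply: lipD; first exact: smooth_norm_lip.
  move=> v; exists `|v (None, h)|; split => // w r.
  by rewrite line_coordE addrAC subrr add0r normrM mulrC.
- exact: level_taylor.
- by move=> v; apply: bounded_fctD => //; exact: bounded_fct_cst.
- move=> v; rewrite (_ : level2 h v = fun w => (\sum_k v (Some k, h) ^+ 2) * (smooth_norm h w)^-1 +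
    (-1) * ((smooth_norm h w)^-1 * ((\sum_k v (Some k, h) * unit_coord h k w) *
                          (\sum_k v (Some k, h) * unit_coord h k w)))); last first.
    by apply/funext => w; rewrite mulN1r.
  apply: bounded_fctD; apply: bounded_fctM => //; try exact: bounded_fct_cst.
  by apply: bounded_fctM => //; exact: bounded_fctM.
- by move=> v; apply: lipD => //; exact: lip_cst.
- move=> v; rewrite (_ : level2 h v = fun w => (\sum_k v (Some k, h) ^+ 2) * (smooth_norm h w)^-1 +
    (-1) * ((smooth_norm h w)^-1 * ((\sum_k v (Some k, h) * unit_coord h k w) *
                          (\sum_k v (Some k, h) * unit_coord h k w)))); last first.
    by apply/funext => w; rewrite mulN1r.
  apply: lipD; apply: lipM => //; try exact: bounded_fct_cst; try exact: lip_cst.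
    by apply: bounded_fctM => //; exact: bounded_fctM.
  by apply: lipM => //; [exact: bounded_fctM|exact: lipM].
Qed.

(** A smoothed count of low levels: an index counts fully at level at most 0 and not at all from
    level 3 on. This is the 3 that later enters the tail bounds. *)
Definition hits c w : R := \sum_h step (level c h w).

Definition hits1 c v w : R := \sum_h step1 (level c h w) * level1 h v w.

Definition hits2 c v w : R := \sum_h (step1 (level c h w) * level2 h v w +
  step2 (level c h w) * (level1 h v w * level1 h v w)).

Lemma smooth_hits c : smooth (hits c) (hits1 c) (hits2 c).
Proof.
apply: smooth_sum => h.
apply: (@smooth_comp _ _ (@step R) (@step1 R) (@step2 R) 10 (fun=> True)) => //.
- by move=> x y _ _; exact: step_lip.
- by move=> x y _ _; rewrite (le_trans (step1_lip _ _))// ler_wpM2r// ler_nat.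
- by move=> x y _ _; rewrite (le_trans (step2_lip _ _))// ler_wpM2r// ler_nat.
- by move=> x _; have /andP[] := step1_bounds x; rewrite ler_norml; lra.
- by move=> x _; have := step2_bound x; lra.
- by move=> x y _ _; rewrite (le_trans (step_taylor _ _))// ler_wpM2r ?exprn_ge0// ler_nat.
- exact: smooth_level.
Qed.

Lemma hits_ge0 c w : 0 <= hits c w.
Proof. by apply: sumr_ge0 => h _; have /andP[] := step_bounds (level c h w). Qed.

(* Roughly the indicator that some level is at most [c]; its concavity in [hits]
   is what gives the mixed second derivatives the sign Gordon's comparison needs. *)
Definition gordon c w : R := 1 - (1 + hits c w)^-1.

Definition gordon2 c v w : R := (1 + hits c w)^-1 ^+ 2 * hits2 c v w +
  (- 2 * (1 + hits c w)^-1 ^+ 3) * (hits1 c v w * hits1 c v w).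

(** Composition with $1-1/(1+x)$ on $x\ge 0$. The constant 6 bounds $2(b^2+ab+a^2)$ for
    $a,b\in[0,1]$, which arises when $2a^3$ and $2b^3$ are compared. *)
Lemma smooth_gordon c : smooth (gordon c)
  (fun v w => (1 + hits c w)^-1 ^+ 2 * hits1 c v w) (gordon2 c).
Proof.
pose z (x : R) := (1 + x)^-1.
have z01 x : 0 <= x -> 0 <= z x <= 1.
  by move=> x0; rewrite invr_ge0 addr_ge0//= invf_le1 ?ltr_pwDl// lerDl.
have zB x y : 0 <= x -> 0 <= y -> z y - z x = - (y - x) * (z x * z y).
  by move=> x0 y0; rewrite /z; field; rewrite !gt_eqF ?ltr_pwDl.
have zl x y : 0 <= x -> 0 <= y -> `|z y - z x| <= `|y - x|.
  move=> x0 y0; rewrite zB// normrM normrN ler_piMr//.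
  have /andP[a1 a2] := z01 _ x0; have /andP[b1 b2] := z01 _ y0.
  by rewrite ger0_norm ?mulr_ge0// mulr_ile1.
apply: (@smooth_comp _ _ (fun x => 1 - z x) (fun x => z x ^+ 2) (fun x => - 2 * z x ^+ 3) 6
   (fun x => 0 <= x)) => //.
- move=> x y x0 y0; have := zl _ _ x0 y0.
  rewrite (_ : _ - _ - _ = - (z y - z x)); last by ring.
  by rewrite normrN; have := normr_ge0 (y - x); lra.
- move=> x y x0 y0; have h := zl _ _ x0 y0.
  have /andP[a1 a2] := z01 _ x0; have /andP[b1 b2] := z01 _ y0.
  rewrite subr_sqr normrM mulrC; apply: ler_pM => //.
  by rewrite ger0_norm ?addr_ge0//; lra.
- move=> x y x0 y0; have h := zl _ _ x0 y0.
  have /andP[a1 a2] := z01 _ x0; have /andP[b1 b2] := z01 _ y0.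
  rewrite (_ : _ - _ = (2 * (z y ^+ 2 + z y * z x + z x ^+ 2)) * - (z y - z x)); last by ring.
  rewrite normrM normrN; apply: ler_pM => //.
  rewrite ger0_norm; last by rewrite mulr_ge0// !addr_ge0 ?mulr_ge0.
  have : z y ^+ 2 <= 1 by rewrite exprn_ile1.
  have : z x ^+ 2 <= 1 by rewrite exprn_ile1.
  have : z y * z x <= 1 by rewrite mulr_ile1.
  lra.
- move=> x x0; have /andP[a1 a2] := z01 _ x0.
  have : z x ^+ 2 <= 1 by rewrite exprn_ile1.
  by rewrite ger0_norm ?exprn_ge0//; lra.
- move=> x x0; have /andP[a1 a2] := z01 _ x0.
  have : z x ^+ 3 <= 1 by rewrite exprn_ile1.
  by rewrite normrM normrN !ger0_norm ?exprn_ge0//; lra.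
- move=> x y x0 y0; have e := zB _ _ x0 y0.
  have /andP[a1 a2] := z01 _ x0; have /andP[b1 b2] := z01 _ y0.
  have ey : z y = z x - (y - x) * (z x * z y) by rewrite -mulNr -e addrC subrK.
  (* The expansion of $1/(1+y)$ at $x$ is a finite geometric sum, so its remainder is known
     exactly. *)
  rewrite (_ : _ - _ = (y - x) ^+ 3 * (z x ^+ 3 * z y)).
    rewrite normrM normrX mulrC ler_wpM2r ?exprn_ge0//.
    rewrite ger0_norm ?mulr_ge0 ?exprn_ge0//.
    have : z x ^+ 3 * z y <= 1 by rewrite mulr_ile1// ?exprn_ge0// exprn_ile1.
    lra.
  set d := y - x in ey *; set a := z x in ey *; set b := z y in ey *.
  transitivity (a - b - a ^+ 2 * d + a ^+ 3 * d ^+ 2); first by field.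
  have h1 : a - b = d * (a * b) by rewrite {1}ey; ring.
  rewrite h1; transitivity (d * a * (b - a + a ^+ 1 * (d * a))); first by ring.
  have -> : b - a = - (d * (a * b)) by rewrite -h1 opprB.
  transitivity (d * a * (d * a * (a - b))); first by ring.
  by rewrite h1; ring.
- exact: hits_ge0.
- exact: smooth_hits.
Qed.

Lemma cm_smooth_norm h : coord_measurable (smooth_norm h).
Proof.
apply: cm_sqrt; apply: cmD; first exact: cm_cst.
by apply: cm_sum => k; apply: (cm_comp (h := fun x => x ^+ 2)); [exact: measurable_funX|exact: cm_coord].
Qed.

Lemma cm_inv_smooth_norm h : coord_measurable (fun w => (smooth_norm h w)^-1).
Proof. by apply: cm_inv; [exact: smooth_norm_ge1|exact: cm_smooth_norm]. Qed.

Lemma cm_level c h : coord_measurable (level c h).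
Proof.
apply: cmD; last exact: cm_cst.
by apply: cmD; [exact: cm_smooth_norm|exact: cm_coord].
Qed.

Let cm_dot h v : coord_measurable (fun w => \sum_k v (Some k, h) * unit_coord h k w).
Proof.
apply: cm_sum => k; apply: cmM; first exact: cm_cst.
by apply: cmM; [exact: cm_coord|exact: cm_inv_smooth_norm].
Qed.

Lemma cm_level1 h v : coord_measurable (level1 h v).
Proof. by apply: cmD; [exact: cm_dot|exact: cm_cst]. Qed.

Lemma cm_level2 h v : coord_measurable (level2 h v).
Proof.
apply: cmD; first by apply: cmM; [exact: cm_cst|exact: cm_inv_smooth_norm].
apply: (cm_comp (h := fun x => - x)); first exact: measurable_funN.
apply: cmM; first exact: cm_inv_smooth_norm.
by apply: cmM; exact: cm_dot.
Qed.

Lemma cm_hits c : coord_measurable (hits c).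
Proof. by apply: cm_sum => h; apply: cm_comp; [exact: measurable_step|exact: cm_level]. Qed.

Lemma cm_hits1 c v : coord_measurable (hits1 c v).
Proof.
apply: cm_sum => h; apply: cmM; last exact: cm_level1.
by apply: cm_comp; [exact: measurable_step1|exact: cm_level].
Qed.

Lemma cm_hits2 c v : coord_measurable (hits2 c v).
Proof.
apply: cm_sum => h; apply: cmD; apply: cmM.
- by apply: cm_comp; [exact: measurable_step1|exact: cm_level].
- exact: cm_level2.
- by apply: cm_comp; [exact: measurable_step2|exact: cm_level].
- by apply: cmM; exact: cm_level1.
Qed.

Let cm_z c : coord_measurable (fun w => (1 + hits c w)^-1).
Proof.
apply: cm_inv; first by move=> w; rewrite lerDl hits_ge0.
by apply: cmD; [exact: cm_cst|exact: cm_hits].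
Qed.

Lemma gordon_bounds c w : 0 <= gordon c w <= 1.
Proof.
have h := hits_ge0 c w.
rewrite /gordon subr_ge0 invf_le1 ?ltr_pwDl// lerDl h/= gerBl invr_ge0.
by rewrite addr_ge0.
Qed.

Lemma bcm_gordon c : bounded_coord_measurable (gordon c).
Proof.
split; last first.
  exists 1 => w; have /andP[a b] := gordon_bounds c w.
  by rewrite ger0_norm.
apply: (cm_comp (h := fun x => 1 - x)); [exact: measurable_funB|exact: cm_z].
Qed.

Lemma bcm_gordon2 c v : bounded_coord_measurable (gordon2 c v).
Proof.
split; last first.
  by have [C [_ HC]] := smooth_bdd2 (smooth_gordon c) v; exists C.
apply: cmD; apply: cmM.
- by apply: (cm_comp (h := fun x => x ^+ 2)); [exact: measurable_funX|exact: cm_z].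
- exact: cm_hits2.
- apply: (cm_comp (h := fun x => - 2 * x ^+ 3)); last exact: cm_z.
  by apply: measurable_funM => //; exact: measurable_funX.
- by apply: cmM; exact: cm_hits1.
Qed.

End gordon_functional.

(** * Gordon's inequality between the two Gaussian processes *)

Lemma sqr_sum_expand (R : comPzRingType) (I : Type) (s : seq I) (f : I -> R) :
  (\sum_(i <- s) f i) ^+ 2 = \sum_(i <- s) \sum_(j <- s) f i * f j.
Proof. by rewrite expr2 big_distrlr. Qed.

Lemma dot_le1 (R : realFieldType) (I : finType) (x y : I -> R) :
  \sum_i x i ^+ 2 <= 1 -> \sum_i y i ^+ 2 <= 1 -> \sum_i x i * y i <= 1.
Proof.
move=> x1 y1; apply: (@le_trans _ _ (\sum_i (x i ^+ 2 + y i ^+ 2) / 2)).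
  apply: ler_sum => i _; have := sqr_ge0 (x i - y i); rewrite sqrrB mulr2n; lra.
by rewrite -mulr_suml big_split/=; lra.
Qed.

(* The difference of the two sides is [sum a_h a_h' (1 - <u_h,u_h'>) (1 - <x_h,x_h'>)]. *)
Lemma gordon_quadratic (R : realFieldType) (H K E : finType)
    (a : H -> R) (u : H -> K -> R) (x : H -> E -> R) :
  (forall h, a h <= 0) -> (forall h, \sum_k u h k ^+ 2 <= 1) ->
  (forall h, \sum_e x h e ^+ 2 <= 1) ->
  \sum_k (\sum_h a h * u h k) ^+ 2 + \sum_e (\sum_h a h * x h e) ^+ 2 <=
  \sum_k \sum_e (\sum_h a h * (x h e * u h k)) ^+ 2 + (\sum_h a h) ^+ 2.
Proof.
move=> a0 u1 x1; rewrite -subr_ge0.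
have eU : \sum_k (\sum_h a h * u h k) ^+ 2 =
    \sum_h \sum_g a h * a g * \sum_k u h k * u g k.
  under eq_bigr do rewrite sqr_sum_expand.
  rewrite exchange_big/=; apply: eq_bigr => h _; rewrite exchange_big/=; apply: eq_bigr => g _.
  by rewrite mulr_sumr; apply: eq_bigr => k _; ring.
have eX : \sum_e (\sum_h a h * x h e) ^+ 2 =
    \sum_h \sum_g a h * a g * \sum_e x h e * x g e.
  under eq_bigr do rewrite sqr_sum_expand.
  rewrite exchange_big/=; apply: eq_bigr => h _; rewrite exchange_big/=; apply: eq_bigr => g _.
  by rewrite mulr_sumr; apply: eq_bigr => e _; ring.
have eXU : \sum_k \sum_e (\sum_h a h * (x h e * u h k)) ^+ 2 =
    \sum_h \sum_g a h * a g * ((\sum_e x h e * x g e) * (\sum_k u h k * u g k)).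
  under eq_bigr do (under eq_bigr do rewrite sqr_sum_expand; rewrite exchange_big/=).
  rewrite exchange_big/=; apply: eq_bigr => h _.
  under eq_bigr do rewrite exchange_big/=.
  rewrite exchange_big/=; apply: eq_bigr => g _.
  rewrite mulr_suml mulr_sumr exchange_big/=; apply: eq_bigr => e _.
  by rewrite !mulr_sumr; apply: eq_bigr => k _; ring.
rewrite eU eX eXU sqr_sum_expand -!big_split/= -sumrB; apply: sumr_ge0 => h _.
rewrite -!big_split/= -sumrB; apply: sumr_ge0 => g _.
have hu : \sum_k u h k * u g k <= 1 by exact: dot_le1.
have hx : \sum_e x h e * x g e <= 1 by exact: dot_le1.
set U := \sum_k _ in hu *; set X := \sum_e _ in hx *.
rewrite [X in 0 <= X](_ : _ = (a h * a g) * ((1 - U) * (1 - X))); last by ring.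
by apply: mulr_ge0; [exact: mulr_le0|rewrite mulr_ge0 ?subr_ge0].
Qed.

Section gordon_comparison.
Variables (R : realType) (m n p : nat) (x : 'I_p -> 'M[R]_n).
Local Notation J := (option 'I_m * 'I_p)%type.
Hypothesis x1 : forall h, \sum_i \sum_j x h i j ^+ 2 = 1.

Definition matrix_dir (q : 'I_m * 'I_n * 'I_n) : J -> R := fun j =>
  if j.1 is Some k then (k == q.1.1)%:R * x j.2 q.1.2 q.2 else 0.

Definition scalar_dir : J -> R := fun j => if j.1 is Some k then 0 else 1.

Definition row_dir (k : 'I_m) : J -> R := fun j => if j.1 is Some l then (l == k)%:R else 0.

Definition entry_dir (e : 'I_n * 'I_n) : J -> R := fun j =>
  if j.1 is Some k then 0 else - x j.2 e.1 e.2.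

(* Gaussian combinations of [matrix_dirs] are the process [(Phi x_h, g)] with [g]
   a common scalar; those of [vector_dirs] are [(g, - <G, x_h>)] with [g] a common
   vector. *)
Definition matrix_dirs := scalar_dir :: map matrix_dir (enum {: 'I_m * 'I_n * 'I_n}).
Definition vector_dirs := map entry_dir (enum {: 'I_n * 'I_n}) ++ map row_dir (enum 'I_m).

Let sum_matrix_dirs (f : (J -> R) -> R) : \sum_(v <- matrix_dirs) f v =
  f scalar_dir + \sum_k \sum_(e : 'I_n * 'I_n) f (matrix_dir (k, e.1, e.2)).
Proof.
rewrite big_cons big_map big_enum/=; congr (_ + _).
transitivity (\sum_(ki : 'I_m * 'I_n) \sum_(j < n) f (matrix_dir (ki.1, ki.2, j))).
  by rewrite pair_bigA/=; apply: eq_bigr => -[[k i] j].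
transitivity (\sum_(k < m) \sum_(i < n) \sum_(j < n) f (matrix_dir (k, i, j))).
  by rewrite [RHS](pair_bigA _ (fun k i => \sum_(j < n) f (matrix_dir (k, i, j)))).
by apply: eq_bigr => k _; rewrite pair_bigA.
Qed.

Let sum_vector_dirs (f : (J -> R) -> R) : \sum_(v <- vector_dirs) f v =
  \sum_k f (row_dir k) + \sum_(e : 'I_n * 'I_n) f (entry_dir e).
Proof. by rewrite big_cat/= addrC; congr (_ + _); rewrite big_map big_enum. Qed.

Let pick_sum (k : 'I_m) (c : R) (u : 'I_m -> R) : \sum_l (l == k)%:R * c * u l = c * u k.
Proof.
rewrite (bigD1 k)//= eqxx mul1r big1 ?addr0// => l /negbTE ->.
by rewrite mul0r mul0r.
Qed.

Let pick_sum1 (k : 'I_m) (u : 'I_m -> R) : \sum_l (l == k)%:R * u l = u k.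
Proof.
by rewrite -[RHS]mul1r -(pick_sum k 1 u); apply: eq_bigr => l _; rewrite mulr1.
Qed.

Let pick_sqr (k : 'I_m) (c : R) : \sum_l ((l == k)%:R * c) ^+ 2 = c ^+ 2.
Proof.
rewrite (bigD1 k)//= eqxx mul1r big1 ?addr0// => l /negbTE ->.
by rewrite mul0r expr0n.
Qed.

Let zero_sum (u : 'I_m -> R) : \sum_l 0 * u l = 0.
Proof. by rewrite big1// => l _; rewrite mul0r. Qed.

Let zero_sqr : \sum_(l < m) (0 : R) ^+ 2 = 0.
Proof. by rewrite big1// => l _; rewrite expr0n. Qed.

Let level1_matrix h q w :
  level1 h (matrix_dir q) w = x h q.1.2 q.2 * unit_coord h q.1.1 w.
Proof. by rewrite /level1 /matrix_dir/= pick_sum addr0. Qed.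

Let level1_scalar h w : level1 h scalar_dir w = 1.
Proof. by rewrite /level1 /scalar_dir/= zero_sum add0r. Qed.

Let level1_row h k w : level1 h (row_dir k) w = unit_coord h k w.
Proof.
by rewrite /level1 /row_dir/= addr0 pick_sum1.
Qed.

Let level1_entry h e w : level1 h (entry_dir e) w = - x h e.1 e.2.
Proof. by rewrite /level1 /entry_dir/= zero_sum add0r. Qed.

Let level2_matrix h q w : level2 h (matrix_dir q) w = x h q.1.2 q.2 ^+ 2 *
  ((smooth_norm h w)^-1 * (1 - unit_coord h q.1.1 w ^+ 2)).
Proof. by rewrite /level2 /matrix_dir/= pick_sqr pick_sum; ring. Qed.

Let level2_scalar h w : level2 h scalar_dir w = 0.
Proof. by rewrite /level2 /scalar_dir/= zero_sqr zero_sum; ring. Qed.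

Let level2_row h k w : level2 h (row_dir k) w =
  (smooth_norm h w)^-1 * (1 - unit_coord h k w ^+ 2).
Proof.
rewrite /level2 /row_dir/=.
have -> : \sum_l (l == k)%:R ^+ 2 = 1 :> R.
  by rewrite -[RHS](expr1n _ 2) -(pick_sqr k); apply: eq_bigr => l _; rewrite mulr1.
by rewrite pick_sum1; ring.
Qed.

Let level2_entry h e w : level2 h (entry_dir e) w = 0.
Proof. by rewrite /level2 /entry_dir/= zero_sqr zero_sum; ring. Qed.

Let x1' h : \sum_(e : 'I_n * 'I_n) x h e.1 e.2 ^+ 2 = 1.
Proof. by rewrite -(x1 h) pair_bigA. Qed.

(** Because each [x h] is a unit vector, the two processes have the same covariance at any single
    index [h]. Second-derivative terms involving one index therefore agree, and the families can
    differ only in products over two indices. *)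
Let sum_level2 h w : \sum_(v <- matrix_dirs) level2 h v w = \sum_(v <- vector_dirs) level2 h v w.
Proof.
rewrite sum_matrix_dirs sum_vector_dirs level2_scalar add0r.
rewrite [X in _ = _ + X]big1 ?addr0; last by move=> e _; exact: level2_entry.
apply: eq_bigr => k _; rewrite level2_row.
under eq_bigr do rewrite level2_matrix/=.
by rewrite -mulr_suml x1' mul1r.
Qed.

Let sum_level1_sqr h w : \sum_(v <- matrix_dirs) level1 h v w * level1 h v w =
  \sum_(v <- vector_dirs) level1 h v w * level1 h v w.
Proof.
rewrite sum_matrix_dirs sum_vector_dirs level1_scalar mulr1 addrC; congr (_ + _).
  apply: eq_bigr => k _; rewrite level1_row.
  under eq_bigr do rewrite level1_matrix/= -expr2 exprMn.
  by rewrite -mulr_suml x1' mul1r.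
by rewrite -(x1' h); apply: eq_bigr => e _; rewrite level1_entry mulrNN.
Qed.

Let sum_hits2 c w : \sum_(v <- matrix_dirs) hits2 c v w = \sum_(v <- vector_dirs) hits2 c v w.
Proof.
rewrite /hits2 exchange_big/= [RHS]exchange_big/=; apply: eq_bigr => h _.
by rewrite !big_split/= -!mulr_sumr sum_level2 sum_level1_sqr.
Qed.

(** An instance of [gordon_quadratic]. The coefficients are values of [step1], nonpositive because
    the step decreases, and the normalised vectors have norm at most 1. *)
Let sum_hits1_sqr c w : \sum_(v <- vector_dirs) hits1 c v w * hits1 c v w <=
  \sum_(v <- matrix_dirs) hits1 c v w * hits1 c v w.
Proof.
rewrite sum_matrix_dirs sum_vector_dirs.
have := @gordon_quadratic R 'I_p 'I_m ('I_n * 'I_n)%type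
  (fun h => step1 (level c h w)) (fun h k => unit_coord h k w) (fun h e => x h e.1 e.2).
move=> gq; apply: (le_trans _ (le_trans (gq _ _ _) _)) => {gq}.
- rewrite le_eqVlt; apply/orP; left; apply/eqP.
  congr (_ + _); apply: eq_bigr => i _; rewrite -expr2.
    by congr (_ ^+ 2); apply: eq_bigr => h _; rewrite level1_row.
  rewrite /hits1 -[RHS]sqrrN -sumrN; congr (_ ^+ 2); apply: eq_bigr => h _.
  by rewrite level1_entry mulrN.
- by move=> h; have /andP[] := step1_bounds (level c h w).
- move=> h; under eq_bigr do rewrite /unit_coord exprMn exprVn sqr_smooth_norm.
  rewrite -mulr_suml; set S := \sum_k _.
  have S0 : 0 <= S by apply: sumr_ge0 => k _; exact: sqr_ge0.
  by rewrite ler_pdivrMr ?ltr_pwDl// mul1r lerDr.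
- by move=> h; rewrite x1'.
- rewrite addrC le_eqVlt; apply/orP; left; apply/eqP; congr (_ + _).
    rewrite -expr2; congr (_ ^+ 2); apply: eq_bigr => h _.
    by rewrite level1_scalar mulr1.
  apply: eq_bigr => k _; apply: eq_bigr => e _; rewrite -expr2; congr (_ ^+ 2).
  by apply: eq_bigr => h _; rewrite level1_matrix.
Qed.

(** Summed over directions, the part of [gordon2] linear in [hits2] is the same for both families.
    The squares of [hits1] are larger along [matrix_dirs] and enter with the nonpositive factor
    $-2(1+\mathrm{hits})^{-3}$. *)
Theorem gordon_comparison c w0 :
  gauss_ops matrix_dirs (gordon c) w0 <= gauss_ops vector_dirs (gordon c) w0.
Proof.
have sg := @smooth_gordon R m p c.
apply: (gauss_ops_comparison (@bcm_gordon R m p c) (@bcm_gordon2 R m p c) (smooth_taylor sg)).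
  by move=> u v; exact: smooth_lip2 sg v u.
move=> w; rewrite /gordon2 !big_split/= -!mulr_sumr sum_hits2 lerD2l.
rewrite !mulNr lerN2; apply: ler_wpM2l; last exact: sum_hits1_sqr.
by rewrite mulr_ge0// exprn_ge0// invr_ge0 addr_ge0// hits_ge0.
Qed.

End gordon_comparison.

(** * Lower tail of the norm of a Gaussian vector *)

Lemma ln_le_quadratic (R : realType) (r : R) : 0 < r -> r <= 1 ->
  ln r <= - (1 - r) - (1 - r) ^+ 2 / 2.
Proof.
move=> r0; rewrite le_eqVlt => /predU1P[->|r1].
  by rewrite ln1 subrr expr0n /=; lra.
(* Its derivative is $(1-x)^2/x\ge 0$, and the claim is $f(r)\le f(1)$. *)
pose f (x : R) := ln x + (x ^+ 2 / 2 - 2 * x).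
have df (x : R) : 0 < x -> is_derive x 1 f (x^-1 + (x - 2)).
  move=> x0; have h1 := is_derive1_ln x0.
  by apply: is_derive_eq; rewrite /GRing.scale/=; congr (_ + _); field.
have [||c] := @MVT R f (fun x => x^-1 + (x - 2)) r 1 r1.
- by move=> x; rewrite in_itv/= => /andP[rx _]; apply: df; exact: lt_trans rx.
- apply: derivable_within_continuous => x; rewrite in_itv/= => /andP[rx _].
  by have [] := df x (lt_le_trans r0 rx).
rewrite in_itv/= => /andP[rc c1]; have c0 : 0 < c by exact: lt_trans rc.
rewrite /f ln1 add0r (_ : c^-1 + (c - 2) = (1 - c) ^+ 2 / c); last by field; rewrite gt_eqF.
have : 0 <= (1 - c) ^+ 2 / c * (1 - r).
  by rewrite mulr_ge0 ?subr_ge0 ?(ltW r1)// divr_ge0 ?sqr_ge0// ltW.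
by move=> h1 h2; move: h1; rewrite -h2; lra.
Qed.

(** Turns a pointwise product bound into a bound on the iterated integral, one variable at a time.
    The induction generalises [c1], which absorbs the factor of the variable just fixed. *)
Lemma gauss_ops_prod_le (R : realType) (J : Type) (I : eqType) (L : seq I)
    (v : I -> J -> R) (f : I -> R -> R) (K : I -> R) (F : (J -> R) -> R) (c0 c1 : R) w :
  bounded_coord_measurable F -> (forall w, 0 <= F w) -> 0 <= c0 -> 0 <= c1 ->
  (forall i, measurable_fun [set: R] (f i)) -> (forall i s, 0 <= f i s) ->
  (forall i, (\int[normal_prob 0 1]_s (f i s)%:E <= (K i)%:E)%E) ->
  uniq L ->
  (forall s : I -> R, F (w + \sum_(i <- L) s i *: v i) <= c0 + c1 * \prod_(i <- L) f i (s i)) ->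
  gauss_ops (map v L) F w <= c0 + c1 * \prod_(i <- L) K i.
Proof.
move=> bF F0 c00 + mf f0 fK; elim: L c1 w => [|i L IH] c1 w c10 /= uL FH.
  by have := FH (fun=> 0); rewrite !big_nil addr0.
have /andP[iL uL'] := uL.
have K0 j : 0 <= K j.
  by rewrite -lee_fin (le_trans _ (fK j))// integral_ge0// => s _; rewrite lee_fin.
have PK0 : 0 <= \prod_(j <- L) K j by apply: prodr_ge0.
have step s : gauss_ops (map v L) F (w + s *: v i) <=
    c0 + c1 * (\prod_(j <- L) K j) * f i s.
  rewrite mulrAC; apply: IH => //; first by rewrite mulr_ge0.
  move=> t; pose t' j := if j == i then s else t j.
  have := FH t'; rewrite !big_cons /t' eqxx mulrA addrA.
  have e (T : Type) (g : I -> R -> T) : forall j, j \in L -> g j (if j == i then s else t j) = g j (t j).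
    by move=> j jL; case: eqP => // ji; move: iL; rewrite -ji jL.
  rewrite (eq_big_seq _ (e _ (fun j x => x *: v j))).
  by rewrite (eq_big_seq _ (e _ f)).
rewrite -lee_fin gauss_opE; last exact: gauss_ops_bcm.
have c10' : 0 <= c1 * \prod_(j <- L) K j by rewrite mulr_ge0.
have Fs0 w' : 0 <= gauss_ops (map v L) F w'.
  rewrite -[leLHS](gauss_ops_cst (map v L) 0 w'); apply: gauss_ops_le => //.
  exact: bcm_cst.
have mfi : measurable_fun [set: R] (fun s => (f i s)%:E) by exact/measurable_EFinP.
apply: (@le_trans _ _ (\int[normal_prob 0 1]_s (c0%:E + (c1 * \prod_(j <- L) K j)%:E * (f i s)%:E))%E).
  apply: ge0_le_integral => //.
  - by move=> s _; rewrite lee_fin.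
  - apply/measurable_EFinP; apply: bcm_line.
    by have [] := gauss_ops_bcm (map v L) bF.
  - by apply: emeasurable_funD => //; exact: emeasurable_funM.
  - by move=> s _; rewrite -EFinM -EFinD lee_fin.
have g1 : normal_prob (0 : R) 1 setT = 1%E := @probability_setT _ _ R (normal_prob 0 1).
rewrite ge0_integralD//; last 2 first.
- by move=> s _; rewrite mule_ge0// lee_fin.
- exact: emeasurable_funM.
rewrite integral_cst//= [X in (_ * X + _)%E]g1 mule1 EFinD leeD2l//.
rewrite ge0_integralZl//; last by move=> s _; rewrite lee_fin.
by rewrite big_cons (mulrC (K i)) mulrA [X in (_ <= X)%E]EFinM lee_wpmul2l// lee_fin.
Qed.

Section chi_lower_tail.
Variables (R : realType) (m p : nat).
Local Notation J := (option 'I_m * 'I_p)%type.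

Let row_sum (w : J -> R) (s : 'I_m -> R) (j : J) :
  (w + \sum_(k <- enum 'I_m) s k *: @row_dir R m p k) j =
  w j + (if j.1 is Some k then s k else 0).
Proof.
rewrite [LHS]/(_ + _)/=; congr (_ + _).
rewrite fct_sumE big_enum/= (eq_bigr (fun k => s k * @row_dir R m p k j))//.
case: j => -[k|] h; rewrite /row_dir/=; last by rewrite big1// => l _; rewrite mulr0.
rewrite (bigD1 k)//= eqxx mulr1 big1 ?addr0//.
by move=> l /negbTE; rewrite eq_sym => ->; rewrite mulr0.
Qed.

Let gordon_eq0 (c : R) (w : J -> R) : (forall h, 3 <= level c h w) -> gordon c w = 0.
Proof.
move=> l3; rewrite /gordon /hits big1; first by rewrite addr0 invr1 subrr.
by move=> h _; exact: step_ge3.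
Qed.

(** [gordon] vanishes unless $1+|g|_2^2<\rho^2$, so this is a Chernoff bound. For $0<\rho<\sqrt m$
    it gives $e^{-(\sqrt m-\rho)^2}$, which $(\sqrt m-\rho-l/2)^2\ge 0$ makes linear in $\rho$; in
    that form it can be integrated when $\rho$ is itself random. *)
Lemma chi_lower_tail (c rho l : R) (w : J -> R) :
  0 <= l -> (forall k h, w (Some k, h) = 0) ->
  (forall h, 3 + c - w (None, h) <= rho) ->
  gauss_ops (map (@row_dir R m p) (enum 'I_m)) (gordon c) w <=
  expR (l * rho - l * Num.sqrt m%:R + l ^+ 2 / 4).
Proof.
move=> l0 w0 wrho.
have bg := @bcm_gordon R m p c.
have g0 (u : J -> R) : 0 <= gordon c u by have /andP[] := gordon_bounds c u.
have levelE s h : level c h (w + \sum_(k <- enum 'I_m) s k *: @row_dir R m p k) =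
    Num.sqrt (1 + \sum_k s k ^+ 2) + w (None, h) - c.
  rewrite /level /smooth_norm row_sum addr0; congr (Num.sqrt (1 + _) + _ - _).
  by apply: eq_bigr => k _; rewrite row_sum w0 add0r.
have [rho0|rho0] := leP rho 0.
  have -> : gauss_ops (map (@row_dir R m p) (enum 'I_m)) (gordon c) w = 0; last exact: expR_ge0.
  apply/eqP; rewrite eq_le; apply/andP; split; last first.
    rewrite -[leLHS](gauss_ops_cst (map (@row_dir R m p) (enum 'I_m)) 0 w).
    by apply: gauss_ops_le => //; exact: bcm_cst.
  have := @gauss_ops_prod_le R J 'I_m (enum 'I_m) (@row_dir R m p) (fun _ _ => 1) (fun=> 1)
    (gordon c) 0 0 w bg g0 (lexx _) (lexx _).
  rewrite mul0r addr0; apply => //.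
  - move=> _; rewrite integral_cst//= mul1e.
    by rewrite (@probability_setT _ _ R (normal_prob 0 1)).
  - exact: enum_uniq.
  - move=> s; rewrite gordon_eq0// => h; rewrite levelE.
    by have := wrho h; have := sqrtr_ge0 (1 + \sum_k s k ^+ 2); lra.
have [rm|rm] := leP (Num.sqrt m%:R) rho.
  apply: (@le_trans _ _ 1).
    rewrite -[leRHS](gauss_ops_cst (map (@row_dir R m p) (enum 'I_m)) 1 w).
    apply: gauss_ops_le => //; first exact: bcm_cst.
    by move=> u; have /andP[] := gordon_bounds c u.
  rewrite -[X in X <= _]expR0 ler_expR addr_ge0 ?divr_ge0 ?sqr_ge0// -mulrBr mulr_ge0// subr_ge0//.
have m0 : 0 < m%:R :> R by rewrite -sqrtr_gt0 (lt_trans rho0).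
set M := Num.sqrt m%:R in rm *.
have M0 : 0 < M by rewrite sqrtr_gt0.
have MM : M ^+ 2 = m%:R by rewrite sqr_sqrtr// ltW.
(* The optimal Chernoff parameter: it makes $1+2\mu=m/\rho^2$. *)
pose mu := (M ^+ 2 / rho ^+ 2 - 1) / 2.
have mu0 : 0 <= mu.
  rewrite divr_ge0// subr_ge0 ler_pdivlMr ?exprn_gt0// mul1r.
  by rewrite lerXn2r ?nnegrE// ltW.
have mu1 : 1 + 2 * mu = (M / rho) ^+ 2 by rewrite /mu expr_div_n; field; rewrite gt_eqF.
have := @gauss_ops_prod_le R J 'I_m (enum 'I_m) (@row_dir R m p)
  (fun _ s => expR (- mu * s ^+ 2)) (fun=> (Num.sqrt (1 + 2 * mu))^-1)
  (gordon c) 0 (expR (mu * rho ^+ 2)) w bg g0 (lexx _) (expR_ge0 _).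
rewrite add0r big_const_seq count_predT size_enum_ord iter_mulr_1 => h.
apply: (le_trans (h _ _ _ _ _)) => {h} //.
- by move=> _; apply: measurableT_comp => //; apply: measurable_funM => //; exact: measurable_funX.
- by move=> _; exact: gauss_expR_sqr.
- exact: enum_uniq.
- move=> s; rewrite add0r.
  have eS : \sum_(k <- enum 'I_m) s k ^+ 2 = \sum_k s k ^+ 2 by rewrite big_enum.
  rewrite -(big_morph _ (@expRD R) (@expR0 R)) -expRD -mulr_sumr mulNr -mulrBr eS.
  set S := \sum_k s k ^+ 2.
  have S0 : 0 <= S by apply: sumr_ge0 => k _; exact: sqr_ge0.
  have [Sr|Sr] := leP S (rho ^+ 2).
    apply: (@le_trans _ _ 1); first by have /andP[] := gordon_bounds c (w + \sum_(k <- enum 'I_m) s k *: @row_dir R m p k).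
    by rewrite -[X in X <= _]expR0 ler_expR mulr_ge0// subr_ge0.
  rewrite gordon_eq0 ?expR_ge0// => h; rewrite levelE -/S.
  have : rho <= Num.sqrt (1 + S).
    rewrite -(ler_pXn2r (n := 2))// ?nnegrE ?sqrtr_ge0 ?(ltW rho0)// sqr_sqrtr ?addr_ge0//.
    by move: Sr; set a := rho ^+ 2; lra.
  by have := wrho h; lra.
have r0 : 0 < rho / M by rewrite divr_gt0.
rewrite mu1 sqrtr_sqr gtr0_norm ?divr_gt0// invf_div.
rewrite -[rho / M]lnK ?posrE// -expRM_natl -expRD ler_expR.
have := ln_le_quadratic r0; rewrite ler_pdivrMr// mul1r => /(_ (ltW rm)).
rewrite -MM /mu; set L := ln _ => hL.
have hL2 : M ^+ 2 * L <= M ^+ 2 * (- (1 - rho / M) - (1 - rho / M) ^+ 2 / 2).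
  by rewrite ler_wpM2l// sqr_ge0.
have e1 : M ^+ 2 * (- (1 - rho / M) - (1 - rho / M) ^+ 2 / 2) =
   - M ^+ 2 + M * rho - (M - rho) ^+ 2 / 2 by field; rewrite gt_eqF.
have e2 : (M ^+ 2 / rho ^+ 2 - 1) / 2 * rho ^+ 2 = (M ^+ 2 - rho ^+ 2) / 2 by field; rewrite gt_eqF.
rewrite e1 in hL2; rewrite e2.
have := sqr_ge0 (M - rho - l / 2).
nra.
Qed.

End chi_lower_tail.

Lemma cauchy_schwarz_sum (R : rcfType) (I : finType) (x y : I -> R) :
  \sum_i x i * y i <= Num.sqrt (\sum_i x i ^+ 2) * Num.sqrt (\sum_i y i ^+ 2).
Proof.
have sx0 : 0 <= \sum_i x i ^+ 2 by apply: sumr_ge0 => i _; exact: sqr_ge0.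
have sy0 : 0 <= \sum_i y i ^+ 2 by apply: sumr_ge0 => i _; exact: sqr_ge0.
have degenerate (u v : I -> R) : \sum_i u i ^+ 2 = 0 -> \sum_i u i * v i = 0.
  move=> /eqP; rewrite psumr_eq0; last by move=> i _; exact: sqr_ge0.
  move=> /allP u0; rewrite big1// => i _.
  have := u0 i (mem_index_enum i); rewrite /= sqrf_eq0 => /eqP ->.
  by rewrite mul0r.
have [x0|x0] := eqVneq (\sum_i x i ^+ 2) 0.
  by rewrite degenerate// mulr_ge0 ?sqrtr_ge0.
have [y0|y0] := eqVneq (\sum_i y i ^+ 2) 0.
  under eq_bigr do rewrite mulrC.
  by rewrite degenerate// mulr_ge0 ?sqrtr_ge0.
set a := Num.sqrt (\sum_i x i ^+ 2); set b := Num.sqrt (\sum_i y i ^+ 2).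
have a0 : 0 < a by rewrite sqrtr_gt0 lt_def x0.
have b0 : 0 < b by rewrite sqrtr_gt0 lt_def y0.
have normed (u : I -> R) c : 0 < c -> c = Num.sqrt (\sum_i u i ^+ 2) ->
    \sum_i (u i / c) ^+ 2 <= 1.
  move=> c0 cE; under eq_bigr do rewrite expr_div_n.
  rewrite -mulr_suml ler_pdivrMr ?exprn_gt0// mul1r cE sqr_sqrtr//.
  by apply: sumr_ge0 => i _; exact: sqr_ge0.
have := dot_le1 (normed x a a0 erefl) (normed y b b0 erefl).
under eq_bigr do rewrite mulrACA -invfM.
by rewrite -mulr_suml ler_pdivrMr ?mulr_gt0// mul1r.
Qed.

Lemma sqrt_sum_sqrD (R : rcfType) (I : finType) (x y : I -> R) :
  Num.sqrt (\sum_i (x i + y i) ^+ 2) <=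
  Num.sqrt (\sum_i x i ^+ 2) + Num.sqrt (\sum_i y i ^+ 2).
Proof.
have s0 (u : I -> R) : 0 <= \sum_i u i ^+ 2 by apply: sumr_ge0 => i _; exact: sqr_ge0.
rewrite -(ler_pXn2r (n := 2))// ?nnegrE ?addr_ge0 ?sqrtr_ge0//.
rewrite sqrrD !sqr_sqrtr//.
have -> : \sum_i (x i + y i) ^+ 2 = \sum_i x i ^+ 2 + \sum_i x i * y i *+ 2 + \sum_i y i ^+ 2.
  by rewrite -!big_split/=; apply: eq_bigr => i _; rewrite sqrrD.
by rewrite lerD2r lerD2l sumrMnl ler_wMn2r// cauchy_schwarz_sum.
Qed.

(** * Gaussian width of the descent cone *)

Section cone_width.
Variables (R : realType) (n : nat) (X : 'M[R]_n) (tau : R).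
Hypothesis tau0 : 0 <= tau.
Local Notation E := ('I_n * 'I_n)%type.
Implicit Types (h : 'M[R]_n) (e : E) (g : E -> R).

(* The directional derivative at [X] of the entrywise l1 norm. *)
Definition l1_slope h : R :=
  \sum_(e : E) if X e.1 e.2 != 0 then Num.sg (X e.1 e.2) * h e.1 e.2 else `|h e.1 e.2|.

(** In absolute value, the distance from [s] to [tau] times the subdifferential of $|\cdot|$ at the
    entry [e] of [X]. *)
Definition shrink e (s : R) : R :=
  if X e.1 e.2 != 0 then s - tau * Num.sg (X e.1 e.2) else Num.max 0 (`|s| - tau).

(* Subtracting [tau] times a subgradient of the l1 norm only increases the
   pairing with a descent direction. *)
Lemma cone_width h g : l1_slope h <= 0 -> \sum_(e : E) h e.1 e.2 ^+ 2 = 1 ->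
  \sum_(e : E) g e * h e.1 e.2 <= Num.sqrt (\sum_(e : E) shrink e (g e) ^+ 2).
Proof.
move=> slope h1.
have key : \sum_(e : E) g e * h e.1 e.2 <= tau * l1_slope h +
    \sum_(e : E) `|shrink e (g e)| * `|h e.1 e.2|.
  rewrite /l1_slope mulr_sumr -big_split/=; apply: ler_sum => e _; rewrite /shrink.
  case: ifPn => _.
    have := ler_norm ((g e - tau * Num.sg (X e.1 e.2)) * h e.1 e.2).
    by rewrite normrM; lra.
  have h2 : g e * h e.1 e.2 <= `|g e| * `|h e.1 e.2| by rewrite -normrM ler_norm.
  have h3 : `|g e| - tau <= `|Num.max 0 (`|g e| - tau)|.
    by apply: le_trans (ler_norm _); rewrite le_max lexx orbT.
  have := ler_wpM2r (normr_ge0 (h e.1 e.2)) h3.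
  by move: h2; lra.
apply: (le_trans key).
apply: (@le_trans _ _ (0 + Num.sqrt (\sum_(e : E) shrink e (g e) ^+ 2) * 1)); last by rewrite add0r mulr1.
apply: lerD; first by rewrite mulr_ge0_le0.
apply: (le_trans (cauchy_schwarz_sum _ _)).
rewrite (eq_bigr (fun e => shrink e (g e) ^+ 2)); last by move=> e _; rewrite real_normK ?num_real.
have -> : \sum_(e : E) `|h e.1 e.2| ^+ 2 = 1.
  by rewrite -h1; apply: eq_bigr => e _; rewrite real_normK ?num_real.
by rewrite sqrtr1.
Qed.

Definition shrink_mgf e : R := if X e.1 e.2 != 0 then Num.sqrt 3 * expR (tau ^+ 2)
  else 1 + 2 * (Num.sqrt 3 * expR (- (tau ^+ 2 / 2))).

Lemma shrink_mgfP e :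
  (\int[normal_prob 0 1]_s (expR (shrink e s ^+ 2 / 3))%:E <= (shrink_mgf e)%:E)%E.
Proof.
rewrite /shrink /shrink_mgf; case: ifPn => [X0|_]; last exact: gauss_expR_trunc.
have -> : tau ^+ 2 = (tau * Num.sg (X e.1 e.2)) ^+ 2.
  by rewrite exprMn sqr_sg X0 mulr1.
exact: gauss_expR_shift.
Qed.

Lemma measurable_shrink e : measurable_fun [set: R] (shrink e).
Proof.
rewrite /shrink; case: (X e.1 e.2 != 0); first exact: measurable_funB.
apply: measurable_maxr => //; apply: measurable_funB => //; exact: measurable_normr_id.
Qed.

Variables (m p : nat) (x : 'I_p -> 'M[R]_n).
Local Notation J := (option 'I_m * 'I_p)%type.
Hypothesis slope_x : forall h : 'I_p, l1_slope (x h) <= 0.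
Hypothesis x1 : forall h : 'I_p, \sum_(e : E) x h e.1 e.2 ^+ 2 = 1.

(** Integrating the row variables first leaves $e^{lS}$ up to constants, with $S$ the distance from
    the entry variables to the dilated subdifferential. One copy of the bound accounts for $S\le B$,
    the other for $S>B$, where the exponential moment of $S^2/3$ is at most $e^{B^2/3}$. *)
Lemma vector_dirs_le (c B l : R) : 0 <= l -> 0 <= B ->
  \prod_(e <- enum {: E}) shrink_mgf e <= expR (B ^+ 2 / 3) ->
  gauss_ops (vector_dirs m x) (gordon c) 0 <=
  2 * expR (l ^+ 2 + l * (3 + c + B - Num.sqrt m%:R)).
Proof.
move=> l0 B0 prodB; rewrite /vector_dirs gauss_ops_cat.
set F := gauss_ops _ (gordon c).
have bg := @bcm_gordon R m p c.
have bF : bounded_coord_measurable F by exact: gauss_ops_bcm.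
have F0 u : 0 <= F u.
  rewrite -[leLHS](gauss_ops_cst (map (@row_dir R m p) (enum 'I_m)) 0 u).
  apply: gauss_ops_le => //; first exact: bcm_cst.
  by move=> w; have /andP[] := gordon_bounds c w.
set D := expR _.
have D0 : 0 <= D by exact: expR_ge0.
have c10 : 0 <= D * expR (- (B ^+ 2 / 3)) by rewrite mulr_ge0// expR_ge0.
have := @gauss_ops_prod_le R J E (enum {: E}) (entry_dir (m := m) x)
  (fun e s => expR (shrink e s ^+ 2 / 3)) shrink_mgf F D (D * expR (- (B ^+ 2 / 3))) 0
  bF F0 D0 c10.
move=> h; apply: (le_trans (h _ _ _ _ _)) => {h}.
- move=> e; apply: measurableT_comp => //; apply: measurable_funM => //.
  by apply: measurable_funX; exact: measurable_shrink.
- by move=> e s; exact: expR_ge0.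
- exact: shrink_mgfP.
- exact: enum_uniq.
- move=> s; rewrite add0r; set w := \sum_(e <- _) _.
  pose S := Num.sqrt (\sum_(e : E) shrink e (s e) ^+ 2).
  have wE j : w j = if j.1 is Some k then 0 else - \sum_(e : E) s e * x j.2 e.1 e.2.
    rewrite /w fct_sumE big_enum/=.
    rewrite (eq_bigr (fun e => s e * @entry_dir R m n p x e j))//.
    case: j => -[k|] h; rewrite /entry_dir/=; first by rewrite big1// => e _; rewrite mulr0.
    by rewrite -sumrN; apply: eq_bigr => e _; rewrite mulrN.
  apply: (le_trans (chi_lower_tail (rho := 3 + c + S) l0 _ _)).
  + by move=> k h; rewrite wE.
  + by move=> h; rewrite wE/= opprK lerD2l; exact: cone_width.
  rewrite -(big_morph _ (@expRD R) (@expR0 R)) -mulrA -expRD -mulr_suml big_enum/=.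
  have S2 : \sum_(e : E) shrink e (s e) ^+ 2 = S ^+ 2.
    by rewrite sqr_sqrtr//; apply: sumr_ge0 => e _; exact: sqr_ge0.
  rewrite S2; have S0 : 0 <= S by exact: sqrtr_ge0.
  have [SB|BS] := leP S B.
    apply: (@le_trans _ _ D); last by rewrite lerDl mulr_ge0// expR_ge0.
    rewrite ler_expR; have : l * S <= l * B by rewrite ler_wpM2l.
    by have := sqr_ge0 l; lra.
  apply: (@le_trans _ _ (D * expR (- (B ^+ 2 / 3) + S ^+ 2 / 3))); last by rewrite lerDr.
  rewrite -expRD ler_expR.
  (* Gives $l(S-B)\le 3l^2/4+(S-B)^2/3$. Together with the $l^2/4$ of the chi tail this makes up the
     $l^2$ in the bound. *)
  have h1 := sqr_ge0 (3 * l / 2 - (S - B)).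
  have h2 : 0 <= B * (S - B) by rewrite mulr_ge0// subr_ge0 ltW.
  by nra.
rewrite (_ : 2 * D = D + D); last by ring.
rewrite lerD2l -mulrA -[leRHS]mulr1 ler_wpM2l// mulrC expRN ler_pdivrMr ?expR_gt0//.
by rewrite mul1r.
Qed.

End cone_width.

(** * The matrix process on the event of a small image *)

Section matrix_dirs_lower_bound.
Variables (R : realType) (d : measure_display) (T : measurableType d).
Variables (P : probability T R) (m n p : nat).
Variables (G : 'I_m * 'I_n * 'I_n -> {RV P >-> R}) (x : 'I_p -> 'M[R]_n).
Local Notation J := (option 'I_m * 'I_p)%type.
Hypothesis iidG : iid_standard_normal G.

Definition image_norm (h : 'M[R]_n) (w : T) : R :=
  Num.sqrt (\sum_k (\sum_(e : 'I_n * 'I_n) G (k, e.1, e.2) w * h e.1 e.2) ^+ 2).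

Lemma measurable_image_norm h : measurable_fun [set: T] (image_norm h).
Proof.
apply: (measurableT_comp (f := fun x : R => Num.sqrt x)).
  by apply: nondecreasing_measurable => // a b ab; exact: ler_wsqrtr.
apply: measurable_sum => k; apply: measurable_funX; apply: measurable_sum => e.
by apply: measurable_funM.
Qed.

Lemma measurable_image_norm_le h r : measurable [set w | image_norm h w <= r].
Proof.
rewrite (_ : [set w | _] = image_norm h @^-1` `]-oo, r]).
  by rewrite -[_ @^-1` _]setTI; exact: measurable_image_norm.
by apply/seteqP; split => w /=; rewrite in_itv.
Qed.

Definition small_image (r : R) : set T := [set w | exists h, image_norm (x h) w <= r].

Lemma measurable_small_image r : measurable (small_image r).
Proof.
rewrite (_ : small_image r = \bigcup_(h in [set: 'I_p]) [set w | image_norm (x h) w <= r]).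
  by apply: fin_bigcup_measurable => // h _; exact: measurable_image_norm_le.
by apply/seteqP; split => w /=; [move=> [h hr]; exists h|move=> [h _ hr]; exists h].
Qed.

(** If some image has norm at most $r$ and the common scalar is at most $-l$, that level is at most
    0, as $\sqrt{1+a^2}\le 1+a$. Then one index counts fully and [gordon] is at least 1/2; the
    scalar event contributes the remaining 1/4 and the exponential. *)
Lemma matrix_dirs_ge (r l : R) : 0 <= l ->
  fine (P (small_image r)) * expR (- ((l + 1) ^+ 2 / 2)) / 8 <=
  gauss_ops (matrix_dirs m x) (gordon (1 + r - l)) 0.
Proof.
move=> l0; set c := 1 + r - l.
have bg := @bcm_gordon R m p c.
have g0 (u : J -> R) : 0 <= gordon c u by have /andP[] := gordon_bounds c u.
have mb := measurable_small_image r.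
rewrite /matrix_dirs/=; set F := gauss_ops _ (gordon c).
have bF : bounded_coord_measurable F by exact: gauss_ops_bcm.
have F0 u : 0 <= F u.
  rewrite -[leLHS](gauss_ops_cst (map (matrix_dir (m := m) x) (enum {: 'I_m * 'I_n * 'I_n})) 0 u).
  by apply: gauss_ops_le => //; exact: bcm_cst.
pose b := fine (P (small_image r)) / 2.
have b0 : 0 <= b by rewrite divr_ge0// fine_ge0.
have Fge s : s <= - l -> b <= F (0 + s *: @scalar_dir R m p).
  move=> sl; rewrite /F -(iid_expectation_gauss_ops _ _ iidG bg g0).
  have hitE w : small_image r w -> 2^-1 <=
      gordon c (0 + s *: @scalar_dir R m p + \sum_(q <- enum {: 'I_m * 'I_n * 'I_n}) G q w *: @matrix_dir R m n p x q).
    move=> [h hr]; set v := _ + _.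
    have vE j : v j = if j.1 is Some k then \sum_(e : 'I_n * 'I_n) G (k, e.1, e.2) w * x j.2 e.1 e.2 else s.
      have -> : v j = s * @scalar_dir R m p j + \sum_q G q w * @matrix_dir R m n p x q j.
        rewrite /v add0r [LHS]/(_ + _); congr (_ + _).
        by rewrite fct_sumE big_enum.
      case: j => -[k|] h'; rewrite /scalar_dir /matrix_dir/=; last first.
        by rewrite mulr1 big1 ?addr0// => q _; rewrite mulr0.
      rewrite mulr0 add0r.
      transitivity (\sum_(k' < m) \sum_(e : 'I_n * 'I_n) G (k', e.1, e.2) w * ((k == k')%:R * x h' e.1 e.2)).
        transitivity (\sum_(ki : 'I_m * 'I_n) \sum_(j < n) G (ki.1, ki.2, j) w * ((k == ki.1)%:R * x h' ki.2 j)).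
          by rewrite pair_bigA/=; apply: eq_bigr => -[[k' i] j].
        rewrite -(pair_bigA _ (fun k' i => \sum_(j < n) G (k', i, j) w * ((k == k')%:R * x h' i j))).
        by apply: eq_bigr => k' _; rewrite pair_bigA.
      rewrite (bigD1 k)//= [X in _ + X]big1 ?addr0; last first.
        by move=> k' /negbTE; rewrite eq_sym => ->; rewrite big1// => e _; rewrite mul0r mulr0.
      by apply: eq_bigr => e _; rewrite eqxx mul1r.
    have levelh : level c h v <= 0.
      rewrite /level /smooth_norm vE/=.
      have -> : \sum_k v (Some k, h) ^+ 2 = image_norm (x h) w ^+ 2.
        rewrite sqr_sqrtr; last by apply: sumr_ge0 => k _; exact: sqr_ge0.
        by apply: eq_bigr => k _; rewrite vE.
      have n0 : 0 <= image_norm (x h) w by exact: sqrtr_ge0.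
      have : Num.sqrt (1 + image_norm (x h) w ^+ 2) <= 1 + image_norm (x h) w.
        rewrite -(ler_pXn2r (n := 2))// ?nnegrE ?sqrtr_ge0 ?addr_ge0// sqr_sqrtr ?addr_ge0 ?sqr_ge0//.
        by rewrite sqrrD expr1n mul1r lerD2r lerDl mulrn_wge0.
      by rewrite /c; lra.
    have hits1 : 1 <= hits c v.
      rewrite /hits (bigD1 h)//= step_le0// lerDl sumr_ge0// => h' _.
      by have /andP[] := step_bounds (level c h' v).
    rewrite /gordon; have : (1 + hits c v)^-1 <= 2^-1.
      by rewrite lef_pV2 ?posrE//; lra.
    lra.
  have ind0 : (P.-integrable setT (fun w => (2^-1 * \1_(small_image r) w)%:E)).
    apply: measurable_bounded_integrable => //.
    - by rewrite (le_lt_trans (probability_le1 _ _)) ?ltry.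
    - by apply: measurable_funM => //; exact: measurable_indic.
    - exists 1; split => // y y1 w _; rewrite /= ger0_norm ?mulr_ge0//.
      by apply: (le_trans _ (ltW y1)); rewrite -[leRHS]mulr1 ler_pM// ?invf_le1// ?ler1n//.
  have mF : measurable_fun [set: T] (fun w => gordon c (0 + s *: @scalar_dir R m p +
      \sum_(q <- enum {: 'I_m * 'I_n * 'I_n}) G q w *: @matrix_dir R m n p x q)).
    apply: bg.1 => j.
    rewrite (_ : (fun w => _) = fun w => (0 + s *: @scalar_dir R m p) j +
      \sum_(q <- enum {: 'I_m * 'I_n * 'I_n}) G q w * @matrix_dir R m n p x q j).
      apply: measurable_funD => //; apply: measurable_sum => q.
      by apply: measurable_funM.
    by apply/funext => w; rewrite [LHS]/(_ + _)/= fct_sumE.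
  have iF : P.-integrable setT (EFin \o (fun w => gordon c (0 + s *: @scalar_dir R m p +
      \sum_(q <- enum {: 'I_m * 'I_n * 'I_n}) G q w *: @matrix_dir R m n p x q))).
    apply: measurable_bounded_integrable => //.
    - by rewrite (le_lt_trans (probability_le1 _ _)) ?ltry.
    - exists 1; split => // y y1 w _; rewrite /= ger0_norm//.
      by apply: (le_trans _ (ltW y1)); have /andP[] := gordon_bounds c
        (0 + s *: @scalar_dir R m p + \sum_(q <- enum {: 'I_m * 'I_n * 'I_n}) G q w *: @matrix_dir R m n p x q).
  apply: (@le_trans _ _ (\int[P]_w (2^-1 * \1_(small_image r) w))).
    rewrite RintegralZl//; last first.
      apply: measurable_bounded_integrable => //.
      + by rewrite (le_lt_trans (probability_le1 _ _)) ?ltry.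
      + exists 1; split => // y y1 w _; rewrite /= ger0_norm//.
        by apply: (le_trans _ (ltW y1)); rewrite indicE; case: (_ \in _).
    by rewrite /Rintegral integral_indic// setIT /b mulrC.
  apply: le_Rintegral => // w _; rewrite indicE.
  by case: (boolP (w \in _)) => [/set_mem/hitE|_]; rewrite ?mulr1 ?mulr0.
rewrite -lee_fin gauss_opE//.
apply: (@le_trans _ _ (\int[normal_prob 0 1]_(s in `]-oo, (- l)%R]) (b%:E))%E).
  rewrite integral_cst//= /b.
  rewrite (_ : _ / 8 = fine (P (small_image r)) / 2 * (4^-1 * expR (- ((l + 1) ^+ 2 / 2)))); last by field.
  by rewrite EFinM lee_wpmul2l ?lee_fin ?gauss_tail_ge.
have mFs : measurable_fun [set: R] (fun s : R => (F (0 + s *: @scalar_dir R m p))%:E).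
  by apply/measurable_EFinP; apply: bcm_line; exact: bF.1.
apply: (@le_trans _ _ (\int[normal_prob 0 1]_(s in `]-oo, (- l)%R]) (F (0 + s *: @scalar_dir R m p))%:E)%E).
  by apply: ge0_le_integral => //; exact: measurable_funTS.
apply: ge0_subset_integral => //.
by move=> s _; rewrite lee_fin.
Qed.

End matrix_dirs_lower_bound.

(** * Escape through the mesh *)

Section finite_escape.
Variables (R : realType) (n s : nat) (X : 'M[R]_n).
Hypotheses (n0 : (0 < n)%N) (s0 : (0 < s)%N) (sparseX : column_sparse s X).
Local Notation E := ('I_n * 'I_n)%type.

(** With this threshold $e^{-\tau^2/2}=1/n$: the entries off the support, possibly $n^2$ of them,
    contribute at most a factor $e^{4n}$, while an entry of the support costs $\sqrt3n^2$. *)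
Let tau : R := Num.sqrt (2 * ln n%:R).

Let ln_ge0n : 0 <= ln n%:R :> R.
Proof. by rewrite ln_ge0// ler1n. Qed.

Let tau2 : tau ^+ 2 = 2 * ln n%:R.
Proof. by rewrite sqr_sqrtr// mulr_ge0. Qed.

Lemma support_le : \sum_(e : E) (X e.1 e.2 != 0)%:R <= (n * s)%:R :> R.
Proof.
rewrite -(pair_bigA _ (fun i j => (X i j != 0)%:R))/= exchange_big/=.
rewrite (eq_bigr (fun j => (#|[set i : 'I_n | X i j != 0%R]%SET|)%:R)).
  rewrite -natr_sum ler_nat -[leqRHS]mulnC -[X in (_ <= _ * X)%N](card_ord n) mulnC.
  by rewrite -sum_nat_const; apply: leq_sum => j _; exact: sparseX.
move=> j _; rewrite -sum1dep_card natr_sum [RHS]big_mkcond/=.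
by apply: eq_bigr => i _; case: ifP.
Qed.

Lemma shrink_mgf_le e : shrink_mgf X tau e <=
  expR (4 / n%:R + (1 + 2 * ln n%:R) * (X e.1 e.2 != 0)%:R).
Proof.
have nR : 0 < n%:R :> R by rewrite ltr0n.
have s3 : Num.sqrt 3 <= 2 :> R.
  by rewrite -(ler_pXn2r (n := 2))// ?nnegrE ?sqrtr_ge0// sqr_sqrtr//; lra.
rewrite /shrink_mgf tau2; case: ifPn => [_|_] /=.
  rewrite mulr1 addrA expRD ler_pM2r ?expR_gt0//.
  apply: (le_trans s3); apply: le_trans (expR_ge1Dx _).
  by have q0 : 0 <= 4 / n%:R :> R by [rewrite divr_ge0]; lra.
rewrite mulr0 addr0; apply: le_trans (expR_ge1Dx _).
rewrite [2 * ln _]mulrC mulfK// expRN lnK ?posrE// lerD2l mulrA ler_wpM2r ?invr_ge0 ?ler0n//.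
by lra.
Qed.

(** The $n^2$ exponents $4/n$ add up to $4n\le 4ns$, and each of the at most $ns$ support entries
    adds $1+2\ln n$. *)
Lemma prod_shrink_mgf_le : \prod_(e <- enum {: E}) shrink_mgf X tau e <=
  expR ((n * s)%:R * (5 + 2 * ln n%:R)).
Proof.
have nR : 0 < n%:R :> R by rewrite ltr0n.
rewrite big_enum/=.
apply: (@le_trans _ _ (\prod_(e : E) expR (4 / n%:R + (1 + 2 * ln n%:R) * (X e.1 e.2 != 0)%:R))).
  apply: ler_prod => e _; rewrite shrink_mgf_le andbT /shrink_mgf.
  by case: ifP => _; rewrite ?addr_ge0 ?mulr_ge0 ?expR_ge0 ?sqrtr_ge0//.
rewrite -(big_morph _ (@expRD R) (@expR0 R)) ler_expR big_split/= sumr_const card_prod !card_ord.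
rewrite -mulr_sumr.
have h1 : (4 / n%:R) *+ (n * n) = 4 * n%:R :> R.
  by rewrite -mulr_natr natrM; field; exact: lt0r_neq0.
have h2 : n%:R <= (n * s)%:R :> R by rewrite ler_nat leq_pmulr.
have h3 : 0 <= 1 + 2 * ln n%:R :> R by rewrite addr_ge0// mulr_ge0.
have := ler_wpM2l h3 support_le.
rewrite h1; lra.
Qed.

Lemma ln_constE : ln (expR 251 * n%:R ^+ 6) = 251 + 6 * ln n%:R :> R.
Proof.
by rewrite lnM ?posrE ?expR_gt0 ?exprn_gt0 ?ltr0n// lnXn ?ltr0n// expRK mulr_natl.
Qed.

(** With $a=ns$ and $L=\ln n$, squaring leaves $22\sqrt{a(15+6L)}+121\le 236a$, where $236=251-15$.
    Since $L\le n\le a$, the root is at most $5a$, and $110a+121\le 231a$. *)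
Lemma width_gap : Num.sqrt ((n * s)%:R * (15 + 6 * ln n%:R)) + 11 <=
  Num.sqrt ((n * s)%:R * ln (expR 251 * n%:R ^+ 6)) :> R.
Proof.
rewrite ln_constE.
set a : R := (n * s)%:R; set L : R := ln n%:R.
have L0 : 0 <= L by exact: ln_ge0n.
have a1 : 1 <= a by rewrite ler1n muln_gt0 n0.
have La : L <= a.
  have na : n%:R <= a by rewrite ler_nat leq_pmulr.
  apply: le_trans na; have n1 : 1 <= n%:R :> R by rewrite ler1n.
  have -> : L = ln (1 + (n%:R - 1)) by congr ln; ring.
  by apply: (le_trans (le_ln1Dx _)); lra.
have b5 : Num.sqrt (a * (15 + 6 * L)) <= 5 * a.
  rewrite -(ler_pXn2r (n := 2))// ?nnegrE ?sqrtr_ge0//; last by lra.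
  by rewrite sqr_sqrtr ?mulr_ge0//; nra.
rewrite -(ler_pXn2r (n := 2))// ?nnegrE ?addr_ge0 ?sqrtr_ge0//.
rewrite sqr_sqrtr; last by rewrite mulr_ge0//; lra.
have h2 : 0 <= a * (15 + 6 * L) by rewrite mulr_ge0//; lra.
rewrite sqrrD sqr_sqrtr//; nra.
Qed.

Variables (d : measure_display) (T : measurableType d) (P : probability T R) (m p : nat).
Variables (G : 'I_m * 'I_n * 'I_n -> {RV P >-> R}) (x : 'I_p -> 'M[R]_n).
Hypothesis iidG : iid_standard_normal G.
Hypothesis slope_x : forall h, l1_slope X (x h) <= 0.
Hypothesis x1 : forall h, \sum_(e : E) x h e.1 e.2 ^+ 2 = 1.

(** The lower bound, the comparison and the upper bound are chained at $l=t+1$, and the probability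
    of the scalar event is divided out. The result is uniform in [p]. The radius [r + 1] leaves room
    for approximating directions. *)
Lemma finite_escape (t r : R) : 0 < t -> 0 <= r ->
  (t + r + Num.sqrt ((n * s)%:R * ln (expR 251 * n%:R ^+ 6))) ^+ 2 <= m%:R ->
  fine (P (small_image G x (r + 1))) <= expR (- (t ^+ 2) / 2).
Proof.
move=> t0 r0 hm; have gap := width_gap.
set B0 : R := Num.sqrt ((n * s)%:R * (15 + 6 * ln n%:R)) in gap.
set B : R := Num.sqrt _ in hm gap.
have B00 : 0 <= B0 by exact: sqrtr_ge0.
have sm : t + r + B <= Num.sqrt m%:R.
  rewrite -(ler_pXn2r (n := 2))// ?nnegrE ?sqrtr_ge0//; last by rewrite !addr_ge0 ?(ltW t0)// sqrtr_ge0.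
  by rewrite [leRHS]sqr_sqrtr// ler0n.
have l0 : 0 <= t + 1 by lra.
have mdl := matrix_dirs_ge x iidG (r + 1) l0.
have x1' h : \sum_i \sum_j x h i j ^+ 2 = 1 by rewrite pair_bigA x1.
have gc := gordon_comparison (m := m) x1' (1 + (r + 1) - (t + 1)) 0.
have tau0 : 0 <= tau by exact: sqrtr_ge0.
have pB : \prod_(e <- enum {: E}) shrink_mgf X tau e <= expR (B0 ^+ 2 / 3).
  apply: (le_trans prod_shrink_mgf_le); rewrite ler_expR sqr_sqrtr.
    by have n1 := ler0n R (n * s); lra.
  by rewrite mulr_ge0// addr_ge0// mulr_ge0.
have vd := vector_dirs_le tau0 m slope_x x1 (1 + (r + 1) - (t + 1)) l0 B00 pB.
have := le_trans mdl (le_trans gc vd).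
set p0 := fine _; set e1 := expR (- _); set e2 := expR _ => main.
have e10 : 0 < e1 by exact: expR_gt0.
have : p0 <= 16 * (e2 / e1).
  by rewrite mulrA ler_pdivlMr//; move: main; lra.
move=> /le_trans; apply; rewrite /e2 /e1 -expRN opprK -expRD.
have e16 : 16 <= expR 4 :> R.
  rewrite -[X in expR X]mulr1 expRM_natl; apply: (@le_trans _ _ (2 ^+ 4)); first by lra.
  by rewrite ler_pXn2r ?nnegrE ?expR_ge0//; have := expR_ge1Dx (1 : R); lra.
apply: (@le_trans _ _ (expR 4 * expR (- (t ^+ 2) / 2 - 4))); last by rewrite -expRD ler_expR; lra.
apply: ler_pM e16 _; rewrite ?expR_ge0//.
rewrite ler_expR.
(* The exponent is at most $(t+1)^2-(t+1)(2t+7)+(t+2)^2/2=-t^2/2-5t-4$. *)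
have := ler_wpM2l l0 sm; have := ler_wpM2l l0 gap.
nra.
Qed.

End finite_escape.

(** * Recovery *)

Lemma mxdotE (R : realType) (n : nat) (X Y : 'M[R]_n) :
  mxdot X Y = \sum_(e : 'I_n * 'I_n) X e.1 e.2 * Y e.1 e.2.
Proof.
rewrite /mxdot /mxtrace -(pair_bigA _ (fun i j => X i j * Y i j))/= exchange_big/=.
by apply: eq_bigr => j _; rewrite mxE; apply: eq_bigr => i _; rewrite mxE.
Qed.

Lemma frobenius_normE (R : realType) (n : nat) (Z : 'M[R]_n) :
  frobenius_norm Z = Num.sqrt (\sum_(e : 'I_n * 'I_n) Z e.1 e.2 ^+ 2).
Proof. by rewrite /frobenius_norm mxdotE. Qed.

Lemma l2normB (R : realType) (m : nat) (u v : 'cV[R]_m) :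
  l2norm (u - v) <= l2norm u + l2norm v.
Proof.
have := sqrt_sum_sqrD (fun i => u i 0) (fun i => - v i 0).
rewrite /l2norm (eq_bigr (fun i => (u - v) i 0 ^+ 2)); last by move=> i _; rewrite !mxE.
by under [X in _ + Num.sqrt X]eq_bigr do rewrite sqrrN.
Qed.

Lemma measurementB (R : realType) (m n : nat) (Phi : 'I_m -> 'M[R]_n) (Y Z : 'M[R]_n) :
  measurement Phi (Y - Z) = measurement Phi Y - measurement Phi Z.
Proof. by apply/matrixP => k j; rewrite !mxE /mxdot mulmxBr linearB. Qed.

Section minimizer.
Variables (R : realType) (m n : nat) (Phi : 'I_m -> 'M[R]_n).
Variables (X Z : 'M[R]_n) (e : 'cV[R]_m) (eta : R).
Hypothesis e_le : l2norm e <= eta.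
Hypothesis minZ : is_minimizer Phi (measurement Phi X + e) eta Z.

Lemma l1norm_ge0 (v : 'cV[R]_n) : 0 <= l1norm v.
Proof. by rewrite sumr_ge0. Qed.

(* Flatness turns the bound on the largest column of [Z] into a bound on
   every column, so that [Z] has no larger entrywise l1 norm than [X]. *)
Lemma minimizer_slope : l1_column_flat X -> l1_slope X (Z - X) <= 0.
Proof.
move=> flatX; case: minZ => _ /(_ X) minX.
have colZ j : l1norm (col j Z) <= l1norm (col j X).
  apply: le_trans (le_trans (minX _) _).
  - by apply: (le_bigmax _ (fun j => l1norm (col j Z))).
  - by rewrite addrC addKr.
  - by apply: bigmax_le => [|k _]; [exact: l1norm_ge0|rewrite (flatX k j)].
apply: (@le_trans _ _ (\sum_(a : 'I_n * 'I_n) (`|Z a.1 a.2| - `|X a.1 a.2|))).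
  apply: ler_sum => a _; rewrite !mxE; case: ifPn => [_|/negPn/eqP ->].
    rewrite mulrBr -normrEsg lerD2r.
    apply: (le_trans (ler_norm _)); rewrite normrM normr_sg.
    by case: (X _ _ != 0); rewrite ?mul1r ?mul0r.
  by rewrite subr0 normr0 subr0.
rewrite -(pair_bigA _ (fun i j => `|Z i j| - `|X i j|))/= exchange_big/=.
apply: sumr_le0 => j _; rewrite sumrB subr_le0.
by have := colZ j; rewrite /l1norm; under eq_bigr do rewrite mxE; under [leRHS]eq_bigr do rewrite mxE.
Qed.

Lemma minimizer_image : l2norm (measurement Phi (Z - X)) <= 2 * eta.
Proof.
case: minZ => feasZ _.
have -> : measurement Phi (Z - X) = e - (measurement Phi X + e - measurement Phi Z).
  by rewrite measurementB opprB opprD addrCA [- _ - _]addrC addNKr.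
apply: (le_trans (l2normB _ _)).
by move: e_le feasZ; lra.
Qed.

End minimizer.

(** * From finitely many directions to the whole descent cone *)

Lemma sqrt_sum_sqr_le (R : rcfType) (I : finType) (a : I -> R) :
  Num.sqrt (\sum_i a i ^+ 2) <= \sum_i `|a i|.
Proof.
have s0 : 0 <= \sum_i `|a i| by exact: sumr_ge0.
rewrite -(ler_pXn2r (n := 2))// ?nnegrE ?sqrtr_ge0//.
rewrite sqr_sqrtr; last by apply: sumr_ge0 => i _; exact: sqr_ge0.
rewrite [leRHS]expr2 mulr_suml; apply: ler_sum => i _.
rewrite -(real_normK (num_real (a i))) expr2 ler_wpM2l//.
by rewrite (bigD1 i)//= lerDl sumr_ge0.
Qed.

(** Points with rational coordinates may miss [K], so a point of [K] is chosen near each of them, at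
    each scale [del N], whenever there is one. Indices without such a point get the default [h0]. *)
Lemma countable_dense (R : realType) (I : finType) (K : set (I -> R)) h0 : K h0 ->
  exists y : nat -> I -> R, (forall k, K (y k)) /\
    forall h (eps : R), K h -> 0 < eps -> exists k, forall i, `|y k i - h i| <= eps.
Proof.
move=> Kh0; pose del (N : nat) : R := N.+1%:R^-1.
pose near (q : {ffun I -> rat} * nat) : set (I -> R) :=
  [set h | K h /\ forall i, `|h i - ratr (q.1 i)| <= del q.2].
exists (fun k => oapp (fun q => xget h0 (near q)) h0 (unpickle k)); split.
  move=> k; case: (unpickle k) => //= q.
  by case: xgetP => // h _ [].
move=> h eps Kh eps0.
have [N Neps] : exists N, del N <= eps / 2.
  have e2 : 0 < eps / 2 by rewrite divr_gt0.
  exists (Num.trunc (eps / 2)^-1).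
  by rewrite /del invf_ple ?posrE// ltW// truncnS_gt.
have N0 : 0 < del N by rewrite invr_gt0.
have /choice[q qP] : forall i, exists q : rat, `|h i - ratr q| <= del N.
  move=> i; have lt_i : h i - del N < h i + del N by lra.
  have [q] := rat_in_itvoo lt_i.
  by rewrite in_itv/= => /andP[q1 q2]; exists q; rewrite ler_norml; apply/andP; split; lra.
pose c : {ffun I -> rat} * nat := ([ffun i => q i], N).
have nc : near c h by split=> // i; rewrite ffunE.
exists (pickle c) => i; rewrite pickleK/=.
case: xgetP => [h' _ [_ h'P]|/(_ h)//].
have := h'P i; have := qP i; rewrite /= ffunE => q1 q2.
rewrite (_ : _ - _ = (h' i - ratr (q i)) - (h i - ratr (q i))); last by ring.
by apply: (le_trans (ler_normB _ _)); lra.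
Qed.

Section net_bound.
Variables (R : realType) (d : measure_display) (T : measurableType d) (P : probability T R).
Variables (m n : nat) (G : 'I_m * 'I_n * 'I_n -> {RV P >-> R}).

Lemma image_norm_le_near (h h' : 'M[R]_n) eps w : 0 <= eps ->
  (forall i j, `|h' i j - h i j| <= eps) ->
  image_norm G h' w <= image_norm G h w +
    eps * \sum_k \sum_(e : 'I_n * 'I_n) `|G (k, e.1, e.2) w|.
Proof.
move=> eps0 near_h.
pose a k := \sum_(e : 'I_n * 'I_n) G (k, e.1, e.2) w * (h' e.1 e.2 - h e.1 e.2).
have -> : image_norm G h' w =
    Num.sqrt (\sum_k (\sum_(e : 'I_n * 'I_n) G (k, e.1, e.2) w * h e.1 e.2 + a k) ^+ 2).
  congr Num.sqrt; apply: eq_bigr => k _; congr (_ ^+ 2).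
  by rewrite -big_split/=; apply: eq_bigr => e _; ring.
apply: (le_trans (sqrt_sum_sqrD _ _)); rewrite lerD2l.
apply: (le_trans (sqrt_sum_sqr_le _)); rewrite mulr_sumr; apply: ler_sum => k _.
apply: (le_trans (ler_norm_sum _ _ _)); rewrite mulr_sumr; apply: ler_sum => e _.
by rewrite normrM mulrC ler_wpM2r.
Qed.

(** Continuity from below along the finite unions; the bound must not depend on their length. *)
Lemma probability_bigcup_le (E : nat -> set T) (b : R) :
  (forall k, measurable (E k)) ->
  (forall p, (P (\bigcup_(k in `I_p) E k) <= b%:E)%E) ->
  (P (\bigcup_k E k) <= b%:E)%E.
Proof.
move=> mE Eb; pose F p := \bigcup_(k in `I_p) E k.
have mF p : measurable (F p) by exact: bigcup_measurable.
have FE : \bigcup_p F p = \bigcup_k E k.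
  apply/seteqP; split => w; first by move=> [p _ [k _ Ekw]]; exists k.
  by move=> [k _ Ekw]; exists k.+1 => //; exists k => //=.
have ndF : nondecreasing_seq F.
  by move=> p q pq; apply/subsetPset => w [k /= kp Ekw]; exists k => //=; exact: leq_trans pq.
have cvgF := nondecreasing_cvg_mu mF (bigcup_measurable (fun p _ => mF p)) ndF.
have cvgPF := cvgF R P.
rewrite -FE -(cvg_lim _ cvgPF)//; apply: lime_le; first by apply/cvg_ex; eexists; exact: cvgPF.
by apply: nearW => p; exact: Eb.
Qed.

(** The Lipschitz constant [M] of the image norm depends on [w], so no net of fixed mesh would do.
    With a dense sequence the mesh $1/(M+1)$ is chosen after [w], and moving to the nearby member of
    the sequence raises the norm by at most 1. *)
Lemma descent_cone_escape (s : nat) (X : 'M[R]_n) (t r : R) :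
  (0 < n)%N -> (0 < s)%N -> column_sparse s X -> iid_standard_normal G ->
  0 < t -> 0 <= r ->
  (t + r + Num.sqrt ((n * s)%:R * ln (expR 251 * n%:R ^+ 6))) ^+ 2 <= m%:R ->
  exists A : set T, [/\ measurable A, ((1 - expR (- (t ^+ 2) / 2))%:E <= P A)%E &
    forall w h, A w -> l1_slope X h <= 0 ->
      \sum_(e : 'I_n * 'I_n) h e.1 e.2 ^+ 2 = 1 -> r < image_norm G h w].
Proof.
move=> n0 s0 sparseX iidG t0 r0 hm.
pose mx (f : 'I_n * 'I_n -> R) : 'M[R]_n := \matrix_(i, j) f (i, j).
pose K : set ('I_n * 'I_n -> R) := [set f | l1_slope X (mx f) <= 0 /\
  \sum_(e : 'I_n * 'I_n) mx f e.1 e.2 ^+ 2 = 1].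
have Kmx h : l1_slope X h <= 0 -> \sum_(e : 'I_n * 'I_n) h e.1 e.2 ^+ 2 = 1 ->
    K (fun e => h e.1 e.2).
  move=> slope h1; rewrite /K/= (_ : mx _ = h)//.
  by apply/matrixP => i j; rewrite mxE.
(* The cone may contain no unit vector, as for [X = 0]; then every outcome qualifies. *)
have [[f0 Kf0]|K0] := pselect (exists f, K f); last first.
  exists setT; split => //; first by rewrite probability_setT lee_fin gerBl expR_ge0.
  by move=> w h _ slope h1; case: K0; eexists; exact: Kmx slope h1.
have [y [Ky densey]] := countable_dense Kf0.
pose E k := [set w | image_norm G (mx (y k)) w <= r + 1].
have mE k : measurable (E k) by exact: measurable_image_norm_le.
have mU : measurable (\bigcup_k E k) by exact: bigcup_measurable.
exists (~` \bigcup_k E k); split; first exact: measurableC.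
  have : (P (\bigcup_k E k) <= (expR (- (t ^+ 2) / 2))%:E)%E.
    apply: probability_bigcup_le => // p.
    pose x (k : 'I_p) := mx (y k).
    have -> : \bigcup_(k in `I_p) E k = small_image G x (r + 1).
      apply/seteqP; split => w; first by move=> [k /= kp Ekw]; exists (Ordinal kp).
      by move=> [k xk]; exists k => //=.
    rewrite -(@fineK _ (P _)) ?lee_fin; last by rewrite fin_num_measure//; exact: measurable_small_image.
    apply: (finite_escape n0 s0 sparseX iidG) => //.
    - by move=> k; case: (Ky k).
    - by move=> k; case: (Ky k).
  rewrite probability_setC// EFinB => PU.
  by rewrite leeD2l// leeN2.
move=> w h Aw slope h1; rewrite ltNge; apply/negP => small_h; apply: Aw.
pose M := \sum_k \sum_(e : 'I_n * 'I_n) `|G (k, e.1, e.2) w|.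
have M0 : 0 <= M by apply: sumr_ge0 => k _; exact: sumr_ge0.
have eps0 : 0 < (M + 1)^-1 by rewrite invr_gt0 ltr_wpDl.
have [k near_k] := densey _ _ (Kmx h slope h1) eps0.
exists k => //; rewrite /E/=.
apply: (le_trans (image_norm_le_near (h := h) w (ltW eps0) _)).
  by move=> i j; rewrite mxE; exact: (near_k (i, j)).
apply: lerD => //; rewrite mulrC ler_pdivrMr ?mul1r; last by rewrite ltr_wpDl.
by rewrite lerDl.
Qed.

End net_bound.

(** * Rescaling, degenerate signals and the recovery theorem *)

Lemma l1_slopeZ (R : realType) (n : nat) (X h : 'M[R]_n) (c : R) : 0 <= c ->
  l1_slope X (c *: h) = c * l1_slope X h.
Proof.
move=> c0; rewrite /l1_slope mulr_sumr; apply: eq_bigr => e _; rewrite mxE.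
by case: ifP => _; [rewrite mulrCA|rewrite normrM ger0_norm].
Qed.

Lemma l1_slope0_le0 (R : realType) (n : nat) (h : 'M[R]_n) :
  l1_slope 0 h <= 0 -> h = 0.
Proof.
move=> slope.
have sum0 : \sum_(e : 'I_n * 'I_n) `|h e.1 e.2| = 0.
  apply/eqP; rewrite eq_le sumr_ge0// andbT; apply: le_trans slope.
  by rewrite /l1_slope le_eqVlt; under [X in _ == X]eq_bigr do rewrite mxE eqxx; rewrite eqxx.
apply/matrixP => i j; rewrite mxE; apply/eqP; rewrite -normr_eq0; apply/eqP.
by apply: (psumr_eq0P _ sum0 (i := (i, j))).
Qed.

Lemma column_sparse0 (R : realType) (n : nat) (X : 'M[R]_n) : column_sparse 0 X -> X = 0.
Proof.
move=> X0; apply/matrixP => i j; rewrite mxE; apply/eqP.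
by have := X0 j; rewrite leqn0 cards_eq0 => /eqP /setP /(_ i); rewrite !inE => /negbFE.
Qed.

Section conclusion.
Variables (R : realType) (d : measure_display) (T : measurableType d) (P : probability T R).
Variables (m n : nat) (G : 'I_m * 'I_n * 'I_n -> {RV P >-> R}).

Lemma image_normE w h :
  image_norm G h w = l2norm (measurement (fun k => \matrix_(i, j) G (k, i, j) w) h).
Proof.
congr Num.sqrt; apply: eq_bigr => k _; rewrite mxE mxdotE; congr (_ ^+ 2).
by apply: eq_bigr => e _; rewrite mxE.
Qed.

Lemma image_normZ w h c : 0 <= c -> image_norm G (c *: h) w = c * image_norm G h w.
Proof.
move=> c0; rewrite /image_norm -[c in RHS](ger0_norm c0) -sqrtr_sqr -sqrtrM ?sqr_ge0//.
congr Num.sqrt; rewrite mulr_sumr; apply: eq_bigr => k _; rewrite -exprMn mulr_sumr.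
by congr (_ ^+ 2); apply: eq_bigr => e _; rewrite mxE mulrCA.
Qed.

(** Were the norm of [h] above [delta], then [h] divided by its norm would be a unit vector of the
    cone with image at most [b / delta]. *)
Lemma frobenius_le_of_escape w (X h : 'M[R]_n) (b delta : R) : 0 < delta -> 0 <= b ->
  (forall u, l1_slope X u <= 0 -> \sum_(e : 'I_n * 'I_n) u e.1 e.2 ^+ 2 = 1 ->
    b / delta < image_norm G u w) ->
  l1_slope X h <= 0 -> image_norm G h w <= b -> frobenius_norm h <= delta.
Proof.
move=> delta0 b0 escape slope hb; rewrite leNgt; apply/negP => big_h.
have F0 : 0 < frobenius_norm h by exact: lt_trans big_h.
have c0 : 0 <= (frobenius_norm h)^-1 by rewrite invr_ge0 ltW.
have := escape ((frobenius_norm h)^-1 *: h).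
rewrite l1_slopeZ// image_normZ// mulr_ge0_le0// => /(_ isT).
have h1 : \sum_(e : 'I_n * 'I_n) ((frobenius_norm h)^-1 *: h) e.1 e.2 ^+ 2 = 1.
  under eq_bigr do rewrite mxE exprMn.
  rewrite -mulr_sumr -[X in _ * X]sqr_sqrtr; last by apply: sumr_ge0 => e _; exact: sqr_ge0.
  by rewrite -frobenius_normE -exprMn mulVf ?expr1n// gt_eqF.
move=> /(_ h1); apply/negP; rewrite -leNgt.
rewrite mulrC; apply: ler_pM => //; first exact: sqrtr_ge0.
by rewrite lef_pV2 ?posrE// ltW.
Qed.

End conclusion.

Theorem theorem5p1 (R : realType) :
  exists C : R, 0 < C /\
  forall (d : measure_display) (T : measurableType d) (P : probability T R)
    (m n s : nat)
    (G : 'I_m * 'I_n * 'I_n -> {RV P >-> R})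
    (X : 'M[R]_n) (eta t delta : R)
    (e : T -> 'cV[R]_m) (Xstar : T -> 'M[R]_n),
  let Phi := fun (w : T) (k : 'I_m) => \matrix_(i, j) G (k, i, j) w in
  let y := fun w : T => measurement (Phi w) X + e w in
  iid_standard_normal G ->
  column_sparse s X ->
  l1_column_flat X ->
  0 <= eta ->
  (forall w, l2norm (e w) <= eta) ->
  (forall w, is_minimizer (Phi w) (y w) eta (Xstar w)) ->
  0 < t ->
  0 < delta ->
  (t + 2 * eta / delta +
     Num.sqrt ((n * s)%:R * ln (C * n%:R ^+ 6))) ^+ 2 <= m%:R ->
  (* [|Xstar - X|_F <= delta] need not be measurable, as neither [e] nor
     [Xstar] is assumed to be: the bound is on its inner probability. *)
  exists A : set T,
    [/\ measurable A,
        A `<=` [set w | frobenius_norm (Xstar w - X) <= delta] &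
        ((1 - expR (- (t ^+ 2) / 2))%:E <= P A)%E].
Proof.
exists (expR 251); split; first exact: expR_gt0.
move=> d T P m n s G X eta t delta e Xstar Phi y iidG sparseX flatX eta0 e_le minX t0 delta0 hm.
have slope w : l1_slope X (Xstar w - X) <= 0 := minimizer_slope (e_le w) (minX w) flatX.
have image_le w : image_norm G (Xstar w - X) w <= 2 * eta.
  by rewrite image_normE; exact: minimizer_image (e_le w) (minX w).
have trivial_case : (forall w, Xstar w - X = 0) -> exists A : set T,
    [/\ measurable A, A `<=` [set w | frobenius_norm (Xstar w - X) <= delta] &
        ((1 - expR (- (t ^+ 2) / 2))%:E <= P A)%E].
  move=> H0; exists setT; split => //; last by rewrite probability_setT lee_fin gerBl expR_ge0.
  move=> w _ /=; rewrite H0 frobenius_normE big1 ?sqrtr0 ?(ltW delta0)// => a _.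
  by rewrite mxE expr0n.
(* The estimates require $ns\ge 1$. For [n = 0] all matrices coincide; for [s = 0] the signal is 0,
   and its descent cone is trivial, so recovery is exact. *)
have [n0|n0] := posnP n.
  by apply: trivial_case => w; apply/matrixP => i; have := ltn_ord i; rewrite [X in (_ < X)%N]n0.
have [s0|s0] := posnP s.
  apply: trivial_case => w; apply: l1_slope0_le0.
  by have := slope w; rewrite s0 in sparseX; rewrite {1}(column_sparse0 sparseX).
have b0 : 0 <= 2 * eta by rewrite mulr_ge0.
have r0 : 0 <= 2 * eta / delta by rewrite divr_ge0// ltW.
(* [A] is determined by the operator and [X] before the noise or the minimizer is looked at; on it
   any choice of [e w] and [Xstar w] is handled pointwise. *)
have [A [mA PA escape]] := descent_cone_escape n0 s0 sparseX iidG t0 r0 hm.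
exists A; split => // w Aw.
apply: (frobenius_le_of_escape delta0 b0 _ (slope w) (image_le w)) => u.
exact: escape Aw.
Qed.
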